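(* Let $\mu>0$ and $\lambda_n=n\mu$. For each $n\ge1$ let $A_{\lambda_n}$ be a Poisson process of rate $\lambda_n$ and $S_{\mu,k}$, $k\ge1$, Poisson processes of rate $\mu$, all mutually independent and independent of the nonnegative-integer-valued random variable $Q_n(0)$, and let $Q_n$ be determined by $$Q_n(t)=Q_n(0)+A_{\lambda_n}(t)-\sum_{k=1}^\infty\int_0^t1_{\{Q_n(s-)\ge k\}}\,dS_{\mu,k}(s),\quad t\ge0.$$ Let $X_n(t)=(Q_n(t)-n)/\sqrt n$ and $$M_{n,1}(t)=\frac{A_{\lambda_n}(t)-\lambda_nt}{\sqrt n},\qquad M_{n,2}(t)=\frac1{\sqrt n}\left[\sum_{k=1}^\infty\int_0^t1_{\{Q_n(s-)\ge k\}}\,dS_{\mu,k}(s)-\mu\int_0^tQ_n(s-)\,ds\right].$$ If $E[Q_n(0)]<\infty$ for each $n\ge1$, then $$X_n(t)=X_n(0)+M_{n,1}(t)-M_{n,2}(t)-\mu\int_0^tX_n(s)\,ds,\quad t\ge0,$$ and $M_{n,1},M_{n,2}$ are square-integrable martingales with respect to the filtration $\mathbf F_n=\{\mathcal F_{n,t}:t\ge0\}$ defined by $$\mathcal F_{n,t}=\sigma\left(Q_n(0),A_{\lambda_n}(s),S_{\mu,k}(s),k\ge1:0\le s\le t\right),$$ augmented by including all null sets. Their predictable quadratic variations are $$\langle M_{n,1}\rangle(t)=\frac{\lambda_nt}{n}=\mu t,\qquad\langle M_{n,2}\rangle(t)=\frac\mu n\int_0^tQ_n(s)\,ds,\quad t\ge0,$$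 with $E[\langle M_{n,2}\rangle(t)]<\infty$ for all $t\ge0$, $n\ge1$, and their optional quadratic variations are $$[M_{n,1}](t)=\frac{A_{\lambda_n}(t)}{n},\qquad[M_{n,2}](t)=\frac1n\sum_{k=1}^\infty\int_0^t1_{\{Q_n(s-)\ge k\}}\,dS_{\mu,k}(s),\quad t\ge0.$$
   Context: A martingale $M$ is square integrable if $E[M(t)^2]<\infty$ for each $t\ge0$. For such $M$ the predictable quadratic variation $\langle M\rangle$ is the unique nondecreasing nonnegative predictable process with $E[\langle M\rangle(t)]<\infty$ for all $t$ such that $M^2-\langle M\rangle$ is a martingale (with $\langle M\rangle(0)=0$ when $M(0)=0$). For a local martingale $M$ with $M(0)=0$, the optional quadratic variation $[M]$ is the unique process of finite variation on bounded intervals with $[M](0)=0$ such that $M^2-[M]$ is a local martingale and $\Delta[M]=(\Delta M)^2$, where $\Delta M(t)=M(t)-M(t-)$. $Q_n(s-)$ denotes the left limit. The defining equation for $Q_n$ is solved recursively over successive jump times. *)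

(* Defs.v *)
From HB Require Import structures.
From mathcomp Require Import all_boot all_order all_algebra.
From mathcomp Require Import all_classical all_reals all_analysis.
Set Implicit Arguments.
Unset Strict Implicit.
Unset Printing Implicit Defensive.
Import Order.TTheory GRing.Theory Num.Theory.
Import numFieldNormedType.Exports.

Local Open Scope classical_set_scope.
Local Open Scope ring_scope.

(* Paths are functions on R of which only the restriction to [0, +oo[ matters. *)
Section paths.
Context {R : realType}.
Implicit Types f : R -> R.

Definition left_limit f (t : R) : R := lim (f x @[x --> t^'-]).

Definition jump f (t : R) : R := f t - left_limit f t.

Definition cadlag f : Prop :=
  (forall t, 0 <= t -> f x @[x --> t^'+] --> f t) /\
  (forall t, 0 < t -> cvg (f x @[x --> t^'-])).

Definition left_continuous_path f : Prop :=
  forall t, 0 < t -> f x @[x --> t^'-] --> f t.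

Definition counting_path f : Prop :=
  [/\ f 0 = 0,
      forall t, 0 <= t -> f t \is a Num.nat,
      forall s t, 0 <= s -> s <= t -> f s <= f t
    & forall t, 0 <= t -> f x @[x --> t^'+] --> f t].

(* The Lebesgue-Stieltjes measure of an unbundled function; it is the zero
   measure when f is not nondecreasing and right-continuous. *)
Definition stieltjes (f : R -> R) : {measure set (measurableTypeR R) -> \bar R} :=
  match pselect (nondecreasing f /\ right_continuous f) with
  | left fP => lebesgue_stieltjes_measure
      (HB.pack_for (cumulative R R) f (isCumulative.Build _ _ _ f fP.1 fP.2))
  | right _ => mzero
  end.

(* The path f is prolonged by f 0 to the left of 0 so that it defines a
   Lebesgue-Stieltjes measure on the whole line. *)
Definition prolonged f (s : R) : R := f (Num.max 0 s).

Definition path_integral (g f : R -> R) (t : R) : \bar R :=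
  (\int[stieltjes (prolonged f)]_(s in `]0%R, t]%classic) (g s)%:E)%E.

End paths.

Section processes.
Context {d : measure_display} {T : measurableType d} {R : realType}.
Variable P : probability T R.
Implicit Types (X Y M V N : R -> T -> R) (G : set (set T))
  (F : R -> set (set T)).

Definition sigma_rv (Z : T -> R) : set (set T) :=
  preimage_set_system setT Z measurable.

Definition sigma_process X : set (set T) :=
  <<s \bigcup_(t in [set t | 0 <= t]) sigma_rv (X t) >>.

Definition mutually_independent (G : nat -> set (set T)) : Prop :=
  forall (J : seq nat) (E : nat -> set T), uniq J ->
    (forall i, i \in J -> G i (E i)) ->
    P (\bigcap_(i in [set` J]) E i) = (\prod_(i <- J) P (E i))%E.

Definition poisson_process (rate : R) N : Prop :=
  [/\ forall t, 0 <= t -> measurable_fun setT (N t),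
      forall w, counting_path (N ^~ w),
      forall t : nat -> R, 0 <= t 0%N -> nondecreasing_seq t ->
        mutually_independent
          (fun i => sigma_rv (fun w => N (t i.+1) w - N (t i) w))
    & forall (s t : R) (k : nat), 0 <= s -> s < t ->
        P [set w | N t w - N s w = k%:R] =
        (poisson_pmf (rate * (t - s)) k)%:E].

(* A filtration is a family F indexed by R, of which only the F t with 0 <= t
   matter. *)
Definition adapted F X : Prop := forall t, 0 <= t -> sigma_rv (X t) `<=` F t.

Definition is_conditional_expectation G (Z Y : T -> R) : Prop :=
  [/\ sigma_rv Y `<=` G,
      P.-integrable setT (EFin \o Y)
    & forall B, G B -> (\int[P]_(w in B) (Z w)%:E = \int[P]_(w in B) (Y w)%:E)%E].

Definition martingale F M : Prop :=
  [/\ forall w, cadlag (M ^~ w),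
      adapted F M,
      forall t, 0 <= t -> P.-integrable setT (EFin \o M t)
    & forall s t, 0 <= s -> s <= t ->
        is_conditional_expectation (F s) (M t) (M s)].

Definition square_integrable_martingale F M : Prop :=
  martingale F M /\
  forall t, 0 <= t -> ('E_P[fun w => (M t w ^+ 2)%R] < +oo)%E.

Definition stopping_time F (tau : T -> \bar R) : Prop :=
  (forall w, (0 <= tau w)%E) /\
  (forall t, 0 <= t -> F t [set w | (tau w <= t%:E)%E]).

Definition stopped (tau : T -> \bar R) X : R -> T -> R :=
  fun t w => X (fine (Order.min t%:E (tau w))) w.

Definition local_martingale F M : Prop :=
  exists tau : nat -> T -> \bar R,
    [/\ forall m, stopping_time F (tau m),
        {ae P, forall w, nondecreasing_seq (tau ^~ w)},
        {ae P, forall w, tau m w @[m --> \oo] --> +oo%E}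
      & forall m, martingale F (stopped (tau m) M)].

Definition half_line : set (R * T) := [set p | 0 <= p.1].

Definition predictable_sigma F : set (set (R * T)) :=
  <<s half_line,
    \bigcup_(Y in [set Y | adapted F Y /\
                           forall w, left_continuous_path (Y ^~ w)])
      preimage_set_system half_line (fun p => Y p.1 p.2) measurable >>.

Definition predictable F V : Prop :=
  preimage_set_system half_line (fun p => V p.1 p.2) measurable
    `<=` predictable_sigma F.

(* V is (a version of) <M>, the processes being identified up to
   indistinguishability. *)
Definition is_predictable_quadratic_variation F M V : Prop :=
  square_integrable_martingale F M /\
  [/\ predictable F V,
      {ae P, forall w, forall s t, 0 <= s -> s <= t -> 0 <= V s w <= V t w},
      {ae P, forall w, M 0 w = 0 -> V 0 w = 0},
      forall t, 0 <= t -> ('E_P[V t] < +oo)%E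
    & martingale F (fun t w => M t w ^+ 2 - V t w)].

(* V is (a version of) [M]. *)
Definition is_optional_quadratic_variation F M V : Prop :=
  [/\ local_martingale F M,
      {ae P, forall w, M 0 w = 0}
    & adapted F V] /\
  [/\ forall w, cadlag (V ^~ w),
      {ae P, forall w, V 0 w = 0},
      {ae P, forall w, forall t, 0 <= t -> bounded_variation 0 t (V ^~ w)},
      {ae P, forall w, forall t, 0 < t ->
        jump (V ^~ w) t = jump (M ^~ w) t ^+ 2}
    & local_martingale F (fun t w => M t w ^+ 2 - V t w)].

End processes.

Section queue.
Context {d : measure_display} {T : measurableType d} {R : realType}.
Variable P : probability T R.
Variable mu : R.
Implicit Types (Q A : R -> T -> R) (S : nat -> R -> T -> R) (n : nat).

Definition arrival_rate n : R := n%:R * mu.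

(* The members of the family of sources of randomness: the initial state, the
   arrival process, and the service processes S 1, S 2, and so on. *)
Definition source Q A S (i : nat) : set (set T) :=
  match i with
  | 0%N => sigma_rv (Q 0)
  | 1%N => sigma_process A
  | k.+2 => sigma_process (S k.+1)
  end.

(* The number of departures in ]0, t]. *)
Definition departures Q S (t : R) (w : T) : \bar R :=
  (\sum_(1 <= k <oo)
    path_integral (\1_[set s | (k%:R <= left_limit (Q ^~ w) s)%R])
                  (S k ^~ w) t)%E.

Definition history Q A S (t : R) : set (set T) :=
  <<s sigma_rv (Q 0)
      `|` \bigcup_(s in `[0, t]) sigma_rv (A s)
      `|` \bigcup_(k in [set k | (1 <= k)%N])
            \bigcup_(s in `[0, t]) sigma_rv (S k s)
      `|` [set B | measurable B /\ P B = 0%E] >>.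

Definition scaled_queue n Q (t : R) (w : T) : R :=
  (Q t w - n%:R) / Num.sqrt n%:R.

Definition M1 n A (t : R) (w : T) : R :=
  (A t w - arrival_rate n * t) / Num.sqrt n%:R.

Definition M2 n Q S (t : R) (w : T) : R :=
  (Num.sqrt n%:R)^-1 *
  (fine (departures Q S t w)
   - mu * \int[lebesgue_measure]_(s in `[0, t]) left_limit (Q ^~ w) s).

End queue.

(* Main.v *)
Require Import Defs.
From mathcomp Require Import all_boot all_order all_algebra.
From mathcomp Require Import all_classical all_reals all_analysis.
From mathcomp Require Import measurable_realfun lra ring.
Import Order.TTheory GRing.Theory Num.Theory.
Import numFieldNormedType.Exports.
Local Open Scope classical_set_scope.
Local Open Scope ring_scope.
Set Implicit Arguments.
Unset Strict Implicit.
Unset Printing Implicit Defensive.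

(** All processes are driven by counting paths, so on a fine enough grid
    u_0 < ... < u_m of [s, t] every path is exactly a sum over the cells: server
    k contributes 1{k <= Q(u_i)} (S_k(u_{i+1}) - S_k(u_i)) departures in cell i.
    This recursion also shows that Q is adapted.  Given the history up to u_i,
    together with all the other sources, the increment of each Poisson process
    over the cell is independent (pi-lambda); hence the compensated cell sums are
    orthogonal, have mean 0, and have second moment
      mu E[sum_i min(Q(u_i)^+, K) (u_{i+1} - u_i)]
    when only K servers are kept.  One passes to the limit in the mesh, then in K
    on the event {Q(0) <= c} (departures are dominated by Q(0) + A(t), whose
    second moment is only finite there), and finally in c by monotone
    convergence.  So M2^2 - <M2> is a martingale, from E[(M(t) - M(s))^2; B] =
    E[<M>(t) - <M>(s); B].  Almost surely two services never jump together, hence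
    the jumps of the departure process are 0 or 1 and Q >= 0.  Finally
    M^2 - [M] = (M^2 - <M>) - n^(-1/2) M is a martingale for both M1 and M2. *)

(** * Counting paths and Riemann sums *)

(** Since only the first moment of Q(0) is finite, domination by Q(0) + A(t) serves for means but
    not for squares. The way out is that {Q(0) <= c} lies in every F_s: it can be intersected with
    the event B over which moments are taken, and c released at the end. For this reason the moment
    identities are stated over an arbitrary event of the history, which is also the form that the
    martingale property asks for. Servers are cut at K because the cell sums are bounded by what
    never idle servers would complete, and infinitely many of those have infinite rate.
    Deterministic grids replace the jump times: an indicator read at the left end of a cell is known
    to the history there. The mesh from which the cell sums are exact depends on the path, which is
    harmless since only pointwise limits are taken. A counting path may jump by two, and services
    may jump together; both are excluded almost surely only. So Q may be negative on a null set, and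
    positive parts stand in the compensators until the moments are known. *)

Section counting_paths.
Context {R : realType}.
Implicit Types f : R -> R.

Lemma near_rightP (x : R) (A : R -> Prop) :
  (\forall y \near x^'+, A y) <->
  exists2 e, 0 < e & forall y, x < y -> y < x + e -> A y.
Proof.
split.
  move=> [e /= e0 eA]; exists e => // y xy yxe; apply: eA => //=.
  by rewrite ltr0_norm ?subr_lt0// opprB ltrBlDl.
move=> [e e0 eA]; exists e => //= y /= + xy.
by rewrite ltr0_norm ?subr_lt0// opprB ltrBlDl; exact: eA.
Qed.

Lemma near_leftP (x : R) (A : R -> Prop) :
  (\forall y \near x^'-, A y) <->
  exists2 e, 0 < e & forall y, x - e < y -> y < x -> A y.
Proof.
split.
  move=> [e /= e0 eA]; exists e => // y xy yxe; apply: eA => //=.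
  by rewrite gtr0_norm ?subr_gt0// ltrBlDl -ltrBlDr.
move=> [e e0 eA]; exists e => //= y /= + xy.
by rewrite gtr0_norm ?subr_gt0// ltrBlDl -ltrBlDr => ?; exact: eA.
Qed.

Lemma eq_nat_num (x y : R) :
  x \is a Num.nat -> y \is a Num.nat -> `|x - y| < 1 -> x = y.
Proof.
move=> /natrP[m ->] /natrP[n ->]; rewrite ltr_norml => /andP[h1 h2].
have {}h1 : (n < m.+1)%N.
  by rewrite -(ltr_nat R) -natr1; lra.
have {}h2 : (m < n.+1)%N.
  by rewrite -(ltr_nat R) -natr1; lra.
by apply/eqP; rewrite eqr_nat eqn_leq; move: h1 h2; rewrite !ltnS => -> ->.
Qed.

Lemma counting_path_right f x : counting_path f -> 0 <= x ->
  exists2 e, 0 < e & forall y, x <= y -> y < x + e -> f y = f x.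
Proof.
move=> [_ fN _ fr] x0.
have /cvgrPdist_lt/(_ _ ltr01)/near_rightP[e e0 he] := fr _ x0.
exists e => // y; rewrite le_eqVlt => /predU1P[-> //|xy] yxe.
apply/esym; apply: eq_nat_num; [exact: fN|apply: fN|exact: he].
by rewrite (le_trans x0)// ltW.
Qed.

(** The left limit comes from integrality: below x the path attains a largest integer value, since
    [f x] bounds it, and by monotonicity it keeps that value until x. *)
Lemma counting_path_left f x : counting_path f -> 0 < x ->
  exists u, [/\ 0 <= u, u < x & forall y, u <= y -> y < x -> f y = f u].
Proof.
move=> [f0 fN fh _] x0.
pose A n := `[< exists u, [/\ 0 <= u, u < x & f u = n%:R] >].
have Aex : exists n, A n by exists 0%N; apply/asboolP; exists 0; rewrite lexx.
have Ale n : A n -> (n <= Num.truncn (f x))%N.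
  move=> /asboolP[u [u0 ux fu]]; rewrite truncn_ge_nat.
    by rewrite -fu fh// ltW.
  by rewrite natr_ge0// fN// ltW.
case: (ex_maxnP Aex Ale) => n /asboolP[u [u0 ux fu]] nmax.
exists u; split => // y uy yx.
have /natrP[m fy] := fN _ (le_trans u0 uy).
apply/eqP; rewrite eq_le [X in _ && X]fh// andbT fy fu ler_nat; apply: nmax.
by apply/asboolP; exists y; split => //; exact: le_trans uy.
Qed.

(** A Lebesgue number argument: by compactness of [0, T], a property of all short intervals near
    each point holds for all intervals shorter than one common length. *)
Lemma uniform_mesh (T : R) (A : R -> R -> Prop) :
  (forall x, 0 <= x -> x <= T -> exists2 e, 0 < e &
    forall u v, 0 <= u -> u <= v -> v <= T -> x - e < u -> v < x + e -> A u v) ->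
  exists2 e, 0 < e &
    forall u v, 0 <= u -> u <= v -> v <= T -> v - u < e -> A u v.
Proof.
move=> H.
pose B (e u : R) := forall v, 0 <= u -> u <= v -> v <= T -> v - u < e -> A u v.
have : \forall e \near 0^'+, `[0, T]%classic `<=` B e.
  apply: (@compact_near_coveringP R^o _).1; first exact: segment_compact.
  move=> x /=; rewrite in_itv/= => /andP[x0 xT].
  have [e e0 eA] := H _ x0 xT.
  exists (ball x (e / 2), [set d | 0 < d /\ d < e / 2]) => /=.
    split; first by apply: nbhsx_ballx; rewrite divr_gt0.
    apply/near_rightP; exists (e / 2); first by rewrite divr_gt0.
    by move=> y y0; rewrite add0r.
  move=> [u d] /= [xu [d0 de]] v u0 uv vT vud; move: xu.
  rewrite -ball_normE /= ltr_norml => /andP[h1 h2]; apply: eA => //; lra.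
move=> /near_rightP[e e0 he]; exists (e / 2); first by rewrite divr_gt0.
move=> u v u0 uv vT vu; apply: (he (e / 2)) => //; [lra|lra|].
by rewrite /= in_itv/= u0 (le_trans uv).
Qed.

(** Around each point the path is constant on either side, so short cells contain at most one jump
    time, and [s] is that time; when the cell has none, [s] may be one of its ends. *)
Lemma counting_path_mesh f T : counting_path f ->
  exists2 e, 0 < e & forall u v, 0 <= u -> u <= v -> v <= T -> v - u < e ->
    exists s, [/\ u <= s, s <= v, forall r, u <= r -> r < s -> f r = f u &
               f v = f s].
Proof.
move=> cf; apply: uniform_mesh => x x0 xT.
have [e e0 he] := counting_path_right cf x0.
have [e' e'0 he'] : exists2 e', 0 < e' & forall y z, x - e' < y -> 0 <= y ->
    y <= z -> z < x -> f z = f y.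
  move: x0; rewrite le_eqVlt => /predU1P[<-|x0].
    by exists 1 => // y z _ y0 yz z0; have := le_lt_trans y0 (le_lt_trans yz z0);
      rewrite ltxx.
  have [u [u0 ux hu]] := counting_path_left cf x0.
  exists (x - u); first by rewrite subr_gt0.
  move=> y z; rewrite subKr => uy _ yz zx.
  by rewrite !hu// ?(le_lt_trans yz)// ?(le_trans (ltW uy))// ltW.
exists (Num.min e e'); first by rewrite lt_min e0.
move=> u v u0 uv vT xu vx.
have {}vx : v < x + e by apply: lt_le_trans vx _; rewrite lerD2l ge_min lexx.
have {}xu : x - e' < u.
  by apply: le_lt_trans xu; rewrite lerD2l lerN2 ge_min lexx orbT.
have [xleu|ultx] := leP x u.
  exists u; split => //; first by move=> r ? ?; lra.
  by rewrite !he//; lra.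
have [vltx|xlev] := ltP v x.
  by exists v; split => // r ur rv; apply: he' => //; lra.
exists x; split => //; [lra| |exact: he].
by move=> r ur rx; apply: he' => //; lra.
Qed.

End counting_paths.

(** * Riemann sums over uniform grids *)

Section riemann_sums.
Context {R : realType}.
Implicit Types f g : R -> R.

Definition mesh (s t : R) (m : nat) : R := (t - s) / m.+1%:R.

Definition grid (s t : R) (m i : nat) : R := s + i%:R * mesh s t m.

Lemma mesh_ge0 s t m : s <= t -> 0 <= mesh s t m.
Proof. by move=> st; rewrite /mesh divr_ge0// subr_ge0. Qed.

Lemma grid0 s t m : grid s t m 0 = s.
Proof. by rewrite /grid mul0r addr0. Qed.

Lemma grid_last s t m : grid s t m m.+1 = t.
Proof.
by rewrite /grid /mesh mulrC divfK ?pnatr_eq0// addrC subrK.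
Qed.

Lemma gridS s t m i : grid s t m i.+1 = grid s t m i + mesh s t m.
Proof. by rewrite /grid -natr1 mulrDl mul1r addrA. Qed.

Lemma le_grid s t m i j : s <= t -> (i <= j)%N -> grid s t m i <= grid s t m j.
Proof.
by move=> st ij; rewrite /grid lerD2l ler_wpM2r ?ler_nat// mesh_ge0.
Qed.

Lemma grid_ge s t m i : s <= t -> s <= grid s t m i.
Proof. by move=> st; rewrite -{1}(grid0 s t m) le_grid. Qed.

Lemma grid_le s t m i : s <= t -> (i <= m.+1)%N -> grid s t m i <= t.
Proof. by move=> st im; rewrite -{2}(grid_last s t m) le_grid. Qed.

Lemma grid_telescope (g : R -> R) s t m :
  g t - g s = \sum_(i < m.+1) (g (grid s t m i.+1) - g (grid s t m i)).
Proof.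
rewrite -(big_mkord xpredT (fun i => g (grid s t m i.+1) - g (grid s t m i))).
by rewrite (telescope_sumr (g \o grid s t m))//= grid_last grid0.
Qed.

Lemma mesh_cvg0 s t : mesh s t m @[m --> \oo] --> (0 : R).
Proof.
rewrite -(mulr0 (t - s)); apply: cvgM; first exact: cvg_cst.
exact: cvg_harmonic.
Qed.

Lemma mesh_small s t e : 0 < e -> s <= t -> \forall m \near \oo, mesh s t m < e.
Proof.
move=> e0 st; have /cvgrPdist_lt/(_ _ e0) := mesh_cvg0 s t.
by apply: filterS => m; rewrite sub0r normrN ger0_norm// mesh_ge0.
Qed.

(** Cells are [u, v[ for [b = true] and ]u, v] for [b = false]. Both kinds occur: samples at left
    ends recover left limits on the second, samples at right ends recover a right-continuous path on
    the first. *)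
Definition cell (b : bool) (s t : R) (m i : nat) : set R :=
  [set` Interval (BSide b (grid s t m i)) (BSide b (grid s t m i.+1))].

Lemma lebesgue_cell b s t m i : s <= t ->
  lebesgue_measure (cell b s t m i) = (mesh s t m)%:E.
Proof.
move=> st; rewrite /cell lebesgue_measure_itv/= lte_fin.
case: ifPn => [_|]; first by rewrite -EFinD gridS addrAC subrr add0r.
rewrite -leNgt gridS gerDl => h; congr EFin; apply/eqP.
by rewrite eq_le h mesh_ge0.
Qed.

Definition step (b : bool) (s t : R) (a : nat -> nat -> R) (m : nat) (r : R) : R :=
  \sum_(i < m.+1) a m i * \1_(cell b s t m i) r.

Lemma stepE b s t a m r : s <= t ->
  [set` Interval (BSide b s) (BSide b t)] r ->
  exists i, [/\ (i < m.+1)%N, cell b s t m i r & step b s t a m r = a m i].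
Proof.
move=> st /=; rewrite in_itv/= => /andP[sr rt].
(* The cell of [r] is the first one whose right end lies beyond [r], strictly or not according to
   [b]. *)
pose A j := r < grid s t m j.+1 ?<= if ~~ b.
have : exists j, A j by exists m; rewrite /A grid_last.
move=> /ex_minnP[i Ai imin].
have im : (i < m.+1)%N by rewrite ltnS imin// /A grid_last.
have lo : grid s t m i < r ?<= if b.
  case: i Ai imin im => [|i] Ai imin im; first by rewrite grid0.
  apply: contraT; rewrite -lteifNE => /(imin _).
  by rewrite ltnn.
exists i; split => //; first by rewrite /cell/= in_itv/= lo.
rewrite /step (bigD1 (Ordinal im))//= big1 ?addr0; last first.
  move=> [j jm] /= /eqP ji; rewrite indicE memNset ?mulr0//.
  rewrite /cell/= in_itv/= => /andP[jr rj].
  have ij : (i <= j)%N by exact: imin.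
  have {}ij : (i.+1 <= j)%N.
    by rewrite ltn_neqAle ij andbT; apply/eqP => e; apply: ji; exact/val_inj.
  have := le_grid m st ij.
  move: Ai jr; rewrite /A; case: b {A sr rt imin lo rj} => /=; lra.
by rewrite indicE mem_set ?mulr1// /cell/= in_itv/= lo.
Qed.

Lemma measurable_step b s t a m : measurable_fun setT (step b s t a m).
Proof.
apply: measurable_sum => i; apply: measurable_funM => //.
by apply: measurable_indic; exact: measurable_itv.
Qed.

Lemma integral_step b s t a m : s <= t ->
  (\int[lebesgue_measure]_(r in [set` Interval (BSide b s) (BSide b t)])
    (step b s t a m r)%:E)%E = (\sum_(i < m.+1) a m i * mesh s t m)%:E.
Proof.
move=> st.
set I := [set` _].
have mI : measurable I by exact: measurable_itv.
have mc (i : nat) : measurable (cell b s t m i) by exact: measurable_itv.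
have ic (i : nat) : lebesgue_measure.-integrable I (EFin \o \1_(cell b s t m i)).
  apply: (integrableS measurableT) => //.
  exact: integrable_indic_itv.
under eq_integral do rewrite /step -sumEFin.
rewrite integral_sum//=; last by move=> i; exact: (integrableZl _ (a m i) (ic i)).
rewrite -sumEFin; apply: eq_bigr => i _.
under eq_integral do rewrite EFinM.
rewrite integralZl//; last exact: ic.
rewrite integral_indic; [|exact: mI|exact: mc].
rewrite setIidl; first by rewrite EFinM; congr (_ * _)%E; exact: lebesgue_cell.
by apply: subset_itv; rewrite /= leBSide implybb /= ?grid_ge ?grid_le.
Qed.

(** A Riemann sum is the integral of a step function, so dominated convergence gives its limit
    together with the integrability of [g]; what has to be checked is pointwise convergence of
    bounded samples. *)
Lemma step_integral_cvg b s t a g C : s <= t ->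
  (forall m i, (i < m.+1)%N -> `|a m i| <= C) ->
  (forall r, [set` Interval (BSide b s) (BSide b t)] r ->
     step b s t a m r @[m --> \oo] --> g r) ->
  lebesgue_measure.-integrable [set` Interval (BSide b s) (BSide b t)] (EFin \o g) /\
  \sum_(i < m.+1) a m i * mesh s t m @[m --> \oo] -->
    \int[lebesgue_measure]_(r in [set` Interval (BSide b s) (BSide b t)]) g r.
Proof.
move=> st aC ag; set I := [set` _].
have mI : measurable I by exact: measurable_itv.
have lI : (lebesgue_measure ([set` Interval (BSide b s) (BSide b t)] : set R) < +oo)%E.
  by rewrite lebesgue_measure_itv/=; case: ifPn => _; rewrite -?EFinB ltry.
have mg : measurable_fun I g.
  apply: (@measurable_fun_cvg _ _ _ _ (step b s t a)) => // m.
  by apply: measurable_funTS; exact: measurable_step.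
have iC : lebesgue_measure.-integrable I (EFin \o cst C).
  apply: measurable_bounded_integrable => //.
  exists `|C|; split; first exact: num_real.
  by move=> M CM x _ /=; exact: ltW.
have [] := @dominated_convergence _ _ _ lebesgue_measure I mI
  (fun m r => (step b s t a m r)%:E) (EFin \o g) (EFin \o cst C).
- move=> m; apply/measurable_EFinP.
  by apply: measurable_funTS; exact: measurable_step.
- exact/measurable_EFinP.
- by apply: aeW => r Ir; apply: cvg_EFin; [near=> m|exact: ag].
- exact: iC.
- apply: aeW => r m Ir /=; rewrite lee_fin.
  by have [i [im _ ->]] := stepE a m st Ir; exact: aC.
move=> ig _ cv; split => //.
rewrite [X in X @ _ --> _](_ : _ = fine \o (fun m =>
    (\int[lebesgue_measure]_(r in I) (step b s t a m r)%:E)%E)); last first.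
  by apply/funext => m; rewrite /= /I integral_step.
apply: fine_cvg; rewrite fineK; last exact: integrable_fin_num.
exact: cv.
Unshelve. all: by end_near. Qed.

End riemann_sums.

(** * Cadlag paths: boundedness and convergence of Riemann sums *)

Section cadlag_paths.
Context {R : realType}.
Implicit Types f : R -> R.

Lemma left_limitP f r : cadlag f -> 0 < r -> f x @[x --> r^'-] --> left_limit f r.
Proof. by move=> [_ +] r0 => /(_ _ r0). Qed.

Lemma left_limit_near f r c :
  (\forall x \near r^'-, f x = c) -> left_limit f r = c.
Proof.
move=> H; apply/cvg_lim; first exact: Rhausdorff.
exact: cvg_near_cst.
Qed.

(** Near a point the path is within 1 of its value on the right and of its left limit on the left;
    compactness of [0, T] turns these local bounds into a single one. *)
Lemma cadlag_bounded f T : cadlag f -> exists C, forall x, 0 <= x -> x <= T -> `|f x| <= C.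
Proof.
move=> [fr fl].
pose B C x := 0 <= x -> `|f x| <= C.
have : \forall C \near +oo, `[0, T]%classic `<=` B C.
  apply: (@compact_near_coveringP R^o _).1; first exact: segment_compact.
  move=> x /=; rewrite in_itv/= => /andP[x0 xT].
  have /cvgrPdist_lt/(_ _ ltr01)/near_rightP[e e0 he] := fr _ x0.
  have [e' [D e'0 he']] : exists e', exists2 D, 0 < e' &
      forall y, 0 <= y -> x - e' < y -> y < x -> `|f y| <= D.
    move: x0; rewrite le_eqVlt => /predU1P[<-|x0].
      by exists 1, 0 => // y y0 _ /(le_lt_trans y0); rewrite ltxx.
    have /cvgrPdist_lt/(_ _ ltr01)/near_leftP[e' e'0 he'] :=
      left_limitP (conj fr fl) x0.
    exists e', (`|left_limit f x| + 1) => // y y0 ey yx.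
    have := he' _ ey yx; have := ler_normB (left_limit f x) (left_limit f x - f y).
    rewrite subKr; lra.
  exists (ball x (Num.min e e'), [set M | Num.max D (`|f x| + 1) < M]) => /=.
    split; first by apply: nbhsx_ballx; rewrite lt_min e0.
    by apply: nbhs_pinfty_gt; exact: num_real.
  move=> [u M] /= [xu +] u0; rewrite gt_max => /andP[DM fM].
  move: xu; rewrite -ball_normE /= lt_min !ltr_norml => /andP[/andP[h1 h2] /andP[h3 h4]].
  have [ux|xu|->] := ltgtP u x; last by lra.
    by apply: le_trans (ltW DM); apply: he' => //; lra.
  have := he u xu; have := ler_normB (f x) (f x - f u).
  rewrite subKr => ? /(_ _); lra.
move=> /filter_ex[C HC].
by exists C => x x0 xT; apply: HC; rewrite //= in_itv/= x0.
Qed.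

Lemma step_left_cvg f s t r : cadlag f -> 0 <= s -> s < r -> r <= t ->
  step false s t (fun m i => f (grid s t m i)) m r @[m --> \oo] --> left_limit f r.
Proof.
move=> cf s0 sr rt; have r0 := le_lt_trans s0 sr.
have st : s <= t by rewrite (le_trans _ rt)// ltW.
apply/cvgrPdist_lt => e e0.
have /cvgrPdist_lt/(_ _ e0)/near_leftP[d d0 hd] := left_limitP cf r0.
apply: filterS (mesh_small d0 st) => m md.
have Ir : [set` Interval (BRight s) (BRight t)] r by rewrite /= in_itv/= sr.
have [i [im + ->]] := stepE (fun m i => f (grid s t m i)) m st Ir.
rewrite /cell/= in_itv/= gridS => /andP[h1 h2]; apply: hd => //; lra.
Qed.

Lemma step_right_cvg f s t r : cadlag f -> 0 <= s -> s <= r -> r < t ->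
  step true s t (fun m i => f (grid s t m i.+1)) m r @[m --> \oo] --> f r.
Proof.
move=> cf s0 sr rt; have r0 := le_trans s0 sr.
have st : s <= t by rewrite (le_trans sr)// ltW.
apply/cvgrPdist_lt => e e0.
have /cvgrPdist_lt/(_ _ e0)/near_rightP[d d0 hd] := cf.1 _ r0.
apply: filterS (mesh_small d0 st) => m md.
have Ir : [set` Interval (BLeft s) (BLeft t)] r by rewrite /= in_itv/= sr.
have [i [im + ->]] := stepE (fun m i => f (grid s t m i.+1)) m st Ir.
rewrite /cell/= in_itv/= gridS => /andP[h1 h2]; apply: hd => //; lra.
Qed.

Section integrals.
Variables (f : R -> R) (s t : R).
Hypotheses (cf : cadlag f) (s0 : 0 <= s) (st : s <= t).

Let left_sums :
  lebesgue_measure.-integrable `]s, t] (EFin \o left_limit f) /\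
  \sum_(i < m.+1) f (grid s t m i) * mesh s t m @[m --> \oo] -->
    \int[lebesgue_measure]_(r in `]s, t]) left_limit f r.
Proof.
have [C hC] := cadlag_bounded t cf.
apply: (@step_integral_cvg _ false s t (fun m i => f (grid s t m i)) _ C st).
  move=> m i im; apply: hC; first by rewrite (le_trans s0)// grid_ge.
  by rewrite grid_le// ltnW.
by move=> r /=; rewrite in_itv/= => /andP[sr rt]; exact: step_left_cvg.
Qed.

Let right_sums :
  lebesgue_measure.-integrable `[s, t[ (EFin \o f) /\
  \sum_(i < m.+1) f (grid s t m i.+1) * mesh s t m @[m --> \oo] -->
    \int[lebesgue_measure]_(r in `[s, t[) f r.
Proof.
have [C hC] := cadlag_bounded t cf.
apply: (@step_integral_cvg _ true s t (fun m i => f (grid s t m i.+1)) _ C st).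
  move=> m i im; apply: hC; first by rewrite (le_trans s0)// grid_ge.
  by rewrite grid_le.
by move=> r /=; rewrite in_itv/= => /andP[sr rt]; exact: step_right_cvg.
Qed.

Lemma cadlag_integrable : lebesgue_measure.-integrable `[s, t] (EFin \o f).
Proof.
have [C hC] := cadlag_bounded t cf.
apply: measurable_bounded_integrable => //.
- by have := @lebesgue_measure_itv R `[s, t]; rewrite /= => ->;
    case: ifPn => _; rewrite -?EFinB ltry.
- apply/measurable_fun_itv_bndo_bndcP.
  by have /measurable_int/measurable_EFinP := right_sums.1.
- exists C; split; first exact: num_real.
  move=> M CM x /=; rewrite in_itv/= => /andP[sx xt].
  by apply: le_trans (ltW CM); apply: hC => //; exact: le_trans sx.
Qed.

Lemma measurable_left_limit : measurable_fun `]s, t] (left_limit f).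
Proof. by have /measurable_int/measurable_EFinP := left_sums.1. Qed.

(** Instead of invoking countability of the jumps, two Riemann sums are compared: left-end sums
    converge to the integral of the left limits, right-end sums to that of [f], and they differ by
    [(f s - f t) * mesh s t m], which tends to 0. *)
Lemma Rintegral_left_limit :
  \int[lebesgue_measure]_(r in `[s, t]) left_limit f r =
  \int[lebesgue_measure]_(r in `[s, t]) f r.
Proof.
rewrite -Rintegral_itv_obnd_cbnd; last exact: left_sums.1.
rewrite -(Rintegral_itv_bndo_bndc right_sums.1).
apply/eqP; rewrite -subr_eq0; apply/eqP.
have E m : \sum_(i < m.+1) f (grid s t m i) * mesh s t m -
   \sum_(i < m.+1) f (grid s t m i.+1) * mesh s t m = (f s - f t) * mesh s t m.
  rewrite -!mulr_suml -mulrBl; congr (_ * _).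
  by rewrite -sumrB -(opprB (f t)) (grid_telescope f s t m) -sumrN;
    under [RHS]eq_bigr do rewrite opprB.
have := cvgB left_sums.2 right_sums.2.
rewrite [X in X @ _ --> _](_ : _ = fun m => (f s - f t) * mesh s t m); last first.
  by apply/funext => m; exact: E.
move=> H; rewrite -(cvg_lim (@Rhausdorff R) (H _)).
apply: (cvg_lim (@Rhausdorff R)).
rewrite -(mulr0 (f s - f t)); apply: cvgM; first exact: cvg_cst.
exact: mesh_cvg0.
Qed.

Lemma riemann_sum_cvg :
  \sum_(i < m.+1) f (grid s t m i) * mesh s t m @[m --> \oo] -->
    \int[lebesgue_measure]_(r in `[s, t]) f r.
Proof.
rewrite -Rintegral_left_limit -Rintegral_itv_obnd_cbnd; last exact: left_sums.1.
exact: left_sums.2.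
Qed.

End integrals.

Lemma cadlag_comp (g f : R -> R) : continuous g -> cadlag f ->
  cadlag (fun r => g (f r)).
Proof.
move=> cg cf; split => r r0.
  by apply: continuous_cvg; [exact: cg|exact: cf.1].
apply/cvg_ex; exists (g (left_limit f r)).
by apply: continuous_cvg; [exact: cg|exact: left_limitP].
Qed.

Lemma cadlag_integral_le f M s t : cadlag f -> 0 <= s -> s <= t ->
  (forall r, s <= r -> r <= t -> f r <= M) ->
  \int[lebesgue_measure]_(r in `[s, t]) f r <= M * (t - s).
Proof.
move=> cf s0 st fM; have cv := riemann_sum_cvg cf s0 st.
rewrite -(cvg_lim (@Rhausdorff R) cv); apply: limr_le; first exact: cvgP cv.
apply: nearW => m; rewrite (grid_telescope id s t m) mulr_sumr.
apply: ler_sum => i _; rewrite gridS addrAC subrr add0r ler_wpM2r ?mesh_ge0//.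
by apply: fM; rewrite ?grid_ge ?grid_le// ltnW.
Qed.

End cadlag_paths.

(** * Lebesgue-Stieltjes measure of a counting path *)

Section stieltjes_paths.
Context {R : realType}.
Implicit Types f g q : R -> R.

Lemma prolonged_nondecreasing f : counting_path f ->
  {homo prolonged f : x y / x <= y}.
Proof.
move=> [_ _ fh _] x y xy; apply: fh; first by rewrite le_max lexx.
by rewrite ge_max !le_max lexx xy orbT.
Qed.

Lemma prolonged_right_continuous f : counting_path f ->
  right_continuous (prolonged f).
Proof.
move=> [_ _ _ fr] x.
have [x0|x0] := ltP x 0.
  apply: cvg_near_cst; apply/near_rightP; exists (- x); first by rewrite oppr_gt0.
  move=> y xy; rewrite subrr => y0; rewrite /prolonged (max_idPl (ltW y0)).
  by rewrite (max_idPl (ltW x0)).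
have -> : prolonged f x = f x by rewrite /prolonged (max_idPr x0).
apply: cvg_trans (fr _ x0); apply: near_eq_cvg; apply/near_rightP; exists 1 => //.
move=> y xy _; rewrite /prolonged; congr f; apply/esym/max_idPr.
by rewrite (le_trans x0)// ltW.
Qed.

Lemma lebesgue_stieltjes_itv (F : cumulative R R) (a b : R) : a <= b ->
  lebesgue_stieltjes_measure F `]a, b] = (F b - F a)%:E.
Proof.
move=> ab; rewrite /lebesgue_stieltjes_measure/= /measure_extension/=.
by rewrite measurable_mu_extE/= ?wlength_itv_bnd//; exact: is_ocitv.
Qed.

Lemma stieltjes_itv f a b : counting_path f -> 0 <= a -> a <= b ->
  stieltjes (prolonged f) `]a, b]%classic = (f b - f a)%:E.
Proof.
move=> cf a0 ab; have b0 := le_trans a0 ab.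
rewrite /stieltjes; case: pselect => [fP|]; last first.
  by case; split; [exact: prolonged_nondecreasing|exact: prolonged_right_continuous].
rewrite [LHS](lebesgue_stieltjes_itv _ ab)/=.
by rewrite /prolonged (max_idPr a0) (max_idPr b0).
Qed.

Variables (f : R -> R) (E : set R).
Hypothesis cf : counting_path f.

Lemma path_integral_indic t : measurable (E `&` `]0, t]) ->
  path_integral (\1_E) f t = stieltjes (prolonged f) (E `&` `]0, t]).
Proof.
move=> mE; rewrite /path_integral.
transitivity (\int[stieltjes (prolonged f)]_(s in `]0%R, t]%classic)
    (\1_(E `&` `]0%R, t]%classic) s)%:E)%E.
  apply: eq_integral => s /set_mem st; rewrite !indicE; congr (_%:R%:E).
  by rewrite in_setI (mem_set st) andbT.
rewrite integral_indic; [|exact: measurable_itv|exact: mE].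
by rewrite -setIA setIid.
Qed.

End stieltjes_paths.

(** * Departures of one server as an integral against its service path *)

Section level_integral.
Context {R : realType}.
Variables (q f : R -> R) (c : R).
Hypotheses (cq : cadlag q) (cf : counting_path f).

Let E : set R := [set s | c <= left_limit q s].

Definition level_integral t : R := fine (path_integral (\1_E) f t).

Let mE u v : 0 <= u -> u <= v -> measurable (E `&` `]u, v]).
Proof.
move=> u0 uv; rewrite setIC.
have := measurable_left_limit cq u0 uv (measurable_itv _) (measurable_itv `[c, +oo[).
by congr (measurable (_ `&` _)); apply/seteqP; split => x /=;
  rewrite /E /= in_itv/= andbT.
Qed.

Let mu_itv u v : 0 <= u -> u <= v -> (stieltjes (prolonged f) (E `&` `]u, v]) <= (f v - f u)%:E)%E.
Proof.
move=> u0 uv; rewrite -stieltjes_itv//.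
by apply: le_measure; rewrite ?inE; [exact: mE|exact: measurable_itv|exact: subIsetr].
Qed.

Lemma path_integral_level t : 0 <= t ->
  path_integral (\1_E) f t = (level_integral t)%:E.
Proof.
move=> t0; rewrite /level_integral fineK// ge0_fin_numE; last first.
  by rewrite path_integral_indic//; exact: mE.
by rewrite path_integral_indic ?(le_lt_trans (mu_itv _ t0)) ?ltry//; exact: mE.
Qed.

Lemma level_integral0 : level_integral 0 = 0.
Proof. by rewrite /level_integral /path_integral set_itvoc0 integral_set0. Qed.

Let level_integralB u v : 0 <= u -> u <= v ->
  (level_integral v - level_integral u)%:E = stieltjes (prolonged f) (E `&` `]u, v]).
Proof.
move=> u0 uv; have v0 := le_trans u0 uv.
have mu_fin : stieltjes (prolonged f) (E `&` `]u, v]) \is a fin_num.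
  by rewrite ge0_fin_numE// (le_lt_trans (mu_itv _ uv))// ltry.
rewrite EFinB -!path_integral_level// !path_integral_indic//; try exact: mE.
have -> : E `&` `]0, v] = (E `&` `]0, u]) `|` (E `&` `]u, v]).
  rewrite -setIUr; congr (_ `&` _); apply/seteqP; split => x /=; rewrite !in_itv/=.
    by case/andP => -> ->; rewrite andbT /=; case: leP => _; [left|right].
  by case=> /andP[h1 h2]; apply/andP; split => //;
    [exact: le_trans uv|exact: le_lt_trans h1].
rewrite measureU; [|exact: mE|exact: mE|].
  rewrite [X in (X - _)%E]addeC addeK//.
  by rewrite ge0_fin_numE// (le_lt_trans (mu_itv _ u0))// ltry.
apply/seteqP; split => // x /= [[_ +] [_ +]].
by rewrite !in_itv/= => /andP[_ xu] /andP[/lt_le_trans/(_ xu)]; rewrite ltxx.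
Qed.

Lemma level_integral_bounds u v : 0 <= u -> u <= v ->
  0 <= level_integral v - level_integral u <= f v - f u.
Proof.
by move=> u0 uv; rewrite -!lee_fin level_integralB// measure_ge0 mu_itv.
Qed.

(** A server whose rank exceeds every queue length met so far has never worked: left limits inherit
    the bound [d], so the integrand vanishes. *)
Lemma level_integral_eq0 t d : 0 <= t -> d < c ->
  (forall s, 0 <= s -> s <= t -> q s <= d) -> level_integral t = 0.
Proof.
move=> t0 dc qd; apply: EFin_inj.
have := level_integralB (lexx 0) t0; rewrite level_integral0 subr0 => ->.
rewrite (_ : _ `&` _ = set0) ?measure0//.
apply/seteqP; split => // r /= []; rewrite /E /= in_itv /= => + /andP[r0 rt].
apply/negP; rewrite -ltNge (le_lt_trans _ dc)//.
apply: limr_le; first exact: cq.2.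
apply/near_leftP; exists r => // y; rewrite subrr => y0 yr.
by apply: qd; [exact: ltW|rewrite (le_trans _ rt)// ltW].
Qed.

(** The left limits of [q] equal [q u] on ]u, s], since [q] does not move before [s], so the
    integrand is constant there; on ]s, v] the integrator puts no mass. *)
Lemma level_integral_cell u v s : 0 <= u -> u <= s -> s <= v ->
  (forall r, u <= r -> r < s -> q r = q u) -> f v = f s ->
  level_integral v - level_integral u = (c <= q u)%R%:R * (f v - f u).
Proof.
move=> u0 us sv qu fvs; have s0 := le_trans u0 us.
have : level_integral v - level_integral s = 0.
  by apply/eqP; rewrite eq_le andbC; have := level_integral_bounds s0 sv;
    rewrite fvs subrr.
move=> /subr0_eq ->; rewrite fvs; apply: EFin_inj; rewrite level_integralB//.
have qr r : u < r -> r <= s -> left_limit q r = q u.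
  move=> ur rs; apply: left_limit_near; apply/near_leftP.
  exists (r - u); first by rewrite subr_gt0.
  by move=> y; rewrite subKr => uy yr; apply: qu; [exact: ltW|exact: lt_le_trans rs].
have [cqu|cqu] := boolP (c <= q u).
  rewrite mul1r -stieltjes_itv//; congr (stieltjes _ _); apply/setIidPr.
  by move=> r /=; rewrite in_itv/= => /andP[ur rs]; rewrite /E /= qr.
rewrite mul0r (_ : _ `&` _ = set0) ?measure0//.
apply/seteqP; split => // r /= []; rewrite /E /= in_itv /= => + /andP[ur rs].
by rewrite qr// (negbTE cqu).
Qed.

End level_integral.

(** * Sums and jumps of counting paths *)

Section counting_more.
Context {R : realType}.
Implicit Types f g : R -> R.

Lemma counting_path_ge0 f t : counting_path f -> 0 <= t -> 0 <= f t.
Proof. by move=> [_ fN _ _] t0; exact: natr_ge0 (fN _ t0). Qed.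

Lemma counting_path_cadlag f : counting_path f -> cadlag f.
Proof.
move=> cf; split; first by have [] := cf.
move=> t t0; have [u [u0 ut fu]] := counting_path_left cf t0.
apply: (@is_cvg_near_cst _ _ (f u)); apply/near_leftP.
exists (t - u); first by rewrite subr_gt0.
by move=> y; rewrite subKr => uy yt; apply: fu => //; exact: ltW.
Qed.

Lemma counting_path0 : counting_path (fun _ : R => 0).
Proof. by split => // t _; exact: cvg_cst. Qed.

Lemma counting_pathD f g : counting_path f -> counting_path g ->
  counting_path (fun t => f t + g t).
Proof.
move=> [f0 fN fh fr] [g0 gN gh gr]; split.
- by rewrite f0 g0 addr0.
- by move=> t t0; rewrite rpredD ?fN ?gN.
- by move=> s t s0 st; rewrite lerD ?fh ?gh.
- by move=> t t0; apply: cvgD; [exact: fr|exact: gr].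
Qed.

Lemma counting_path_sum (I : eqType) (r : seq I) (F : I -> R -> R) :
  (forall i, i \in r -> counting_path (F i)) ->
  counting_path (fun t => \sum_(i <- r) F i t).
Proof.
elim: r => [|i r IH] cF.
  by under eq_fun do rewrite big_nil; exact: counting_path0.
under eq_fun do rewrite big_cons; apply: counting_pathD.
  by apply: cF; rewrite mem_head.
by apply: IH => j jr; apply: cF; rewrite in_cons jr orbT.
Qed.

(** The jump of an integer-valued path that grows by at most 1 on [u, t] is 0 or 1; being its own
    square is how this enters the jump condition on an optional quadratic variation. *)
Lemma simple_jump f t u : counting_path f -> 0 <= u -> u < t -> f t - f u <= 1 ->
  jump f t ^+ 2 = jump f t.
Proof.
move=> cf u0 ut fut; have t0 := le_lt_trans u0 ut.
have [v [v0 vt fv]] := counting_path_left cf t0.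
rewrite /jump; have -> : left_limit f t = f v.
  apply: left_limit_near; apply/near_leftP; exists (t - v); first by rewrite subr_gt0.
  by move=> y; rewrite subKr => vy yt; apply: fv => //; exact: ltW.
have {fut} : f t - f v <= 1.
  have [uv|vu] := leP u v.
    apply: le_trans fut; rewrite lerD2l lerN2.
    by have [_ _ + _] := cf; apply.
  by rewrite -(fv u (ltW vu) ut).
have [_ fN fh _] := cf.
have := fh _ _ v0 (ltW vt).
have /natrP[m ->] := fN _ (ltW t0); have /natrP[n ->] := fN _ v0.
rewrite ler_nat lerBlDr addrC natr1 ler_nat leq_eqVlt => /predU1P[->|nm] mn.
  by rewrite subrr expr0n.
have -> : m = n.+1 by apply/eqP; rewrite eqn_leq mn.
by rewrite -natr1 addrAC subrr add0r expr1n.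
Qed.

End counting_more.

(** * Paths of the queue *)

Section queue_path.
Context d (T : measurableType d) (R : realType).
Variables (Q A : R -> T -> R) (S : nat -> R -> T -> R) (w : T).
Hypotheses (cA : counting_path (A ^~ w))
  (cS : forall k, (1 <= k)%N -> counting_path (S k ^~ w))
  (cQ : cadlag (Q ^~ w)) (Q0 : Q 0 w \is a Num.nat)
  (Qeq : forall t, 0 <= t ->
    ((Q t w)%:E = (Q 0 w + A t w)%:E - departures Q S t w)%E).

Definition departed (t : R) : R := fine (departures Q S t w).

Definition server_departed (k : nat) : R -> R :=
  level_integral (Q ^~ w) (S k ^~ w) k%:R.

(** What the first K servers would complete if they never idled. It dominates the departures and has
    square-integrable increments. *)
Definition potential (K : nat) (t : R) : R := \sum_(1 <= k < K.+1) S k t w.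

Lemma departures_ge0 t : (0 <= departures Q S t w)%E.
Proof.
apply: nneseries_ge0 => k _ _; apply: integral_ge0 => s _.
by rewrite lee_fin.
Qed.

Lemma departuresE t : 0 <= t -> departures Q S t w = (departed t)%:E.
Proof.
move=> t0; rewrite /departed fineK//.
by have := Qeq t0; case: (departures Q S t w).
Qed.

Lemma queueE t : 0 <= t -> Q t w = Q 0 w + A t w - departed t.
Proof. by move=> t0; apply: EFin_inj; rewrite Qeq// departuresE. Qed.

Lemma departed_ge0 t : 0 <= t -> 0 <= departed t.
Proof. by move=> t0; rewrite -lee_fin -departuresE// departures_ge0. Qed.

Lemma queue_le s t : 0 <= s -> s <= t -> Q s w <= Q 0 w + A t w.
Proof.
move=> s0 st; rewrite (queueE s0).
have := departed_ge0 s0; have [_ _ Ah _] := cA; have := Ah _ _ s0 st; lra.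
Qed.

Lemma counting_potential K : counting_path (potential K).
Proof.
by apply: counting_path_sum => k; rewrite mem_index_iota => /andP[k1 _]; exact: cS.
Qed.

(** Up to time t the queue never exceeds [Q 0 w + A t w], so servers above that level contribute
    nothing and the series is a finite sum. *)
Lemma departedE K t : 0 <= t -> Q 0 w + A t w <= K%:R ->
  departed t = \sum_(1 <= k < K.+1) server_departed k t.
Proof.
move=> t0 tK; apply: EFin_inj; rewrite -departuresE// /departures.
rewrite (nneseries_split 1 K); last first.
  by move=> k _; apply: integral_ge0 => s _; rewrite lee_fin.
rewrite add1n [X in (_ + X)%E]eseries0 ?adde0; last first.
  move=> k Kk _; have k1 : (1 <= k)%N by exact: leq_trans Kk.
  rewrite path_integral_level//; last exact: cS.
  rewrite (@level_integral_eq0 _ _ _ _ _ _ t (Q 0 w + A t w))//.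
  - exact: cS.
  - by rewrite (le_lt_trans tK)// ltr_nat.
  - by move=> s s0 st; exact: queue_le.
rewrite -sumEFin big_nat_cond [RHS]big_nat_cond; apply: eq_bigr => k.
by rewrite andbT => /andP[k1 _]; rewrite path_integral_level//; exact: cS.
Qed.

Lemma server_departed0 k : server_departed k 0 = 0.
Proof. exact: level_integral0. Qed.

Lemma server_departed_bounds k u v : (1 <= k)%N -> 0 <= u -> u <= v ->
  0 <= server_departed k v - server_departed k u <= S k v w - S k u w.
Proof. by move=> k1; exact: (level_integral_bounds k%:R cQ (cS k1)). Qed.

Lemma potential_component K k u v : (1 <= k <= K)%N -> 0 <= u -> u <= v ->
  S k v w - S k u w <= potential K v - potential K u.
Proof.
move=> /andP[k1 kK] u0 uv; rewrite /potential -sumrB.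
rewrite (bigD1_seq k) ?iota_uniq ?mem_index_iota ?k1//= lerDl.
rewrite big_seq_cond; apply: sumr_ge0 => j; rewrite mem_index_iota.
by move=> /andP[/andP[j1 _] _]; rewrite subr_ge0; have [_ _ + _] := cS j1; apply.
Qed.

Opaque departed potential server_departed.

Lemma departed_dominated K u v : 0 <= u -> u <= v -> Q 0 w + A v w <= K%:R ->
  0 <= departed v - departed u <= potential K v - potential K u.
Proof.
move=> u0 uv vK; have v0 := le_trans u0 uv.
have uK : Q 0 w + A u w <= K%:R.
  by have [_ _ Ah _] := cA; rewrite (le_trans _ vK)// lerD2l Ah.
rewrite !(@departedE K)// -!sumrB; apply/andP; split.
  rewrite big_seq; apply: sumr_ge0 => k; rewrite mem_index_iota => /andP[k1 _].
  by have /andP[] := server_departed_bounds k1 u0 uv.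
rewrite ler_sum_nat// => k /andP[k1 _].
by have /andP[] := server_departed_bounds k1 u0 uv.
Qed.

(** Before [s] neither arrivals nor potential services occur in the cell; departures are dominated
    by the latter, so Q stands still and the cell formula for one server applies. *)
Lemma server_departed_cell K k u s v : (1 <= k <= K)%N ->
  0 <= u -> u <= s -> s <= v -> Q 0 w + A v w <= K%:R ->
  (forall r, u <= r -> r < s -> A r w = A u w /\ potential K r = potential K u) ->
  potential K v = potential K s ->
  server_departed k v - server_departed k u =
    (k%:R <= Q u w)%R%:R * (S k v w - S k u w).
Proof.
move=> kK u0 us sv vK hu hs; have /andP[k1 _] := kK.
have s0 := le_trans u0 us; have uv := le_trans us sv.
apply: (@level_integral_cell _ _ _ _ cQ (cS k1) u v s) => //.
  move=> r ur rs; have r0 := le_trans u0 ur.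
  have [Aru pru] := hu _ ur rs.
  have rK : Q 0 w + A r w <= K%:R.
    apply: le_trans vK; rewrite lerD2l.
    by have [_ _ Ah _] := cA; rewrite Ah// (le_trans _ sv)// ltW.
  have /andP[d1 d2] := departed_dominated u0 ur rK.
  have dru : departed r = departed u.
    by apply/eqP; rewrite -subr_eq0 eq_le d1 andbT (le_trans d2)// pru subrr.
  by rewrite (queueE r0) (queueE u0) Aru dru.
apply/eqP; rewrite eq_le; apply/andP; split; last first.
  by have [_ _ + _] := cS k1; apply.
by have := potential_component kK s0 sv; rewrite hs subrr subr_le0.
Qed.

Lemma queue_mesh T' K : Q 0 w + A T' w <= K%:R ->
  exists2 e, 0 < e & forall u v, 0 <= u -> u <= v -> v <= T' -> v - u < e ->
  [/\ forall k, (1 <= k <= K)%N -> server_departed k v - server_departed k u =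
        (k%:R <= Q u w)%R%:R * (S k v w - S k u w),
      departed v - departed u =
        \sum_(1 <= k < K.+1) (k%:R <= Q u w)%R%:R * (S k v w - S k u w) &
      exists s, [/\ u <= s, s <= v,
        forall r, u <= r -> r < s -> potential K r = potential K u &
        potential K v = potential K s]].
Proof.
move=> TK.
(* One mesh serves all paths: their sum is a counting path, and where a sum of nondecreasing paths
   stands still, each of them does. *)
have [e e0 he] := counting_path_mesh T' (counting_pathD cA (counting_potential K)).
have [_ _ Ah _] := cA; have [_ _ ph _] := counting_potential K.
exists e => // u v u0 uv vT vu; have v0 := le_trans u0 uv.
have [s [us sv hu hs]] := he u v u0 uv vT vu.
have {}hu r : u <= r -> r < s -> A r w = A u w /\ potential K r = potential K u.
  move=> ur rs; have := hu r ur rs.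
  have := Ah _ _ u0 ur; have := ph _ _ u0 ur; lra.
have s0 := le_trans u0 us.
have {}hs : potential K v = potential K s.
  by have := Ah _ _ s0 sv; have := ph _ _ s0 sv; lra.
have vK : Q 0 w + A v w <= K%:R by rewrite (le_trans _ TK)// lerD2l Ah.
have uK : Q 0 w + A u w <= K%:R by rewrite (le_trans _ vK)// lerD2l Ah.
have cell k : (1 <= k <= K)%N -> server_departed k v - server_departed k u =
        (k%:R <= Q u w)%R%:R * (S k v w - S k u w).
  by move=> kK; exact: (server_departed_cell kK u0 us sv vK).
split => //.
  by rewrite !(@departedE K)// -sumrB; apply: eq_big_nat.
by exists s; split => // r ur rs; have [] := hu r ur rs.
Qed.

Lemma nat_ub (x : R) : exists K : nat, x <= K%:R.
Proof.
exists (Num.truncn `|x|).+1.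
by rewrite (le_trans (ler_norm x))// ltW// truncnS_gt.
Qed.

(** Induction along a grid of mesh below [e], in place of a recursion over jump times. *)
Lemma grid_ind (B : R -> Prop) t e : 0 <= t -> 0 < e -> B 0 ->
  (forall u v, 0 <= u -> u <= v -> v <= t -> v - u < e -> B u -> B v) -> B t.
Proof.
move=> t0 e0 B0 Buv; have /filter_ex[m me] := mesh_small e0 t0.
rewrite -(grid_last 0 t m).
suff H i : (i <= m.+1)%N -> B (grid 0 t m i) by exact: H.
elim: i => [|i IH] im; first by rewrite grid0.
apply: (Buv (grid 0 t m i)); rewrite ?grid_ge ?grid_le ?le_grid//.
  by rewrite gridS addrAC subrr add0r.
exact/IH/ltnW.
Qed.

(** On an arbitrary path one cannot claim more than integrality: if a service path jumps by two
    while Q = 1, then Q becomes -1. *)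
Lemma queue_int t : 0 <= t -> Q t w \is a Num.int.
Proof.
move=> t0; have [K tK] := nat_ub (Q 0 w + A t w).
have [e e0 he] := queue_mesh tK.
have dint : departed t \is a Num.int.
  apply: (grid_ind (B := fun v => departed v \is a Num.int) t0 e0).
    rewrite (@departedE K)//; last first.
      by rewrite (le_trans _ tK)// lerD2l; have [_ _ Ah _] := cA; rewrite Ah.
    by rewrite big1// => k _; rewrite server_departed0.
  move=> u v u0 uv vt vu iu; have [_ H _] := he u v u0 uv vt vu.
  rewrite -(subrK (departed u) (departed v)) rpredD// H.
  rewrite big_seq; apply: rpred_sum => k; rewrite mem_index_iota => /andP[k1 _].
  have [_ SN _ _] := cS k1.
  by rewrite rpredM ?rpredB ?intr_nat ?SN ?natr_nat// (le_trans u0).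
have [_ AN _ _] := cA.
rewrite (queueE t0); apply: rpredB => //.
by apply: rpredD; apply: intr_nat; [exact: Q0|exact: AN].
Qed.

Lemma counting_departed : counting_path departed.
Proof.
split.
- have [K tK] := nat_ub (Q 0 w + A 0 w).
  rewrite (@departedE K)//.
  by rewrite big1// => k _; rewrite server_departed0.
- move=> t t0; rewrite natrEint departed_ge0// andbT.
  have -> : departed t = Q 0 w + A t w - Q t w by rewrite (queueE t0) subKr.
  have [_ AN _ _] := cA.
  apply: rpredB; last exact: queue_int.
  by apply: rpredD; apply: intr_nat; [exact: Q0|exact: AN].
- move=> s t s0 st; have [K tK] := nat_ub (Q 0 w + A t w).
  by have /andP[] := departed_dominated s0 st tK; rewrite subr_ge0.
- move=> t t0.
  (* Right continuity is inherited from Q and A through the balance equation rather than read off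
     the series. *)
  have E s : 0 <= s -> departed s = Q 0 w + A s w - Q s w.
    by move=> s0; rewrite (queueE s0) subKr.
  rewrite E//.
  have H : Q 0 w + A x w - Q x w @[x --> t^'+] --> Q 0 w + A t w - Q t w.
    apply: cvgB; last by have [+ _] := cQ; apply.
    by apply: cvgD; [exact: cvg_cst|have [_ _ _ +] := cA; apply].
  apply: cvg_trans H; apply: near_eq_cvg; apply/near_rightP; exists 1 => //.
  by move=> y ty _; rewrite E// (le_trans t0)// ltW.
Qed.

Lemma server_departed_riemann k s t : (1 <= k)%N -> 0 <= s -> s <= t ->
  \forall m \near \oo, server_departed k t - server_departed k s =
    \sum_(i < m.+1) (k%:R <= Q (grid s t m i) w)%R%:R *
      (S k (grid s t m i.+1) w - S k (grid s t m i) w).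
Proof.
move=> k1 s0 st; have [K tK] := nat_ub (Num.max k%:R (Q 0 w + A t w)).
move: tK; rewrite ge_max ler_nat => /andP[kK tK].
have [e e0 he] := queue_mesh tK.
apply: filterS (mesh_small e0 st) => m me.
rewrite (grid_telescope (server_departed k) s t m); apply: eq_bigr => -[i im] _ /=.
have g0 : 0 <= grid s t m i by rewrite (le_trans s0)// grid_ge.
have [||+ _ _] := he _ _ g0 (le_grid m st (leqnSn i)).
- exact: grid_le.
- by rewrite gridS addrAC subrr add0r.
- by apply; rewrite k1.
Qed.

(** Servers beyond m are left out, and for large m all of these are idle up to t. The recursion thus
    involves finitely many servers and grid values only, as a measurable scheme must. *)
Lemma queue_riemann t : 0 <= t -> \forall m \near \oo, forall i, (i <= m)%N ->
  Q (grid 0 t m i.+1) w = Q (grid 0 t m i) w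
    + (A (grid 0 t m i.+1) w - A (grid 0 t m i) w)
    - \sum_(1 <= k < m.+1) (k%:R <= Q (grid 0 t m i) w)%R%:R *
      (S k (grid 0 t m i.+1) w - S k (grid 0 t m i) w).
Proof.
move=> t0; have [K tK] := nat_ub (Q 0 w + A t w).
have [e e0 he] := queue_mesh tK.
near=> m => i im.
have im1 : (i <= m.+1)%N by exact: leqW.
have me : mesh 0 t m < e by near: m; exact: mesh_small.
have Km : (K <= m)%N by near: m; exact: nbhs_infty_ge.
set u := grid 0 t m i; set v := grid 0 t m i.+1.
have u0 : 0 <= u by exact: grid_ge.
have uv : u <= v by exact: le_grid.
have vt : v <= t by exact: grid_le.
have [|_ H _] := he u v u0 uv vt.
  by rewrite /v gridS addrAC subrr add0r.
rewrite (big_cat_nat _ (n := K.+1))//= [X in _ - (_ + X)]big1_seq ?addr0; last first.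
  move=> k /=; rewrite mem_index_iota => /andP[Kk _].
  rewrite leNgt (_ : _ < _) ?mul0r//.
  rewrite (le_lt_trans (queue_le u0 (le_trans uv vt)))//.
  by rewrite (le_lt_trans tK)// ltr_nat.
rewrite -H.
rewrite (queueE u0) (queueE (le_trans u0 uv)).
move: (departed u) (departed v) => du dv; ring.
Unshelve. all: by end_near. Qed.

(** Bounding the jumps of the sum over servers excludes jumps of size two and simultaneous jumps
    alike. *)
Definition unit_jumps := forall K t, 0 < t ->
  exists u, [/\ 0 <= u, u < t & potential K t - potential K u <= 1].

Hypothesis uj : unit_jumps.

Lemma departed_jump t : 0 < t -> jump departed t ^+ 2 = jump departed t.
Proof.
move=> t0; have [K tK] := nat_ub (Q 0 w + A t w).
have [u [u0 ut pu]] := uj K t0.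
apply: (simple_jump counting_departed u0 ut).
have /andP[_ /le_trans] := departed_dominated u0 (ltW ut) tK; exact.
Qed.

(** A short cell holds at most one departure. It cannot take Q below 0: if [Q u w] is at least 1
    there is room for it, and if it is 0 every indicator vanishes and there is none. *)
Lemma queue_ge0 t : 0 <= t -> 0 <= Q t w.
Proof.
move=> t0; have [K tK] := nat_ub (Q 0 w + A t w).
have [e e0 he] := queue_mesh tK.
apply: (grid_ind (B := fun v => 0 <= Q v w) t0 e0); first exact: natr_ge0.
move=> u v u0 uv vt vu Qu0; have [_ H [s [us sv hu hs]]] := he u v u0 uv vt vu.
have v0 := le_trans u0 uv.
have -> : Q v w = Q u w + (A v w - A u w) - (departed v - departed u).
  rewrite (queueE u0) (queueE v0); move: (departed u) (departed v) => du dv; ring.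
have Auv : 0 <= A v w - A u w.
  by rewrite subr_ge0; have [_ _ + _] := cA; apply.
suff : departed v - departed u <= Q u w.
  by move=> h; rewrite subr_ge0 (le_trans h)// lerDl.
have vK : Q 0 w + A v w <= K%:R.
  by rewrite (le_trans _ tK)// lerD2l; have [_ _ + _] := cA; apply.
have d1 : departed v - departed u <= 1.
  have /andP[_ dp] := departed_dominated u0 uv vK.
  apply: le_trans dp _; rewrite hs.
  have [us'|su] := ltP u s; last first.
    by have -> : s = u; [apply/eqP; rewrite eq_le su|rewrite subrr].
  (* All growth of [potential] in the cell happens at [s], where the unit jump property bounds
     it. *)
  have [r [r0 rs pr]] := uj K (le_lt_trans u0 us').
  have [_ _ ph _] := counting_potential K.
  have [ur|ru] := leP u r; first by rewrite -(hu r ur rs).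
  apply: le_trans pr; rewrite lerD2l lerN2; exact/ph/ltW.
have [Q1|Q1] := leP 1 (Q u w); first exact: le_trans Q1.
have -> : Q u w = 0.
  have /natrP[n En] : Q u w \is a Num.nat by rewrite natrEint queue_int.
  by move: Q1; rewrite En ltrn1 ltnS leqn0 => /eqP ->.
rewrite H big_nat big1// => k /andP[k1 _].
rewrite leNgt (_ : _ < _) ?mul0r//.
by rewrite (lt_le_trans Q1)// ler1n.
Qed.

End queue_path.

(** * Independence of the increments from the past *)

Section generated_sigma_algebras.
Context d (T : measurableType d) (R : realType).
Implicit Types (H : set (set T)) (Z : T -> R).

Lemma sigma_rvP Z (E : set T) :
  sigma_rv Z E <-> exists2 B : set R, measurable B & E = Z @^-1` B.
Proof.
by split=> [[B mB <-]|[B mB ->]]; exists B => //; rewrite setTI.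
Qed.

(** Bridges the inclusions of sigma-algebras used in the definitions and measurability on
    [g_sigma_algebraType], which is stable under sums, products and limits. *)
Lemma measurable_wrtP H Z :
  sigma_rv Z `<=` <<s H >> <-> measurable_fun (setT : set (g_sigma_algebraType H)) Z.
Proof.
split=> [h _ B mB|h E [B mB <-]]; first by apply: h; exists B.
by apply: h.
Qed.

Lemma sub_generated H H' : H `<=` <<s H' >> -> <<s H >> `<=` <<s H' >>.
Proof. by move=> h; apply: smallest_sub => //; exact: smallest_sigma_algebra. Qed.

Lemma generated_mono H H' : H `<=` H' -> <<s H >> `<=` <<s H' >>.
Proof. by move=> h; apply: sub_generated => E /h; exact: sub_sigma_algebra. Qed.

Lemma measurable_fun_wrt H Z : <<s H >> `<=` measurable ->
  measurable_fun (setT : set (g_sigma_algebraType H)) Z -> measurable_fun setT Z.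
Proof. by move=> Hm mZ _ B mB; apply: Hm; exact: mZ. Qed.

End generated_sigma_algebras.

(** * Independence of one event from a generated sigma-algebra *)

Section independence.
Context d (T : measurableType d) (R : realType) (P : probability T R).
Implicit Types (E B : set T) (H : set (set T)).

Definition independent_event E H := forall B, H B -> P (E `&` B) = (P E * P B)%E.

Lemma independent_event_generated E H : measurable E -> H `<=` measurable ->
  setI_closed H -> independent_event E H -> independent_event E <<s H >>.
Proof.
move=> mE Hm HI EH.
suff : <<s H >> `<=` [set B | measurable B /\ P (E `&` B) = (P E * P B)%E].
  by move=> sub B /sub[].
rewrite -(setI_closed_g_dynkin_g_sigma_algebra HI).
apply: smallest_sub; last by move=> B HB; split; [exact: Hm|exact: EH].
split.
- by split; [exact: measurableT|rewrite setIT probability_setT mule1].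
- move=> B [mB PB]; split; first exact: measurableC.
  rewrite -setDE measureD//; last by rewrite ltey_eq fin_num_measure.
  apply: (etrans (congr1 (fun x => (P E - x)%E) PB)).
  rewrite -{1}(mule1 (P E)) -muleBr ?fin_num_measure//.
  by rewrite -probability_setC.
- move=> F tF hF; split; first by apply: bigcup_measurable => k _; have [] := hF k.
  rewrite setI_bigcupr !measure_bigcup//=.
  + rewrite -[X in (X * _)%E](@fineK _ (P E)) ?fin_num_measure// -nneseriesZl//.
    by apply: eq_eseriesr => k _; rewrite fineK ?fin_num_measure//; have [] := hF k.
  + by move=> k _; have [] := hF k.
  + by move=> k _; apply: measurableI => //; have [] := hF k.
  + by apply: trivIset_setIl.
Qed.

End independence.

(** * Increments of a Poisson process and its own past *)

Section poisson_past.
Context d (T : measurableType d) (R : realType) (P : probability T R).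
Variables (rate : R) (N : R -> T -> R).
Hypothesis pN : poisson_process P rate N.

Definition past_events (X : R -> T -> R) (s : R) : set (set T) :=
  \bigcup_(u in `[0, s]) sigma_rv (X u).

(* The past of N is generated by the finite-dimensional atoms
   {N(u_1) = x_1, ..., N(u_r) = x_r}, since N takes countably many values. *)
Definition atom (L : seq (R * R)) : set T :=
  [set w | forall p, p \in L -> N p.1 w = p.2].

Lemma sigma_rv_eq (Z : T -> R) x : sigma_rv Z [set w | Z w = x].
Proof. by apply/sigma_rvP; exists [set x]. Qed.

Lemma sigma_rv_measurable (Z : T -> R) : measurable_fun setT Z ->
  sigma_rv Z `<=` measurable.
Proof. by move=> mZ E /sigma_rvP[B mB ->]; rewrite -[_ @^-1` _]setTI; exact: mZ. Qed.

(** As N starts at 0, prescribing N at finitely many sorted times is prescribing its increments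
    between consecutive times; together with the increment over [s, t] these are independent by
    definition. *)
Lemma increment_independent_atom s t L E : 0 <= s -> s <= t ->
  (forall p, p \in L -> 0 <= p.1 <= s) ->
  sigma_rv (fun w => N t w - N s w) E ->
  P (E `&` atom L) = (P E * P (atom L))%E.
Proof.
move=> s0 st Ls sE; have [_ cN iN _] := pN.
pose leT (p q : R * R) := p.1 <= q.1.
pose L' := sort leT L; pose r := size L'.
have L's i : 0 <= (nth (s, 0) L' i).1 <= s.
  have [ir|ri] := ltnP i r; last by rewrite nth_default//= s0 lexx.
  by apply: Ls; rewrite -(mem_sort leT) mem_nth.
have sL : sorted leT L'.
  by apply: sort_sorted => p q; rewrite /leT le_total.
(* The sequence runs through 0, the r sorted times, s and t. The default [(s, 0)] of [nth] supplies
   s at index r+1, so E concerns increment r+1, while increment r, from the last time to s, is left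
   free. *)
pose tau j := if j is i.+1 then
  if (i <= r)%N then (nth (s, 0) L' i).1 else t else 0.
pose nu j := if j is i.+1 then (nth (s, 0) L' i).2 else 0.
have tau_nd : nondecreasing_seq tau.
  apply/nondecreasing_seqP => -[|i] /=; first by have /andP[] := L's 0%N.
  have [ir|ri] := ltnP i r; last first.
    by case: ifPn => // _; have /andP[_ /le_trans] := L's i; apply.
  rewrite (ltnW ir); have [ir'|ri] := ltnP i.+1 r; last first.
    by rewrite (nth_default _ ri); have /andP[] := L's i.
  exact: (elimT (sortedP (s, 0)) sL i ir').
have rr : (r.+1 < r)%N = false by rewrite ltnNge leqnSn.
have t1 : tau r.+2 = t by rewrite /tau ltnn.
have t2 : tau r.+1 = s by rewrite /tau leqnn nth_default.
pose C j := if (j < r)%N then [set w | N (tau j.+1) w - N (tau j) w = nu j.+1 - nu j]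
  else E.
have CE j : j \in r.+1 :: iota 0 r ->
    sigma_rv (fun w => N (tau j.+1) w - N (tau j) w) (C j).
  rewrite in_cons mem_iota add0n /C => /predU1P[->|/= jr].
    by rewrite rr t1 t2.
  by rewrite jr; exact: sigma_rv_eq.
have C1 := iN tau (lexx 0) tau_nd (r.+1 :: iota 0 r) C.
have C2 := iN tau (lexx 0) tau_nd (iota 0 r) C.
have atomE : atom L = \bigcap_(i in [set` iota 0 r]) C i.
  apply/seteqP; split => w /=.
    move=> Lw j /=; rewrite mem_iota /= add0n => jr.
    have H i : (i <= r)%N -> N (tau i) w = nu i.
      case: i => [_|i ir] /=; first by have [] := cN w.
      by rewrite ltnW//; apply: Lw; rewrite -(mem_sort leT) mem_nth.
    by rewrite /C jr /mkset (H j.+1 jr) (H j (ltnW jr)).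
  move=> Cw p; rewrite -(mem_sort leT) => /(nthP (s, 0))[i ir <-].
  have H j : (j <= r)%N -> N (tau j) w = nu j.
    elim: j => [_|j IH jr]; first by have [] := cN w.
    have := Cw j; rewrite /= mem_iota add0n jr /C jr => /(_ isT) /=.
    by have := IH (ltnW jr) => /= -> /addIr.
  by have := H i.+1 ir; rewrite /= ltnW.
rewrite atomE.
have -> : E `&` \bigcap_(i in [set` iota 0 r]) C i =
    \bigcap_(i in [set` r.+1 :: iota 0 r]) C i.
  apply/seteqP; split => w /=.
    move=> [Ew Cw] j /=; rewrite in_cons => /predU1P[->|]; last exact: Cw.
    by rewrite /C rr.
  move=> Cw; split; last by move=> j jr; apply: Cw; rewrite /= in_cons jr orbT.
  by have := Cw r.+1; rewrite /C rr /= in_cons eqxx => /(_ isT).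
rewrite C1; last 2 first.
- by rewrite /= iota_uniq mem_iota /= add0n rr.
- exact: CE.
rewrite C2 ?iota_uniq//; last by move=> j jr; apply: CE; rewrite in_cons jr orbT.
by rewrite big_cons {1}/C rr.
Qed.

Lemma poisson_measurable u : 0 <= u -> measurable_fun setT (N u).
Proof. by move=> u0; have [+ _ _ _] := pN; exact. Qed.

Lemma past_events_measurable s : past_events N s `<=` measurable.
Proof.
move=> E [u]; rewrite /= in_itv/= => /andP[u0 _].
exact: sigma_rv_measurable (poisson_measurable u0) _.
Qed.

Lemma past_events_atom s : <<s past_events N s >> `<=`
  <<s [set E | exists2 L, (forall p, p \in L -> 0 <= p.1 <= s) & E = atom L] >>.
Proof.
apply: sub_generated => E [u us] /sigma_rvP[B _ ->].
have -> : N u @^-1` B = \bigcup_(k in [set k : nat | B k%:R]) atom [:: (u, k%:R)].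
  apply/seteqP; split => w /=.
    have [_ cN _ _] := pN; have [_ NN _ _] := cN w.
    move: us; rewrite /= in_itv/= => /andP[u0 _].
    have /natrP[k Nk] := NN _ u0; rewrite Nk => Bk; exists k => // p.
    by rewrite mem_seq1 => /eqP ->.
  by move=> [k Bk /(_ (u, k%:R))]; rewrite mem_seq1 eqxx => /(_ isT) /= ->.
apply: (@bigcup_measurable _ (g_sigma_algebraType _)) => k _.
apply: sub_sigma_algebra; exists [:: (u, k%:R)] => //.
by move=> p; rewrite mem_seq1 => /eqP -> /=; move: us; rewrite /= in_itv.
Qed.

Lemma atom_measurable s L :
  (forall p, p \in L -> 0 <= p.1 <= s) -> measurable (atom L).
Proof.
elim: L => [|p L IH] Ls.
  by rewrite (_ : atom [::] = setT)//; apply/seteqP; split.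
have -> : atom (p :: L) = [set w | N p.1 w = p.2] `&` atom L.
  apply/seteqP; split => w /=.
    by move=> h; split=> [|q qL]; apply: h; rewrite in_cons ?eqxx// qL orbT.
  by move=> [h hL] q; rewrite in_cons => /predU1P[->|/hL].
apply: measurableI.
  have /andP[p0 _] := Ls p (mem_head _ _).
  exact: sigma_rv_measurable (poisson_measurable p0) _ (sigma_rv_eq _ _).
by apply: IH => q qL; apply: Ls; rewrite in_cons qL orbT.
Qed.

Lemma increment_independent_past s t E : 0 <= s -> s <= t ->
  sigma_rv (fun w => N t w - N s w) E ->
  independent_event P E <<s past_events N s >>.
Proof.
move=> s0 st sE B /past_events_atom.
have mN : measurable_fun setT (fun w => N t w - N s w).
  by apply: measurable_funB; apply: poisson_measurable => //; exact: le_trans st.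
apply: independent_event_generated.
- exact: sigma_rv_measurable mN _ sE.
- move=> _ [L Ls ->]; exact: atom_measurable Ls.
- move=> _ _ [L Ls ->] [L' Ls' ->]; exists (L ++ L').
    by move=> p; rewrite mem_cat => /orP[/Ls|/Ls'].
  apply/seteqP; split => w /=.
    by move=> [h h'] p; rewrite mem_cat => /orP[/h|/h'].
  by move=> h; split=> p pL; apply: h; rewrite mem_cat pL ?orbT.
- by move=> _ [L Ls ->]; exact: increment_independent_atom s0 st Ls sE.
Qed.

End poisson_past.

(** * Increments and the joint history of all sources *)

Section environment.
Context d (T : measurableType d) (R : realType) (P : probability T R).
Variables (G : nat -> set (set T)) (i : nat) (rate : R) (N : R -> T -> R).
Hypotheses (iG : mutually_independent P G) (mG : forall j, G j `<=` measurable)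
  (GI : forall j, setI_closed (G j)) (GT : forall j, G j setT)
  (GN : G i = sigma_process N) (pN : poisson_process P rate N).

Definition null_events : set (set T) := [set B | measurable B /\ P B = 0%E].

(* The other sources enter with their whole future, so that increments of
   different servers over one cell can be multiplied. *)
Definition environment (s : R) : set (set T) :=
  \bigcup_(j in [set j | j != i]) G j `|` past_events N s `|` null_events.

Let factor s j := if j == i then <<s past_events N s >> else G j.

Let rectangle m (C : nat -> set T) := \bigcap_(j in [set` iota 0 m]) C j.

Let past_sub s : <<s past_events N s >> `<=` G i.
Proof.
rewrite GN; apply: generated_mono => E [u]; rewrite /= in_itv/= => /andP[u0 _] uE.
by exists u.
Qed.

Let factor_sub s j : factor s j `<=` G j.
Proof. by rewrite /factor; case: eqP => [->|_ //]; exact: past_sub. Qed.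

Let factorT s j : factor s j setT.
Proof.
rewrite /factor; case: ifPn => // _.
exact: (@measurableT _ (g_sigma_algebraType (past_events N s))).
Qed.

Let factorI s j : setI_closed (factor s j).
Proof.
rewrite /factor; case: ifPn => // _.
exact: (@measurableI _ (g_sigma_algebraType (past_events N s))).
Qed.

Let mem_iota0 j m : (j \in iota 0 m) = (j < m)%N.
Proof. by rewrite mem_iota. Qed.

Let rectangle_measurable m C : (forall j, G j (C j)) -> measurable (rectangle m C).
Proof.
move=> GC; rewrite /rectangle; elim: m => [|m IH].
  by rewrite [X in measurable X](_ : _ = setT)//; apply/seteqP; split.
rewrite [X in measurable X](_ : _ = \bigcap_(j in [set` iota 0 m]) C j `&` C m).
  by apply: measurableI => //; exact: mG.
apply/seteqP; split => w.
  move=> h; split=> [j|]; last by apply: h; rewrite /mkset mem_iota0.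
  by rewrite /mkset mem_iota0 => jm; apply: h; rewrite /mkset mem_iota0 ltnW.
move=> [h hm] j; rewrite /mkset mem_iota0 ltnS leq_eqVlt => /predU1P[->//|jm].
by apply: h; rewrite /mkset mem_iota0.
Qed.

(** Padding with [setT] brings rectangles to a common length, so that they can be intersected factor
    by factor. *)
Let widen m M (C : nat -> set T) : (m <= M)%N ->
  rectangle m C = rectangle M (fun j => if (j < m)%N then C j else setT).
Proof.
move=> mM; apply/seteqP; split => w h j; rewrite /mkset mem_iota0 => jm.
  by case: ifPn => // jm'; apply: h; rewrite /mkset mem_iota0.
by have := h j; rewrite /mkset mem_iota0 (leq_trans jm mM) jm; exact.
Qed.

(** Mutual independence of the sources factorizes both rectangles, with and without E; as E belongs
    to source i, it is split off there by independence of the increment from its own past. *)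
Let increment_independent_rectangle s t E m C : 0 <= s -> s <= t ->
  sigma_rv (fun w => N t w - N s w) E -> (forall j, factor s j (C j)) ->
  P (E `&` rectangle m C) = (P E * P (rectangle m C))%E.
Proof.
move=> s0 st sE fC.
have E_Gi : G i E.
  rewrite GN; apply: (measurable_wrtP _ _).2 sE.
  have mNu u : 0 <= u ->
      measurable_fun (setT : set (g_sigma_algebraType
        (\bigcup_(t in [set t | 0 <= t]) sigma_rv (N t)))) (N u).
    move=> u0; apply/measurable_wrtP => B uB.
    by apply: sub_sigma_algebra; exists u.
  by apply: measurable_funB; apply: mNu => //; exact: le_trans st.
(* Source i must occur among the factors for E to be absorbed in it. *)
pose M := maxn m i.+1.
rewrite (widen _ (leq_maxl m i.+1)) -/M.
set C' := fun j => _.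
have fC' j : factor s j (C' j) by rewrite /C'; case: ifPn.
have iM : i \in iota 0 M by rewrite mem_iota0 /M leq_maxr.
pose C'' j := if j == i then E `&` C' j else C' j.
have -> : E `&` rectangle M C' = rectangle M C''.
  apply/seteqP; split => w.
    move=> [Ew h] j jM; rewrite /C''; case: ifPn => [_|_]; last exact: h.
    by split => //; exact: h.
  move=> h; split; first by have := h i iM; rewrite /C'' eqxx => -[].
  by move=> j jM; have := h j jM; rewrite /C''; case: ifPn => // _ [].
have GC' j : G j (C' j) by exact: factor_sub (fC' j).
have GC'' j : G j (C'' j).
  by rewrite /C''; case: ifPn => [/eqP ji|//]; apply: GI => //; rewrite ji.
rewrite /rectangle (iG (iota_uniq 0 M) (fun j _ => GC' j)).
rewrite (iG (iota_uniq 0 M) (fun j _ => GC'' j)).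
rewrite !(bigD1_seq i)//= ?iota_uniq// muleA; congr (_ * _)%E; last first.
  by apply: eq_bigr => j ji; rewrite /C'' (negbTE ji).
rewrite /C'' eqxx; apply: (increment_independent_past pN s0 st sE).
by have := fC' i; rewrite /factor eqxx.
Qed.

Lemma environment_measurable s : environment s `<=` measurable.
Proof.
move=> E [[[j _ /mG//]|/(past_events_measurable pN)//]|[]//].
Qed.

(** The pi-system consists of rectangles and null events: a null event meets a measurable one in a
    null event, so the augmentation preserves both stability under intersection and the product
    rule. *)
Lemma increment_independent s t E : 0 <= s -> s <= t ->
  sigma_rv (fun w => N t w - N s w) E ->
  independent_event P E <<s environment s >>.
Proof.
move=> s0 st sE.
have mN : measurable_fun setT (fun w => N t w - N s w).
  by apply: measurable_funB; apply: (poisson_measurable pN) => //; exact: le_trans st.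
have mE := sigma_rv_measurable mN sE.
pose Pi := [set X | exists m C, (forall j, factor s j (C j)) /\ X = rectangle m C].
have PiM : Pi `<=` measurable.
  by move=> _ [m [C [fC ->]]]; apply: rectangle_measurable => j; exact: factor_sub (fC j).
have nullI (X Y : set T) : null_events X -> measurable Y -> null_events (X `&` Y).
  move=> [mX PX] mY; split; first exact: measurableI.
  by apply/eqP; rewrite eq_le measure_ge0 andbT -PX le_measure ?inE//; exact: measurableI.
have sub : environment s `<=` Pi `|` null_events.
  have single j X : factor s j X -> Pi X.
    move=> fX; exists j.+1, (fun k => if k == j then X else setT); split.
      by move=> k; case: ifPn => [/eqP ->|_].
    apply/seteqP; split => w; first by move=> Xw k _; case: ifPn.
    by move=> /(_ j); rewrite /mkset mem_iota0 eqxx ltnSn; exact.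
  move=> X [[[j /= ji GX]|pX]|nX]; [left|left|by right].
    by apply: (single j); rewrite /factor (negbTE ji).
  by apply: (single i); rewrite /factor eqxx; exact: sub_sigma_algebra.
move=> B /(generated_mono sub).
apply: independent_event_generated => //.
- by move=> X [/PiM//|[]].
- move=> X Y [PX|nX] [PY|nY].
  + left; move: PX PY => [m [C [fC ->]]] [m' [C' [fC' ->]]].
    rewrite (widen _ (leq_maxl m m')) [rectangle m' _](widen _ (leq_maxr m m')).
    exists (maxn m m'), (fun j => (if (j < m)%N then C j else setT) `&`
      (if (j < m')%N then C' j else setT)); split.
      by move=> j; apply: factorI; case: ifPn.
    by rewrite /rectangle bigcapI.
  + by right; rewrite setIC; apply: nullI => //; exact: PiM.
  + by right; apply: nullI => //; exact: PiM.
  + by right; apply: nullI => //; case: nY.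
- move=> X [[m [C [fC ->]]]|nX]; first exact: increment_independent_rectangle sE fC.
  have [_ ->] := nX; rewrite mule0 setIC.
  by have [] := nullI _ _ nX mE.
Qed.

End environment.

(** * Moments *)

Section moments_toolkit.
Context d (T : measurableType d) (R : realType) (P : probability T R).
Implicit Types (X Y Z : T -> R) (B : set T) (H : set (set T)).

Definition summable1 X := P.-integrable setT (EFin \o X).

(** Real-valued, hence informative for summable variables: [fine] sends an infinite integral to
    0. *)
Definition mean_on B X : R := \int[P]_(w in B) X w.

Lemma summable1_measurable X : summable1 X -> measurable_fun setT X.
Proof. by move=> /measurable_int/measurable_EFinP. Qed.

Lemma summable1S B X : measurable B -> summable1 X -> P.-integrable B (EFin \o X).
Proof. by move=> mB; apply: integrableS. Qed.

Lemma summable1D X Y : summable1 X -> summable1 Y -> summable1 (fun w => X w + Y w).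
Proof. by move=> iX iY; exact: integrableD iX iY. Qed.

Lemma summable1Z c X : summable1 X -> summable1 (fun w => c * X w).
Proof. by move=> iX; exact: integrableZl iX. Qed.

Lemma summable1N X : summable1 X -> summable1 (fun w => - X w).
Proof. by move=> /(summable1Z (-1)); under eq_fun do rewrite mulN1r. Qed.

Lemma summable1B X Y : summable1 X -> summable1 Y -> summable1 (fun w => X w - Y w).
Proof. by move=> iX /summable1N; exact: summable1D. Qed.

Lemma summable1_cst c : summable1 (fun=> c).
Proof. exact: finite_measure_integrable_cst. Qed.

Lemma summable1_sum (I : eqType) (r : seq I) (F : I -> T -> R) :
  (forall i, i \in r -> summable1 (F i)) -> summable1 (fun w => \sum_(i <- r) F i w).
Proof.
elim: r => [|i r IH] iF; first by under eq_fun do rewrite big_nil; exact: summable1_cst.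
under eq_fun do rewrite big_cons.
apply: summable1D; first by apply: iF; rewrite mem_head.
by apply: IH => j jr; apply: iF; rewrite in_cons jr orbT.
Qed.

Lemma summable1_le X Y : measurable_fun setT X -> (forall w, `|X w| <= Y w) ->
  summable1 Y -> summable1 X.
Proof.
move=> mX XY; apply: le_integrable => //; first exact/measurable_EFinP.
move=> w _ /=; rewrite lee_fin (le_trans (XY w))//; exact: ler_norm.
Qed.

Lemma summable1_norm X : summable1 X -> summable1 (fun w => `|X w|).
Proof. exact: integrable_norm. Qed.

Lemma mean_onD B X Y : measurable B -> summable1 X -> summable1 Y ->
  mean_on B (fun w => X w + Y w) = mean_on B X + mean_on B Y.
Proof. by move=> mB iX iY; apply: RintegralD => //; exact: summable1S. Qed.

Lemma mean_onB B X Y : measurable B -> summable1 X -> summable1 Y ->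
  mean_on B (fun w => X w - Y w) = mean_on B X - mean_on B Y.
Proof. by move=> mB iX iY; apply: RintegralB => //; exact: summable1S. Qed.

Lemma mean_onZ B c X : measurable B -> summable1 X ->
  mean_on B (fun w => c * X w) = c * mean_on B X.
Proof. by move=> mB iX; apply: RintegralZl => //; exact: summable1S. Qed.

Lemma mean_on_cst B c : measurable B -> mean_on B (fun=> c) = c * fine (P B).
Proof. by move=> mB; rewrite /mean_on Rintegral_cst. Qed.

Lemma mean_on_sum (I : eqType) (r : seq I) (F : I -> T -> R) B : measurable B ->
  (forall i, i \in r -> summable1 (F i)) ->
  mean_on B (fun w => \sum_(i <- r) F i w) = \sum_(i <- r) mean_on B (F i).
Proof.
move=> mB; elim: r => [|i r IH] iF.
  rewrite big_nil; under [X in mean_on _ X]eq_fun do rewrite big_nil.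
  by rewrite mean_on_cst// mul0r.
rewrite big_cons -IH; last by move=> j jr; apply: iF; rewrite in_cons jr orbT.
under [X in mean_on _ X]eq_fun do rewrite big_cons.
rewrite mean_onD//; first by apply: iF; rewrite mem_head.
by apply: summable1_sum => j jr; apply: iF; rewrite in_cons jr orbT.
Qed.

Lemma mean_on_fin B X : measurable B -> summable1 X ->
  (\int[P]_(w in B) (X w)%:E = (mean_on B X)%:E)%E.
Proof.
move=> mB iX; rewrite /mean_on /Rintegral fineK//.
by apply: integrable_fin_num => //; exact: summable1S.
Qed.

Lemma mean_on_indic B X : measurable B ->
  mean_on B X = mean_on setT (fun w => \1_B w * X w).
Proof.
move=> mB; rewrite /mean_on Rintegral_mkcond; congr (Rintegral _ _ _).
by apply/funext => w; rewrite patchE indicE; case: ifPn; rewrite ?mul1r ?mul0r.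
Qed.

Lemma mean_on_le B X Y : measurable B -> summable1 X -> summable1 Y ->
  (forall w, X w <= Y w) -> mean_on B X <= mean_on B Y.
Proof.
by move=> mB iX iY XY; apply: le_Rintegral => //; exact: summable1S.
Qed.

Lemma mean_on_ae B X Y : measurable B -> measurable_fun setT X -> measurable_fun setT Y ->
  {ae P, forall w, X w = Y w} -> mean_on B X = mean_on B Y.
Proof.
move=> mB mX mY XY; congr fine; apply: ae_eq_integral => //.
- exact/measurable_EFinP/measurable_funTS.
- exact/measurable_EFinP/measurable_funTS.
- by apply: filterS XY => w /= -> _.
Qed.

Lemma summable1_ae X Y : measurable_fun setT X ->
  {ae P, forall w, X w = Y w} -> summable1 Y -> summable1 X.
Proof.
move=> mX XY iY; apply/integrableP; split; first exact/measurable_EFinP.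
have /integrableP[mY] := iY; apply: le_lt_trans.
rewrite le_eqVlt; apply/orP; left; apply/eqP; apply: ae_eq_integral => //.
- by apply: measurableT_comp => //; exact/measurable_EFinP.
- by apply: measurableT_comp.
- by apply: filterS XY => w /= -> _.
Qed.

(** Dominated convergence is applied on the whole space for the summability of the limit and on B
    for the means. *)
Lemma mean_on_dominated B (F : nat -> T -> R) X Y : measurable B ->
  (forall n, measurable_fun setT (F n)) ->
  (forall w, F n w @[n --> \oo] --> X w) -> summable1 Y ->
  {ae P, forall w, forall n, `|F n w| <= Y w} ->
  summable1 X /\ mean_on B (F n) @[n --> \oo] --> mean_on B X.
Proof.
move=> mB mF FX iY FY.
have mX : measurable_fun setT X.
  by apply: (@measurable_fun_cvg _ _ _ _ F) => // w _; exact: FX.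
have EFX w : (F n w)%:E @[n --> \oo] --> (X w)%:E.
  by apply: cvg_EFin; [exact: nearW|exact: FX].
have [] := @dominated_convergence _ _ _ P setT measurableT (fun n => EFin \o F n)
  (EFin \o X) (EFin \o Y).
- by move=> n; apply/measurable_EFinP.
- exact/measurable_EFinP.
- by apply: aeW => w _; exact: EFX.
- exact: iY.
- by apply: filterS FY => w FYw n _; rewrite /= lee_fin.
move=> iX _ _; split => //.
have [] := @dominated_convergence _ _ _ P B mB (fun n => EFin \o F n)
  (EFin \o X) (EFin \o Y).
- by move=> n; apply/measurable_EFinP; exact: measurable_funTS.
- by apply/measurable_EFinP; exact: measurable_funTS.
- by apply: aeW => w _; exact: EFX.
- exact: summable1S.
- by apply: filterS FY => w FYw n _; rewrite /= lee_fin.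
move=> _ _ cv; apply: fine_cvg; rewrite fineK; first exact: cv.
by apply: integrable_fin_num => //; exact: summable1S.
Qed.

End moments_toolkit.

(** * Square-integrable variables and orthogonality to the past *)

Section square_summable.
Context d (T : measurableType d) (R : realType) (P : probability T R).
Implicit Types (X Y Z : T -> R) (B : set T) (H : set (set T)).

Definition summable2 X := measurable_fun setT X /\ summable1 P (fun w => X w ^+ 2).

Lemma summable2_measurable X : summable2 X -> measurable_fun setT X.
Proof. by case. Qed.

Lemma summable2M X Y : summable2 X -> summable2 Y -> summable1 P (fun w => X w * Y w).
Proof.
move=> [mX iX] [mY iY]; apply: (summable1_le _ _ (summable1D iX iY)).
  exact: measurable_funM.
move=> w; move: (X w) (Y w) => x y; rewrite ler_norml.
have := sqr_ge0 (x + y); have := sqr_ge0 (x - y).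
have := sqr_ge0 x; have := sqr_ge0 y; nra.
Qed.

Lemma summable2_cst c : summable2 (fun=> c).
Proof. by split => //; exact: summable1_cst. Qed.

Lemma summable2_summable1 X : summable2 X -> summable1 P X.
Proof.
by move=> iX; have := summable2M iX (summable2_cst 1); under eq_fun do rewrite mulr1.
Qed.

Lemma summable2D X Y : summable2 X -> summable2 Y -> summable2 (fun w => X w + Y w).
Proof.
move=> iX iY; split; first exact: measurable_funD iX.1 iY.1.
under eq_fun do rewrite sqrrD.
apply: summable1D iY.2; apply: summable1D; first exact: iX.2.
by under eq_fun do rewrite -mulr_natl; apply: summable1Z; exact: summable2M.
Qed.

Lemma summable2Z c X : summable2 X -> summable2 (fun w => c * X w).
Proof.
move=> iX; split; first by apply: measurable_funM iX.1.
by under eq_fun do rewrite exprMn; apply: summable1Z iX.2.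
Qed.

Lemma summable2B X Y : summable2 X -> summable2 Y -> summable2 (fun w => X w - Y w).
Proof.
by move=> iX /(summable2Z (-1))/(summable2D iX); under eq_fun do rewrite mulN1r.
Qed.

Lemma summable2_sum (I : eqType) (r : seq I) (F : I -> T -> R) :
  (forall i, i \in r -> summable2 (F i)) -> summable2 (fun w => \sum_(i <- r) F i w).
Proof.
elim: r => [|i r IH] iF; first by under eq_fun do rewrite big_nil; exact: summable2_cst.
under eq_fun do rewrite big_cons.
apply: summable2D; first by apply: iF; rewrite mem_head.
by apply: IH => j jr; apply: iF; rewrite in_cons jr orbT.
Qed.

Lemma summable2_bounded_mul (h : T -> R) X : measurable_fun setT h -> (forall w, `|h w| <= 1) ->
  summable2 X -> summable2 (fun w => h w * X w).
Proof.
move=> mh h1 [mX iX]; split; first exact: measurable_funM.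
apply: (summable1_le _ _ iX) => [|w].
  by apply: measurable_funX; exact: measurable_funM.
rewrite ger0_norm ?sqr_ge0// exprMn ler_piMl ?sqr_ge0//.
by rewrite -[leLHS]real_normK ?num_real// expr_le1.
Qed.

Import HBNNSimple.

Section orthogonality.
Variables (H : set (set T)) (X Z : T -> R).
Hypotheses (Hm : <<s H >> `<=` measurable) (iX : summable1 P X)
  (X0 : forall B, <<s H >> B -> mean_on P B X = 0).

Lemma mean_mul_simple_eq0 (g : {nnsfun (g_sigma_algebraType H) >-> R}) :
  mean_on P setT (fun w => g w * X w) = 0.
Proof.
pose F (y : R) (w : T) := \1_(g @^-1` [set y] : set T) w * X w.
have -> : (fun w => g w * X w) =
    (fun w => \sum_(y <- finmap.enum_fset (fset_set (range g))) y * F y w).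
  apply/funext => w; rewrite fimfunE fsbig_finite/=; last exact: fimfunP.
  by rewrite mulr_suml; apply: eq_bigr => y _; rewrite mulrA.
have mg y : <<s H >> (g @^-1` [set y]).
  by rewrite -[g @^-1` _]setTI; apply: (measurable_funP g).
have iF y : summable1 P (F y).
  apply: (summable1_le _ _ (summable1_norm iX)) => [|w].
    apply: measurable_funM; last exact: summable1_measurable iX.
    by apply: measurable_indic; exact: Hm.
  rewrite /F indicE normrM; case: (_ \in _).
    by rewrite /= normr1 mul1r.
  by rewrite /= normr0 mul0r.
rewrite mean_on_sum//; last by move=> y _; exact: summable1Z.
rewrite big1_seq// => y _; rewrite mean_onZ// /F.
by rewrite -mean_on_indic ?X0 ?mulr0//; exact: Hm.
Qed.

Let mean_mul_ge0_eq0 (U : T -> R) : (forall w, 0 <= U w) ->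
  measurable_fun (setT : set (g_sigma_algebraType H)) U ->
  summable1 P (fun w => U w * X w) -> mean_on P setT (fun w => U w * X w) = 0.
Proof.
move=> U0 mU iUX.
have mEU : measurable_fun (setT : set (g_sigma_algebraType H)) (EFin \o U).
  exact/measurable_EFinP.
pose g := nnsfun_approx measurableT mEU.
have gU n w : g n w <= U w.
  rewrite -lee_fin /g nnsfun_approxE.
  by apply: le_approx => // v _; rewrite lee_fin.
have gcv w : g n w @[n --> \oo] --> U w.
  have := @cvg_nnsfun_approx _ _ _ _ measurableT _ mEU _ w I.
  by move=> h; apply: (fine_cvg (h _)) => v _; rewrite lee_fin.
have [|||||_ cv] := @mean_on_dominated _ _ _ P setT (fun n w => g n w * X w)
  (fun w => U w * X w) (fun w => `|U w * X w|).
- exact: measurableT.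
- move=> n; apply: measurable_funM; last exact: summable1_measurable iX.
  exact: measurable_fun_wrt Hm _.
- by move=> w; apply: cvgMl; exact: gcv.
- exact: summable1_norm.
- apply: aeW => w n; rewrite !normrM ler_wpM2r//.
  by rewrite !ger0_norm.
rewrite -(cvg_lim (@Rhausdorff R) cv).
under [X in lim (X @ _)]eq_fun do rewrite mean_mul_simple_eq0.
exact: lim_cst.
Qed.

(** The usual extension from events to functions: simple functions, nonnegative ones by dominated
    convergence, then positive and negative parts. Integrability is asked of the product, as Z is
    typically an unbounded sum of earlier noises. *)
Lemma mean_mul_eq0 : measurable_fun (setT : set (g_sigma_algebraType H)) Z ->
  summable1 P (fun w => Z w * X w) -> mean_on P setT (fun w => Z w * X w) = 0.
Proof.
move=> mZ iZX.
have mX := summable1_measurable iX.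
have part (U : T -> R) : (forall w, 0 <= U w <= `|Z w|) ->
    measurable_fun (setT : set (g_sigma_algebraType H)) U ->
    summable1 P (fun w => U w * X w) /\ mean_on P setT (fun w => U w * X w) = 0.
  move=> UZ mU; suff iUX : summable1 P (fun w => U w * X w).
    by split => //; apply: mean_mul_ge0_eq0 => // w; have /andP[] := UZ w.
  apply: (summable1_le _ _ (summable1_norm iZX)) => [|w].
    by apply: measurable_funM => //; exact: measurable_fun_wrt Hm mU.
  have /andP[U0 UZw] := UZ w; rewrite !normrM ler_wpM2r// ger0_norm//.
have [||iP P0] := part (fun w => Num.max (Z w) 0).
- by move=> w; rewrite le_max lexx orbT ge_max ler_norm normr_ge0.
- by apply: measurable_maxr.
have [||iN N0] := part (fun w => Num.max (- Z w) 0).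
- by move=> w; rewrite le_max lexx orbT ge_max -normrN ler_norm normr_ge0.
- by apply: measurable_maxr => //; exact: measurableT_comp.
have -> : (fun w => Z w * X w) =
    (fun w => Num.max (Z w) 0 * X w - Num.max (- Z w) 0 * X w).
  apply/funext => w; rewrite -mulrBl; congr (_ * _).
  by case: (leP (Z w) 0) => ?; case: (leP (- Z w) 0) => ?; lra.
by rewrite mean_onB// P0 N0 subr0.
Qed.

End orthogonality.

End square_summable.

(** * Moments of Poisson increments *)

Section poisson_moments.
Context d (T : measurableType d) (R : realType) (P : probability T R).

Local Open Scope ereal_scope.

(** Lets an index shift absorb one factor k: the mean reduces to the total mass, the second moment
    to the mean plus the total mass. *)
Lemma poisson_pmfS (r : R) k : (0 < r)%R ->
  (k.+1%:R * poisson_pmf r k.+1 = r * poisson_pmf r k)%R.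
Proof.
move=> r0; rewrite /poisson_pmf r0 factS natrM exprS.
have k0 : (k.+1%:R : R) != 0%R by rewrite pnatr_eq0.
have f0 : (k`!%:R : R) != 0%R by rewrite pnatr_eq0 -lt0n fact_gt0.
move: (k.+1%:R : R) (k`!%:R : R) k0 f0 => a b a0 b0.
by field; rewrite a0 b0.
Qed.

Lemma poisson_pmf_sum (r : R) : (0 < r)%R ->
  \sum_(0 <= k <oo) (poisson_pmf r k)%:E = 1.
Proof.
move=> r0; have := probability_setT (poisson_prob r 0%N).
rewrite /= /poisson_prob r0 -nneseries_esumT//.
by move=> k; rewrite lee_fin poisson_pmf_ge0.
Qed.

Let shift (f : nat -> R) : (forall k, (0 <= f k)%R) -> f 0%N = 0%R ->
  \sum_(0 <= k <oo) (f k)%:E = \sum_(0 <= k <oo) (f k.+1)%:E.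
Proof.
move=> f0 f00; rewrite nneseries_recl//; last by move=> k _; rewrite lee_fin.
rewrite f00 add0e -(nneseries_addn 1); last by move=> k; rewrite lee_fin.
by apply: eq_eseriesr => k _; rewrite addn1.
Qed.

Lemma poisson_pmf_mean (r : R) : (0 < r)%R ->
  \sum_(0 <= k <oo) (k%:R * poisson_pmf r k)%:E = r%:E.
Proof.
move=> r0; rewrite shift ?mul0r//; last first.
  by move=> k; rewrite mulr_ge0// poisson_pmf_ge0.
under eq_eseriesr do rewrite poisson_pmfS// EFinM.
rewrite nneseriesZl; last by move=> k _; rewrite lee_fin poisson_pmf_ge0.
by rewrite poisson_pmf_sum// mule1.
Qed.

Lemma poisson_pmf_square_mean (r : R) : (0 < r)%R ->
  \sum_(0 <= k <oo) (k%:R ^+ 2 * poisson_pmf r k)%:E = (r + r ^+ 2)%:E.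
Proof.
move=> r0; rewrite shift ?mul0r//; last 2 first.
- by move=> k; rewrite mulr_ge0// poisson_pmf_ge0.
- by rewrite expr0n mul0r.
under eq_eseriesr => k _.
  rewrite expr2 -mulrA poisson_pmfS// mulrCA -natr1 mulrDl mul1r EFinM EFinD; over.
rewrite nneseriesZl; last first.
  by move=> k _; rewrite adde_ge0// lee_fin ?mulr_ge0 ?poisson_pmf_ge0.
rewrite nneseriesD; last 2 first.
- by move=> k _ _; rewrite lee_fin ?mulr_ge0 ?poisson_pmf_ge0.
- by move=> k _ _; rewrite lee_fin ?poisson_pmf_ge0.
rewrite poisson_pmf_mean// poisson_pmf_sum// -EFinD -EFinM.
by congr EFin; ring.
Qed.

Variables (rate : R) (N : R -> T -> R).
Hypotheses (rate0 : (0 < rate)%R) (pN : poisson_process P rate N).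

Section increment.
Variables (s t : R) (B : set T).
Hypotheses (s0 : (0 <= s)%R) (st : (s <= t)%R) (mB : measurable B)
  (iB : forall k : nat, P ([set w | N t w - N s w = k%:R]%R `&` B) =
    P [set w | N t w - N s w = k%:R]%R * P B).

Let r : R := (rate * (t - s))%R.

Lemma increment_nat w : (N t w - N s w \is a Num.nat)%R.
Proof.
have [_ + _ _] := pN => /(_ w)[_ NN Nh _].
rewrite natrEint subr_ge0 Nh// andbT rpredB// intr_nat// NN//.
exact: le_trans st.
Qed.

Lemma increment_measurable : measurable_fun setT (fun w => N t w - N s w)%R.
Proof.
by apply: measurable_funB; apply: (poisson_measurable pN) => //; exact: le_trans st.
Qed.

(** Integer values split B into countably many slices on which the integrand is constant, and [iB]
    gives the probability of each slice. *)
Lemma integral_increment (f : R -> R) : (s < t)%R -> (forall k : nat, (0 <= f k%:R)%R) ->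
  measurable_fun setT f ->
  \int[P]_(w in B) (f (N t w - N s w)%R)%:E =
  (\sum_(0 <= k <oo) (f k%:R * poisson_pmf r k)%:E) * P B.
Proof.
move=> slt f0 mf.
pose F (k : nat) := [set w | N t w - N s w = k%:R]%R `&` B.
have mD : measurable_fun setT (fun w => (f (N t w - N s w)%R)%:E).
  by apply/measurable_EFinP; apply: measurableT_comp => //; exact: increment_measurable.
have mF k : measurable (F k).
  apply: measurableI => //.
  exact: sigma_rv_measurable increment_measurable _ (sigma_rv_eq _ _).
have BF : B = \bigcup_k F k.
  apply/seteqP; split => [w Bw|w [k _ []]//].
  by have /natrP[k Ek] := increment_nat w; exists k.
have fD w : (0 <= f (N t w - N s w))%R.
  by have /natrP[k ->] := increment_nat w.
rewrite {1}BF ge0_integral_bigcup//.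
- transitivity (\sum_(0 <= k <oo) ((P B) * (f k%:R * poisson_pmf r k)%:E)).
    apply: eq_eseriesr => k _.
    transitivity (\int[P]_(w in F k) (cst (f k%:R)%:E w)).
      by apply: eq_integral => w /set_mem[/= -> _].
    rewrite integral_cst//.
    apply: (etrans (congr1 (fun x => (f k%:R)%:E * x) (iB k))).
    have [_ _ _ ->//] := pN.
    by rewrite muleA -EFinM muleC.
  have [p ->] : exists p, P B = p%:E.
    by exists (fine (P B)); rewrite fineK// fin_num_measure.
  rewrite nneseriesZl 1?muleC// => k _.
  by rewrite lee_fin mulr_ge0// poisson_pmf_ge0.
- exact: measurable_funTS.
- by move=> w _; rewrite lee_fin.
- apply/trivIsetP => i j _ _ /eqP ij; apply/seteqP; split => // w [[/= e1 _] [/= e2 _]].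
  by apply: ij; apply/eqP; rewrite -(eqr_nat R) -e1 -e2.
Qed.

Let mean_increment_pos (f : R -> R) (c : R) : (s < t)%R ->
  (forall k : nat, (0 <= f k%:R)%R) -> measurable_fun setT f ->
  \sum_(0 <= k <oo) (f k%:R * poisson_pmf r k)%:E = c%:E ->
  mean_on P B (fun w => f (N t w - N s w)%R) = (c * fine (P B))%R.
Proof.
move=> slt f0 mf fc; rewrite /mean_on /Rintegral integral_increment// fc.
by rewrite fineM// fin_num_measure.
Qed.

Let r0 : (s < t)%R -> (0 < r)%R.
Proof. by move=> slt; rewrite /r mulr_gt0// subr_gt0. Qed.

Lemma mean_increment :
  mean_on P B (fun w => N t w - N s w)%R = (rate * (t - s) * fine (P B))%R.
Proof.
(* The Poisson law is prescribed for s < t only, so the degenerate interval is treated apart. *)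
move: st; rewrite le_eqVlt => /predU1P[<-|slt].
  by rewrite subrr mulr0; under [X in mean_on _ _ X]eq_fun do rewrite subrr;
    rewrite mean_on_cst.
by apply: (@mean_increment_pos id) => //; exact/poisson_pmf_mean/r0.
Qed.

Lemma mean_increment_sqr :
  mean_on P B (fun w => (N t w - N s w) ^+ 2)%R =
  ((rate * (t - s) + (rate * (t - s)) ^+ 2) * fine (P B))%R.
Proof.
move: st; rewrite le_eqVlt => /predU1P[<-|slt].
  rewrite subrr mulr0 expr0n addr0; under [X in mean_on _ _ X]eq_fun do
    rewrite subrr expr0n.
  by rewrite mean_on_cst.
apply: (@mean_increment_pos (fun x => x ^+ 2)%R) => //.
exact/poisson_pmf_square_mean/r0.
Qed.

End increment.

Lemma increment_summable2 s t : (0 <= s)%R -> (s <= t)%R ->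
  summable2 P (fun w => N t w - N s w)%R.
Proof.
move=> s0 st; have mN := increment_measurable s0 st; split => //.
apply/integrableP; split; first by apply/measurable_EFinP; exact: measurable_funX.
rewrite (_ : \int[P]_x _ = \int[P]_x ((N t x - N s x) ^+ 2)%:E); last first.
  by apply: eq_integral => w _; rewrite /= ger0_norm// sqr_ge0.
move: st; rewrite le_eqVlt => /predU1P[<-|slt].
  under eq_integral do rewrite subrr expr0n.
  by rewrite integral0.
rewrite (@integral_increment s t setT _ _ _ _ (fun x => x ^+ 2)%R)//.
- rewrite poisson_pmf_square_mean ?mulr_gt0 ?subr_gt0//.
  by rewrite probability_setT mule1 ltry.
- exact: ltW.
- by move=> k; rewrite setIT probability_setT mule1.
Qed.

End poisson_moments.

(** * Compensated departures *)

Section queue_measurability.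
Context d (T : measurableType d) (R : realType) (P : probability T R).
Variables (mu lam : R) (Q A : R -> T -> R) (S : nat -> R -> T -> R).
Hypotheses (pA : poisson_process P lam A)
  (pS : forall k, (1 <= k)%N -> poisson_process P mu (S k))
  (mQ0 : measurable_fun setT (Q 0))
  (cQ : forall w, cadlag (Q ^~ w))
  (Qeq : forall w t, 0 <= t ->
    ((Q t w)%:E = (Q 0 w + A t w)%:E - departures Q S t w)%E).

(** The generators of [history], named so that adaptedness becomes measurability on the type
    [g_sigma_algebraType] of this set. *)
Definition history_events (t : R) : set (set T) :=
  sigma_rv (Q 0)
  `|` \bigcup_(s in `[0, t]) sigma_rv (A s)
  `|` \bigcup_(k in [set k | (1 <= k)%N])
        \bigcup_(s in `[0, t]) sigma_rv (S k s)
  `|` [set B | measurable B /\ P B = 0%E].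

Let arrival_counting w : counting_path (A ^~ w).
Proof. by have [_ + _ _] := pA; exact. Qed.

Let service_counting w k : (1 <= k)%N -> counting_path (S k ^~ w).
Proof. by move=> /pS[_ + _ _]; exact. Qed.

Lemma history_events_mono s t : s <= t -> history_events s `<=` history_events t.
Proof.
move=> st E.
have itv u : `[0, s]%classic u -> `[0, t]%classic u.
  by rewrite /= !in_itv/= => /andP[-> /le_trans]; exact.
case=> [[[?|[u us ?]]|[k k1 [u us ?]]]|?].
- by left; left; left.
- by left; left; right; exists u => //; exact: itv.
- by left; right; exists k => //; exists u => //; exact: itv.
- by right.
Qed.

Lemma history_events_measurable t : history_events t `<=` measurable.
Proof.
move=> E [[[|[u]]|[k k1 [u]]]|[]//].
- exact: sigma_rv_measurable.
- rewrite /= in_itv/= => /andP[u0 _].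
  exact: sigma_rv_measurable (poisson_measurable pA u0) _.
- rewrite /= in_itv/= => /andP[u0 _].
  exact: sigma_rv_measurable (poisson_measurable (pS k1) u0) _.
Qed.

Lemma history_measurable t : <<s history_events t >> `<=` measurable.
Proof.
by apply: smallest_sub; [exact: sigma_algebra_measurable|exact: history_events_measurable].
Qed.

Definition adapted_at (t : R) (X : T -> R) :=
  measurable_fun (setT : set (g_sigma_algebraType (history_events t))) X.

Lemma adapted_at_mono s t X : s <= t -> adapted_at s X -> adapted_at t X.
Proof.
move=> st /measurable_wrtP h; apply/measurable_wrtP; apply: subset_trans h _.
exact: generated_mono (history_events_mono st).
Qed.

Lemma adapted_at_measurable t X : adapted_at t X -> measurable_fun setT X.
Proof. exact: measurable_fun_wrt (@history_measurable t). Qed.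

Lemma adapted_at_Q0 t : adapted_at t (Q 0).
Proof.
by apply/measurable_wrtP => E hE; apply: sub_sigma_algebra; left; left; left.
Qed.

Lemma adapted_at_arrival s t : 0 <= s -> s <= t -> adapted_at t (A s).
Proof.
move=> s0 st; apply/measurable_wrtP => E hE; apply: sub_sigma_algebra.
by left; left; right; exists s => //=; rewrite in_itv/= s0.
Qed.

Lemma adapted_at_service k s t : (1 <= k)%N -> 0 <= s -> s <= t -> adapted_at t (S k s).
Proof.
move=> k1 s0 st; apply/measurable_wrtP => E hE; apply: sub_sigma_algebra.
by left; right; exists k => //; exists s => //=; rewrite in_itv/= s0.
Qed.

Definition level (k : nat) (x : R) : R := (k%:R <= x)%R%:R.

Lemma measurable_level k : measurable_fun setT (level k).
Proof.
rewrite (_ : level k = \1_(`[k%:R, +oo[)); first exact: measurable_indic.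
apply/funext => x; rewrite /level indicE; congr ((nat_of_bool _)%:R).
by apply/idP/idP => [h|/set_mem]; [apply/mem_set; rewrite /= in_itv/= h|
  rewrite /= in_itv/= andbT].
Qed.

Lemma level_bounds k x : 0 <= level k x <= 1.
Proof. by rewrite /level; case: (k%:R <= x); rewrite /= ?lexx ?ler01. Qed.

Lemma level_sqr k x : level k x ^+ 2 = level k x.
Proof. by rewrite /level; case: (k%:R <= x); rewrite /= ?expr1n ?expr0n. Qed.

(* For m large (depending on w) the scheme reproduces Q exactly on the grid. *)
Fixpoint euler t m i : T -> R :=
  if i is j.+1 then fun w => euler t m j w
    + (A (grid 0 t m j.+1) w - A (grid 0 t m j) w)
    - \sum_(1 <= k < m.+1) level k (euler t m j w) *
        (S k (grid 0 t m j.+1) w - S k (grid 0 t m j) w)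
  else Q 0.

Lemma adapted_at_euler t m i : 0 <= t -> (i <= m.+1)%N -> adapted_at t (euler t m i).
Proof.
move=> t0; elim: i => [|i IH] im /=; first exact: adapted_at_Q0.
have {}IH := IH (ltnW im).
have g0 j : 0 <= grid 0 t m j by exact: grid_ge.
have gi : grid 0 t m i <= t by exact/grid_le/ltnW.
have gi1 : grid 0 t m i.+1 <= t by exact: grid_le.
apply: measurable_funB; first (apply: measurable_funD => //; apply: measurable_funB).
- exact: adapted_at_arrival.
- exact: adapted_at_arrival.
rewrite [X in measurable_fun _ X](_ : _ = fun w => \sum_(k < m) (level k.+1 (euler t m i w) *
        (S k.+1 (grid 0 t m i.+1) w - S k.+1 (grid 0 t m i) w))); last first.
  by apply/funext => w; rewrite big_add1 big_mkord.
apply: measurable_sum => k; apply: measurable_funM.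
  exact: measurableT_comp (measurable_level _) IH.
by apply: measurable_funB; exact: adapted_at_service.
Qed.

Lemma euler_cvg t w : 0 <= t -> euler t m m.+1 w @[m --> \oo] --> Q t w.
Proof.
move=> t0; apply: cvg_near_cst.
have := queue_riemann (arrival_counting w) (@service_counting w) (cQ w) (Qeq w) t0.
apply: filterS => m hm.
rewrite -[in RHS](grid_last 0 t m).
suff H i : (i <= m.+1)%N -> euler t m i w = Q (grid 0 t m i) w by exact: H.
elim: i => [|i IH] im; first by rewrite grid0.
rewrite /= (IH (ltnW im)) [RHS]hm//.
Qed.

Lemma adapted_at_queue s t : 0 <= s -> s <= t -> adapted_at t (Q s).
Proof.
move=> s0 st; apply: (adapted_at_mono st).
apply: (@measurable_fun_cvg _ (g_sigma_algebraType _) _ _ (fun m => euler s m m.+1)).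
  by move=> m; exact: adapted_at_euler.
by move=> w _; exact: euler_cvg.
Qed.

Lemma adapted_at_departed s t : 0 <= s -> s <= t -> adapted_at t (departed Q S ^~ s).
Proof.
move=> s0 st; rewrite [X in adapted_at _ X](_ : _ = fun w => Q 0 w + A s w - Q s w).
  apply: measurable_funB; last exact: adapted_at_queue.
  by apply: measurable_funD; [exact: adapted_at_Q0|exact: adapted_at_arrival].
by apply/funext => w; rewrite (queueE (Qeq w) s0) subKr.
Qed.

(** Riemann sums of adapted variables converge to the integral on every path; this avoids joint
    measurability in time and chance. *)
Lemma adapted_at_integral (g : R -> R) s t u : continuous g -> 0 <= s -> s <= t -> t <= u ->
  adapted_at u (fun w => \int[lebesgue_measure]_(r in `[s, t]) g (Q r w)).
Proof.
move=> cg s0 st tu.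
have gcad w : cadlag (fun r => g (Q r w)) by exact: (cadlag_comp cg (cQ w)).
apply: (@measurable_fun_cvg _ (g_sigma_algebraType _) _ _
  (fun m w => \sum_(i < m.+1) g (Q (grid s t m i) w) * mesh s t m)); last first.
  by move=> w _; exact: riemann_sum_cvg.
move=> m; apply: measurable_sum => i; apply: measurable_funM => //.
apply: measurableT_comp; first exact: continuous_measurable_fun.
apply: adapted_at_queue; first by rewrite (le_trans s0)// grid_ge.
by rewrite (le_trans _ tu)// grid_le// ltnW.
Qed.

End queue_measurability.

(** * Compensated service increments over one cell *)

Section compensated_services.
Context d (T : measurableType d) (R : realType) (P : probability T R).
Variables (mu lam : R) (Q A : R -> T -> R) (S : nat -> R -> T -> R).
Hypotheses (mu0 : 0 < mu) (lam0 : 0 < lam)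
  (pA : poisson_process P lam A)
  (pS : forall k, (1 <= k)%N -> poisson_process P mu (S k))
  (mQ0 : measurable_fun setT (Q 0))
  (iG : mutually_independent P (source Q A S)).

Lemma source_measurable j : source Q A S j `<=` measurable.
Proof.
case: j => [|[|j]] /=; first exact: sigma_rv_measurable.
- apply: smallest_sub; first exact: sigma_algebra_measurable.
  by move=> E [u /= u0]; exact: sigma_rv_measurable (poisson_measurable pA u0) _.
- apply: smallest_sub; first exact: sigma_algebra_measurable.
  move=> E [u /= u0].
  exact: sigma_rv_measurable (poisson_measurable (pS (ltn0Sn j)) u0) _.
Qed.

Lemma sourceI j : setI_closed (source Q A S j).
Proof.
case: j => [|[|j]] /=.
- move=> E E' /sigma_rvP[B mB ->] /sigma_rvP[B' mB' ->]; apply/sigma_rvP.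
  by exists (B `&` B') => //; exact: measurableI.
- exact: (@measurableI _ (g_sigma_algebraType _)).
- exact: (@measurableI _ (g_sigma_algebraType _)).
Qed.

Lemma sourceT j : source Q A S j setT.
Proof.
case: j => [|[|j]] /=; first by apply/sigma_rvP; exists setT.
- exact: (@measurableT _ (g_sigma_algebraType _)).
- exact: (@measurableT _ (g_sigma_algebraType _)).
Qed.

Local Notation env i N := (environment P (source Q A S) i N).

Let in_source_A u : 0 <= u -> sigma_rv (A u) `<=` source Q A S 1.
Proof. by move=> u0 E hE; apply: sub_sigma_algebra; exists u. Qed.

Let in_source_S k u : (1 <= k)%N -> 0 <= u -> sigma_rv (S k u) `<=` source Q A S k.+1.
Proof. by case: k => // k _ u0 E hE; apply: sub_sigma_algebra; exists u. Qed.

(** Of the process of server k the history holds the past only, and every other source is contained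
    whole in the environment. The index is shifted because source [k.+1] is [S k]. *)
Lemma history_sub_service k u : (1 <= k)%N ->
  history_events P Q A S u `<=` env k.+1 (S k) u.
Proof.
move=> k1 E [[[hE|[v]]|[l /= l1 [v]]]|hE]; last by right.
- by left; left; exists 0%N.
- rewrite /= in_itv/= => /andP[v0 _] hE; left; left; exists 1%N => /=.
    by rewrite eqSS eq_sym -lt0n.
  exact: in_source_A hE.
- rewrite /= in_itv/= => /andP[v0 vu] hE.
  have [lk|lk] := eqVneq l k; last first.
    left; left; exists l.+1 => /=; first by rewrite eqSS.
    exact: in_source_S hE.
  by left; right; exists v; [rewrite /= in_itv/= v0|rewrite -lk].
Qed.

Lemma history_sub_arrival u : history_events P Q A S u `<=` env 1 A u.
Proof.
move=> E [[[hE|[v]]|[l /= l1 [v]]]|hE]; last by right.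
- by left; left; exists 0%N.
- by move=> vu hE; left; right; exists v.
- rewrite /= in_itv/= => /andP[v0 vu] hE; left; left; exists l.+1 => /=.
    by rewrite eqSS -lt0n.
  exact: in_source_S hE.
Qed.

Definition service_noise k u v w := S k v w - S k u w - mu * (v - u).

Definition arrival_noise u v w := A v w - A u w - lam * (v - u).

Lemma service_noise_summable2 k u v : (1 <= k)%N -> 0 <= u -> u <= v ->
  summable2 P (service_noise k u v).
Proof.
move=> k1 u0 uv; apply: summable2B (summable2_cst _ _).
exact: (increment_summable2 mu0 (pS k1)).
Qed.

Lemma arrival_noise_summable2 u v : 0 <= u -> u <= v -> summable2 P (arrival_noise u v).
Proof.
move=> u0 uv; apply: summable2B (summable2_cst _ _).
exact: (increment_summable2 lam0 pA).
Qed.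

(** Mean and variance of a Poisson variable agree, so the second moment is linear in the cell
    length; this is why sums over cells become time integrals. *)
Let noise_moments rate N u v B : 0 < rate -> poisson_process P rate N ->
  0 <= u -> u <= v -> measurable B ->
  (forall E, sigma_rv (fun w => N v w - N u w) E -> P (E `&` B) = (P E * P B)%E) ->
  mean_on P B (fun w => N v w - N u w - rate * (v - u)) = 0 /\
  mean_on P B (fun w => (N v w - N u w - rate * (v - u)) ^+ 2) =
    rate * (v - u) * fine (P B).
Proof.
move=> rate0 pN u0 uv mB iB.
have i2 := increment_summable2 rate0 pN u0 uv.
have i1 := summable2_summable1 i2.
have iB' (k : nat) : P ([set w | N v w - N u w = k%:R]%R `&` B) =
    (P [set w | N v w - N u w = k%:R]%R * P B)%E.
  exact/iB/sigma_rv_eq.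
have E1 := mean_increment rate0 pN u0 uv mB iB'.
have E2 := mean_increment_sqr rate0 pN u0 uv mB iB'.
split.
  by rewrite mean_onB ?E1 ?mean_on_cst ?subrr//; exact: summable1_cst.
set r := rate * (v - u).
rewrite [X in mean_on _ _ X](_ : _ = fun w => (N v w - N u w) ^+ 2 +
    ((- (2 * r)) * (N v w - N u w) + r ^+ 2)); last first.
  by apply/funext => w; ring.
have H c1 c2 : mean_on P B (fun w => (N v w - N u w) ^+ 2 + (c1 * (N v w - N u w) + c2)) =
    (r + r ^+ 2) * fine (P B) + (c1 * (r * fine (P B)) + c2 * fine (P B)).
  rewrite mean_onD//; last 2 first.
  - exact: i2.2.
  - by apply: summable1D; [exact: summable1Z|exact: summable1_cst].
  rewrite mean_onD//; [|exact: summable1Z|exact: summable1_cst].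
  by rewrite mean_onZ// E1 E2 mean_on_cst.
by rewrite H; ring.
Qed.

Lemma service_noise_moments k u v B : (1 <= k)%N -> 0 <= u -> u <= v ->
  <<s env k.+1 (S k) u >> B ->
  mean_on P B (service_noise k u v) = 0 /\
  mean_on P B (fun w => service_noise k u v w ^+ 2) = mu * (v - u) * fine (P B).
Proof.
move=> k1 u0 uv uB; apply: noise_moments => //; first exact: pS.
  have := uB; apply: smallest_sub; first exact: sigma_algebra_measurable.
  exact: (environment_measurable source_measurable (pS k1)).
move=> E hE.
apply: (increment_independent iG source_measurable sourceI sourceT _ (pS k1) u0 uv hE uB).
by case: k k1 {uB hE}.
Qed.

Lemma arrival_noise_moments u v B : 0 <= u -> u <= v ->
  <<s env 1 A u >> B ->
  mean_on P B (arrival_noise u v) = 0 /\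
  mean_on P B (fun w => arrival_noise u v w ^+ 2) = lam * (v - u) * fine (P B).
Proof.
move=> u0 uv uB; apply: noise_moments => //.
  have := uB; apply: smallest_sub; first exact: sigma_algebra_measurable.
  exact: (environment_measurable source_measurable pA).
move=> E hE.
have GN : source Q A S 1 = sigma_process A by [].
exact: (increment_independent iG source_measurable sourceI sourceT GN pA u0 uv hE uB).
Qed.

Lemma service_noise_adapted k u v : (1 <= k)%N -> 0 <= u -> u <= v ->
  adapted_at P Q A S v (service_noise k u v).
Proof.
move=> k1 u0 uv; apply: measurable_funB => //; apply: measurable_funB.
- by apply: adapted_at_service => //; exact: le_trans uv.
- exact: adapted_at_service.
Qed.

Lemma service_noise_env k l u v : (1 <= k)%N -> (1 <= l)%N -> l != k ->
  0 <= u -> u <= v ->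
  measurable_fun (setT : set (g_sigma_algebraType (env k.+1 (S k) u)))
    (service_noise l u v).
Proof.
move=> k1 l1 lk u0 uv.
have H x : 0 <= x ->
    measurable_fun (setT : set (g_sigma_algebraType (env k.+1 (S k) u))) (S l x).
  move=> x0; apply/measurable_wrtP => E hE; apply: sub_sigma_algebra.
  by left; left; exists l.+1; [rewrite /= eqSS|exact: in_source_S hE].
apply: measurable_funB => //; apply: measurable_funB; apply: H => //.
exact: le_trans uv.
Qed.

Section one_step.
Variables (h : nat -> T -> R) (K : nat) (u v : R).
Hypotheses (u0 : 0 <= u) (uv : u <= v)
  (ah : forall k, adapted_at P Q A S u (h k))
  (hh : forall k w, h k w ^+ 2 = h k w).

(** With [h k] the indicator that server k is busy at u, this is the compensated number of
    departures from the first K servers in the cell; with [h k] equal to 1 it is the compensated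
    growth of [potential]. *)
Definition thinned_noise w := \sum_(1 <= k < K.+1) h k w * service_noise k u v w.

Let h01 k w : h k w = 0 \/ h k w = 1.
Proof.
have := hh k w; rewrite expr2 => /eqP; rewrite -subr_eq0 -[X in _ - X]mulr1 -mulrBr.
by rewrite mulf_eq0 subr_eq0 => /orP[/eqP ->|/eqP ->]; [left|right].
Qed.

Let h1 k w : `|h k w| <= 1.
Proof. by case: (h01 k w) => ->; rewrite ?normr0 ?normr1. Qed.

Let mh k : measurable_fun setT (h k).
Proof. exact: (adapted_at_measurable pA pS mQ0 (ah k)). Qed.

Let term_summable2 k : (1 <= k)%N ->
  summable2 P (fun w => h k w * service_noise k u v w).
Proof. by move=> k1; apply: summable2_bounded_mul => //; exact: service_noise_summable2. Qed.

Lemma thinned_noise_summable2 : summable2 P thinned_noise.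
Proof.
apply: summable2_sum => k; rewrite mem_index_iota => /andP[k1 _].
exact: term_summable2.
Qed.

Variable B : set T.
Hypothesis uB : <<s history_events P Q A S u >> B.

Let mB : measurable B.
Proof. exact: (history_measurable pA pS mQ0 uB). Qed.

Let level_set k : set T := B `&` h k @^-1` [set 1].

Let level_setE k w : \1_(level_set k) w = \1_B w * h k w :> R.
Proof.
rewrite !indicE; have [Bw|Bw] := pselect (B w); last first.
  by rewrite !memNset ?mul0r// => -[].
rewrite (mem_set Bw) mul1r; case: (h01 k w) => hkw; rewrite hkw.
  by rewrite memNset// => -[_ /=]; rewrite hkw => /esym/eqP; rewrite oner_eq0.
by rewrite mem_set.
Qed.

Let level_set_history k : <<s history_events P Q A S u >> (level_set k).
Proof.
apply: (@measurableI _ (g_sigma_algebraType (history_events P Q A S u))) => //.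
by rewrite -[h k @^-1` _]setTI; apply: ah.
Qed.

Let mlevel k : measurable (level_set k).
Proof. exact: (history_measurable pA pS mQ0 (level_set_history k)). Qed.

(** Multiplying by an indicator of the history is shrinking the event of integration, and the
    moments of the noise are known on all such events. *)
Let mean_on_level k X : mean_on P B (fun w => h k w * X w) = mean_on P (level_set k) X.
Proof.
rewrite mean_on_indic// [RHS]mean_on_indic//; congr (mean_on _ _ _).
by apply/funext => w; rewrite level_setE mulrA.
Qed.

Let level_set_env k : (1 <= k)%N -> <<s env k.+1 (S k) u >> (level_set k).
Proof.
by move=> k1; apply: (generated_mono (history_sub_service k1)); exact: level_set_history.
Qed.

Let mean_term k : (1 <= k)%N -> mean_on P B (fun w => h k w * service_noise k u v w) = 0.
Proof.
move=> k1; rewrite mean_on_level.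
by have [] := service_noise_moments k1 u0 uv (level_set_env k1).
Qed.

Let mean_term_sqr k : (1 <= k)%N ->
  mean_on P B (fun w => (h k w * service_noise k u v w) ^+ 2) =
  mu * (v - u) * mean_on P B (h k).
Proof.
move=> k1; under [X in mean_on _ _ X]eq_fun do rewrite exprMn hh.
rewrite mean_on_level; have [_ ->] := service_noise_moments k1 u0 uv (level_set_env k1).
congr (_ * _).
have <- : mean_on P B (fun w => h k w * 1) = mean_on P B (h k).
  by congr mean_on; apply/funext => w; rewrite mulr1.
by rewrite mean_on_level mean_on_cst// mul1r.
Qed.

(** Relative to the environment of server k everything but its own noise is known, including the
    noise of server l over the same cell; what remains has mean 0. *)
Let mean_cross k l : (1 <= k)%N -> (1 <= l)%N -> l != k ->
  mean_on P B (fun w => (h l w * service_noise l u v w) *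
                        (h k w * service_noise k u v w)) = 0.
Proof.
move=> k1 l1 lk.
have sub := generated_mono (history_sub_service k1 (u := u)).
have wrt X : adapted_at P Q A S u X ->
    measurable_fun (setT : set (g_sigma_algebraType (env k.+1 (S k) u))) X.
  by move=> /measurable_wrtP aX; apply/measurable_wrtP => E /aX; exact: sub.
rewrite mean_on_indic//.
have -> : (fun w => \1_B w * (h l w * service_noise l u v w * (h k w * service_noise k u v w)))
    = (fun w => \1_B w * (h l w * service_noise l u v w) * h k w * service_noise k u v w).
  by apply/funext => w; rewrite !mulrA.
apply: (mean_mul_eq0 (H := env k.+1 (S k) u)).
- apply: smallest_sub; first exact: sigma_algebra_measurable.
  exact: (environment_measurable source_measurable (pS k1)).
- exact/summable2_summable1/service_noise_summable2.
- by move=> C CB; have [] := service_noise_moments k1 u0 uv CB.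
- apply: measurable_funM; last exact: (wrt _ (ah k)).
  apply: measurable_funM; first by apply: measurable_indic; exact: sub.
  by apply: measurable_funM; [exact: (wrt _ (ah l))|exact: service_noise_env].
- have i1 : summable2 P (fun w => \1_B w * (h l w * service_noise l u v w)).
    apply: summable2_bounded_mul; last exact: term_summable2.
      exact: measurable_indic.
    by move=> w; rewrite indicE; case: (_ \in _); rewrite /= ?normr1 ?normr0.
  have := summable2M i1 (term_summable2 k1).
  by under eq_fun do rewrite mulrA.
Qed.

Lemma thinned_noise_mean : mean_on P B thinned_noise = 0.
Proof.
rewrite /thinned_noise mean_on_sum//; last first.
  move=> k; rewrite mem_index_iota => /andP[k1 _].
  exact/summable2_summable1/term_summable2.
by rewrite big_nat big1// => k /andP[k1 _]; exact: mean_term.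
Qed.

Lemma thinned_noise_sqr_mean : mean_on P B (fun w => thinned_noise w ^+ 2) =
  mu * (v - u) * mean_on P B (fun w => \sum_(1 <= k < K.+1) h k w).
Proof.
have ih k : summable1 P (h k).
  by apply: (summable1_le _ _ (summable1_cst P 1)).
rewrite mean_on_sum// mulr_sumr.
have -> : (fun w => thinned_noise w ^+ 2) = (fun w => \sum_(1 <= k < K.+1) \sum_(1 <= l < K.+1)
    (h l w * service_noise l u v w) * (h k w * service_noise k u v w)).
  apply/funext => w; rewrite /thinned_noise expr2 mulr_sumr.
  by apply: eq_bigr => k _; rewrite mulr_suml.
have it k l : (1 <= k)%N -> (1 <= l)%N -> summable1 P (fun w =>
    (h l w * service_noise l u v w) * (h k w * service_noise k u v w)).
  by move=> k1 l1; apply: summable2M; exact: term_summable2.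
rewrite mean_on_sum//; last first.
  move=> k; rewrite mem_index_iota => /andP[k1 _]; apply: summable1_sum => l.
  by rewrite mem_index_iota => /andP[l1 _]; exact: it.
rewrite big_nat [RHS]big_nat; apply: eq_bigr => k /andP[k1 kK].
rewrite mean_on_sum//; last first.
  by move=> l; rewrite mem_index_iota => /andP[l1 _]; exact: it.
rewrite (bigD1_seq k) ?iota_uniq ?mem_index_iota ?k1//=.
rewrite big_nat_cond big1 ?addr0; last first.
  by move=> l /andP[/andP[l1 _] lk]; exact: mean_cross.
by rewrite -mean_term_sqr.
Qed.

End one_step.
End compensated_services.

(** * Counting processes without multiple jumps *)

Section almost_sure_unit_jumps.
Context d (T : measurableType d) (R : realType) (P : probability T R).
Variables (Z : R -> T -> R) (C : R).
Hypotheses (cZ : forall w, counting_path (Z ^~ w))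
  (Z2 : forall u v, 0 <= u -> u <= v -> summable2 P (fun w => Z v w - Z u w))
  (mZ : forall u v, 0 <= u -> u <= v ->
    mean_on P setT (fun w => (Z v w - Z u w) ^+ 2 - (Z v w - Z u w)) <= C * (v - u) ^+ 2).

Let double u v : set T := [set w | 2 <= Z v w - Z u w].

Let measurable_double u v : 0 <= u -> u <= v -> measurable (double u v).
Proof.
move=> u0 uv; have := (Z2 u0 uv).1 measurableT _ (measurable_itv `[2, +oo[).
by rewrite setTI; congr measurable; apply/seteqP; split => w /=;
  rewrite in_itv/= andbT.
Qed.

(** Markov's inequality for x^2 - x, which is nonnegative on integers and at least 2 once x is at
    least 2. *)
Let prob_double u v : 0 <= u -> u <= v -> (P (double u v) <= (C * (v - u) ^+ 2)%:E)%E.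
Proof.
move=> u0 uv; have mD := measurable_double u0 uv.
have iZ := Z2 u0 uv.
rewrite -[P _]fineK ?fin_num_measure// lee_fin (le_trans _ (mZ u0 uv))//.
rewrite -[leLHS]mul1r -mean_on_cst// mean_on_indic//.
apply: mean_on_le => //.
- under eq_fun do rewrite mulr1.
  apply: (summable1_le _ _ (summable1_cst P 1)); first exact: measurable_indic.
  by move=> w; rewrite indicE; case: (_ \in _); rewrite /= ?normr1 ?normr0.
- by apply: summable1B; [exact: iZ.2|exact: summable2_summable1].
move=> w; rewrite mulr1 indicE.
have [_ ZN Zh _] := cZ w.
have ZZ : Z v w - Z u w \is a Num.nat.
  rewrite natrEint subr_ge0 Zh// andbT rpredB// intr_nat// ZN//.
  exact: le_trans uv.
have ZZ2 : 0 <= (Z v w - Z u w) ^+ 2 - (Z v w - Z u w).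
  have /natrP[[|m] ->] := ZZ; first by rewrite expr0n subrr.
  have : 1 <= m.+1%:R :> R by rewrite ler1n.
  by move: (m.+1%:R) => x; nra.
have [|nD] := boolP (w \in double u v); last exact: ZZ2.
by move=> /set_mem; rewrite /double /=; move: (Z v w - Z u w) => x; nra.
Qed.

Let unit_jump w t := exists u, [/\ 0 <= u, u < t & Z t w - Z u w <= 1].

(* On every grid of [0, n] some cell has two jumps; a cell of length h has two
   jumps with probability at most C h^2. *)
Let bad (n : nat) : set T := \bigcap_m \bigcup_(i in `I_m.+1)
  double (grid 0 n%:R m i) (grid 0 n%:R m i.+1).

Let grid_ok (n m i : nat) : 0 <= grid (0 : R) n%:R m i <= grid 0 n%:R m i.+1.
Proof. by rewrite grid_ge// le_grid. Qed.

Let measurable_bad n : measurable (bad n).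
Proof.
apply: bigcap_measurable => // m _; apply: bigcup_measurable => i _.
by have /andP[] := grid_ok n m i; exact: measurable_double.
Qed.

Let prob_bad n : P (bad n) = 0%E.
Proof.
have le m : (P (bad n) <= (C * n%:R * mesh 0 n%:R m)%:E)%E.
  have mD (i : nat) : measurable (double (grid 0 n%:R m i) (grid 0 n%:R m i.+1)).
    by have /andP[] := grid_ok n m i; exact: measurable_double.
  apply: (@le_trans _ _ (P (\big[setU/set0]_(i < m.+1)
      double (grid 0 n%:R m i) (grid 0 n%:R m i.+1)))).
    apply: le_measure; rewrite ?inE; [exact: measurable_bad|exact: bigsetU_measurable|].
    rewrite -(bigcup_mkord _ (fun i => double (grid 0 n%:R m i) (grid 0 n%:R m i.+1))).
    exact: bigcap_inf.
  apply: (le_trans (Boole_inequality P (n := m.+1) (fun i _ => mD i))).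
  apply: (@le_trans _ _ (\sum_(i < m.+1) (C * mesh 0 n%:R m ^+ 2)%:E)%E).
    apply: lee_sum => i _; have /andP[h1 h2] := grid_ok n m i.
    by rewrite (le_trans (prob_double h1 h2))// gridS addrAC subrr add0r.
  rewrite sumEFin lee_fin sumr_const card_ord -[leLHS]mulr_natr.
  have hm : n%:R = mesh 0 n%:R m * m.+1%:R :> R.
    by rewrite -[LHS](grid_last (0 : R) n%:R m) /grid add0r mulrC.
  rewrite [X in C * X * _]hm; move: (mesh _ _ _) (m.+1%:R : R) => x y.
  by rewrite le_eqVlt; apply/orP; left; apply/eqP; ring.
apply/eqP; rewrite eq_le measure_ge0 andbT.
have : (C * n%:R * mesh 0 n%:R m)%:E @[m --> \oo] --> (0 : R)%:E.
  apply: cvg_EFin; first exact: nearW.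
  rewrite -(mulr0 (C * n%:R)); apply: cvgM; [exact: cvg_cst|exact: mesh_cvg0].
move=> cv.
have -> : 0%E = limn (fun m => (C * n%:R * mesh 0 n%:R m)%:E).
  by apply/esym/cvg_lim.
by apply: lime_ge; [exact: cvgP cv|exact: nearW].
Qed.

(** The exceptional set is covered by the measurable sets [bad n]: if every u before t leaves a
    growth of at least 2 until t, then so does the left end of the cell of t, on every grid. *)
Lemma ae_unit_jumps : {ae P, forall w t, 0 < t -> unit_jump w t}.
Proof.
exists (\bigcup_n bad n); split.
- exact: bigcup_measurable.
- apply/eqP; rewrite eq_le measure_ge0 andbT.
  have mU : measurable (\bigcup_n bad n) by exact: bigcup_measurable.
  apply: (le_trans (measure_sigma_subadditive P measurable_bad mU (@subset_refl _ _))).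
  by rewrite eseries0// => n _ _; exact: prob_bad.
move=> w /= /existsNP[t /not_implyP[t0 nut]].
have [n tn] := nat_ub t; exists n => // m _.
have st : (0 : R) <= n%:R by [].
(* Cells are open on the left, so that the left end of the cell of t lies strictly before t, as a
   witness for [unit_jump] must. *)
have It : [set` Interval (BRight 0) (BRight n%:R)] t by rewrite /= in_itv/= t0.
have [i [im + _]] := stepE (fun _ _ => 0) m st It.
rewrite /cell /= in_itv/= => /andP[lo hi]; exists i => //=.
have /andP[g0 _] := grid_ok n m i.
have [_ ZN Zh _] := cZ w.
have : 2 <= Z t w - Z (grid 0 n%:R m i) w.
  rewrite leNgt; apply/negP => lt2; apply: nut.
  exists (grid 0 n%:R m i); split => //.
  have /natrP[k kE] : Z t w - Z (grid 0 n%:R m i) w \is a Num.nat.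
    by rewrite natrEint subr_ge0 Zh ?(ltW lo)// andbT rpredB// intr_nat// ZN// ltW.
  by move: lt2; rewrite kE ltr_nat ltnS -(ler_nat R).
move=> /le_trans; apply; rewrite lerD2r Zh//.
exact: ltW.
Qed.

End almost_sure_unit_jumps.

(** * Sums of noises over a grid *)

Section noise_sums.
Context d (T : measurableType d) (R : realType) (P : probability T R).
Variables (mu lam : R) (Q A : R -> T -> R) (S : nat -> R -> T -> R).
Hypotheses (mu0 : 0 < mu) (lam0 : 0 < lam)
  (pA : poisson_process P lam A)
  (pS : forall k, (1 <= k)%N -> poisson_process P mu (S k))
  (mQ0 : measurable_fun setT (Q 0))
  (Q0nat : forall w, Q 0 w \is a Num.nat)
  (iG : mutually_independent P (source Q A S))
  (cQ : forall w, cadlag (Q ^~ w))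
  (Qeq : forall w t, 0 <= t ->
    ((Q t w)%:E = (Q 0 w + A t w)%:E - departures Q S t w)%E).

Local Notation F t := (<<s history_events P Q A S t >>).

Let arrival_counting w : counting_path (A ^~ w).
Proof. by have [_ + _ _] := pA; exact. Qed.

Let service_counting w k : (1 <= k)%N -> counting_path (S k ^~ w).
Proof. by move=> /pS[_ + _ _]; exact. Qed.

Let FT t : F t setT.
Proof. exact: (@measurableT _ (g_sigma_algebraType (history_events P Q A S t))). Qed.

Let F_mono s t : s <= t -> F s `<=` F t.
Proof. by move=> st; apply: generated_mono; exact: history_events_mono. Qed.

Let F_measurable t : F t `<=` measurable.
Proof. exact: (history_measurable pA pS mQ0). Qed.

Lemma ae_arrival_unit_jumps : {ae P, forall w t, 0 < t ->
  exists u, [/\ 0 <= u, u < t & A t w - A u w <= 1]}.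
Proof.
apply: (@ae_unit_jumps _ _ _ P A (lam ^+ 2)) => //.
  by move=> u v u0 uv; exact: (increment_summable2 lam0 pA).
move=> u v u0 uv; have iA := increment_summable2 lam0 pA u0 uv.
rewrite mean_onB//; [|exact: iA.2|exact: summable2_summable1].
have iT (k : nat) : P ([set w | A v w - A u w = k%:R]%R `&` setT) =
    (P [set w | A v w - A u w = k%:R]%R * P setT)%E.
  by rewrite setIT probability_setT mule1.
rewrite (mean_increment lam0 pA u0 uv measurableT iT).
rewrite (mean_increment_sqr lam0 pA u0 uv measurableT iT).
by rewrite probability_setT /= !mulr1 addrAC subrr add0r exprMn.
Qed.

Lemma ae_service_unit_jumps : {ae P, forall w, unit_jumps S w}.
Proof.
apply: ae_foralln => K.
(* With all servers taken as busy, the thinned noise is the compensated [potential]. Its first two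
   moments are thereby known without identifying the law of a sum of K services. *)
pose one (k : nat) (w : T) : R := 1.
have a1 u k : adapted_at P Q A S u (one k) by exact: measurable_cst.
have o2 k w : one k w ^+ 2 = one k w by rewrite expr1n.
have iX u v (u0 : 0 <= u) (uv : u <= v) :=
  thinned_noise_summable2 mu0 pA pS mQ0 K u0 uv (a1 u) o2.
have E u v w : potential S w K v - potential S w K u =
    thinned_noise mu S one K u v w + K%:R * (mu * (v - u)).
  rewrite /thinned_noise /potential -sumrB.
  under [in RHS]eq_bigr do rewrite mul1r /service_noise.
  by rewrite [in RHS]sumrB sumr_const_nat subn1 mulr_natl subrK.
(* The constant is that of a Poisson variable of mean K mu h, whose second factorial moment is (K mu
   h)^2. *)
apply: (@ae_unit_jumps _ _ _ P (fun t w => potential S w K t) ((K%:R * mu) ^+ 2)).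
- move=> w; apply: counting_potential; exact: service_counting.
- move=> u v u0 uv; under eq_fun do rewrite E.
  by apply: summable2D; [exact: iX|exact: summable2_cst].
move=> u v u0 uv; have {}iX := iX u v u0 uv.
under [X in mean_on _ _ X]eq_fun do rewrite E.
set c := K%:R * (mu * (v - u)).
have -> : (fun w => (thinned_noise mu S one K u v w + c) ^+ 2 -
      (thinned_noise mu S one K u v w + c)) =
    (fun w => thinned_noise mu S one K u v w ^+ 2 +
      ((c + c - 1) * thinned_noise mu S one K u v w + (c ^+ 2 - c))).
  by apply/funext => w; ring.
have i1 := summable2_summable1 iX.
rewrite mean_onD//; last 2 first.
- exact: iX.2.
- by apply: summable1D; [exact: summable1Z|exact: summable1_cst].
rewrite mean_onD//; [|exact: summable1Z|exact: summable1_cst].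
rewrite mean_onZ// mean_on_cst// probability_setT /= mulr1.
rewrite (thinned_noise_mean mu0 pA pS mQ0 iG K u0 uv (a1 u) o2 (@FT u)).
rewrite (thinned_noise_sqr_mean mu0 pA pS mQ0 iG K u0 uv (a1 u) o2 (@FT u)).
have -> : (fun w : T => \sum_(1 <= k < K.+1) one k w) = fun=> K%:R.
  by apply/funext => w; rewrite sumr_const_nat subn1.
rewrite mean_on_cst// probability_setT /= mulr1 mulr0 add0r /c.
by rewrite le_eqVlt; apply/orP; left; apply/eqP; ring.
Qed.

Opaque departed potential server_departed.

Lemma ae_queue_ge0 : {ae P, forall w t, 0 <= t -> 0 <= Q t w}.
Proof.
apply: filterS ae_service_unit_jumps => w uj t t0.
exact: (queue_ge0 (arrival_counting w) (@service_counting w) (cQ w) (Q0nat w) (Qeq w)).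
Qed.

Definition level_at u k w : R := level k (Q u w).

Lemma adapted_level_at u k : 0 <= u -> adapted_at P Q A S u (level_at u k).
Proof.
move=> u0; apply: measurableT_comp; first exact: measurable_level.
exact: (adapted_at_queue pA pS cQ Qeq).
Qed.

Lemma level_at_sqr u k w : level_at u k w ^+ 2 = level_at u k w.
Proof. exact: level_sqr. Qed.

Section grid_sums.
Variables (K : nat) (s t : R) (m : nat).
Hypotheses (s0 : 0 <= s) (st : s <= t).

Local Notation g := (grid s t m).

Let g0 i : 0 <= g i.
Proof. by rewrite (le_trans s0)// grid_ge. Qed.

Let gS i : g i <= g i.+1.
Proof. exact: le_grid. Qed.

Definition noise_step i : T -> R :=
  thinned_noise mu S (level_at (g i)) K (g i) (g i.+1).

Definition noise_sum j w := \sum_(i < j) noise_step i w.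

Let noise_sumS j w : noise_sum j.+1 w = noise_sum j w + noise_step j w.
Proof. by rewrite /noise_sum big_ord_recr. Qed.

Let step2 i : summable2 P (noise_step i).
Proof.
apply: (thinned_noise_summable2 mu0 pA pS mQ0) => //.
  by move=> k; exact: adapted_level_at.
by move=> k w; exact: level_at_sqr.
Qed.

Lemma noise_sum_summable2 j : summable2 P (noise_sum j).
Proof.
elim: j => [|j IH].
  rewrite [X in summable2 _ X](_ : _ = fun=> 0); first exact: summable2_cst.
  by apply/funext => w; rewrite /noise_sum big_ord0.
rewrite [X in summable2 _ X](_ : _ = fun w => noise_sum j w + noise_step j w).
  exact: summable2D.
by apply/funext => w; exact: noise_sumS.
Qed.

Let step_adapted i : adapted_at P Q A S (g i.+1) (noise_step i).
Proof.
rewrite /noise_step [X in adapted_at _ _ _ _ _ X](_ : _ = fun w => \sum_(k < K)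
    (level_at (g i) k.+1 w * service_noise mu S k.+1 (g i) (g i.+1) w)); last first.
  by apply/funext => w; rewrite /thinned_noise big_add1 big_mkord.
apply: measurable_sum => k; apply: measurable_funM.
  by apply: (adapted_at_mono (gS i)); exact: adapted_level_at.
exact: service_noise_adapted.
Qed.

Let sum_adapted j : adapted_at P Q A S (g j) (noise_sum j).
Proof.
elim: j => [|j IH].
  rewrite [X in adapted_at _ _ _ _ _ X](_ : _ = fun=> 0); first exact: measurable_cst.
  by apply/funext => w; rewrite /noise_sum big_ord0.
rewrite [X in adapted_at _ _ _ _ _ X](_ : _ = fun w => noise_sum j w + noise_step j w).
  by apply: measurable_funD; [exact: (adapted_at_mono (gS j) IH)|exact: step_adapted].
by apply/funext => w; exact: noise_sumS.
Qed.

Variable B : set T.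
Hypothesis sB : F s B.

Let mB : measurable B. Proof. exact: F_measurable sB. Qed.

Let gB i : F (g i) B.
Proof. by apply: F_mono sB; exact: grid_ge. Qed.

Let step_mean j C : F (g j) C -> mean_on P C (noise_step j) = 0.
Proof.
have al k : adapted_at P Q A S (g j) (level_at (g j) k) by exact: adapted_level_at.
exact: (thinned_noise_mean mu0 pA pS mQ0 iG K (g0 j) (gS j) al (level_at_sqr (g j))).
Qed.

Lemma noise_sum_mean j : mean_on P B (noise_sum j) = 0.
Proof.
rewrite /noise_sum; elim: j => [|j IH].
  by under [X in mean_on _ _ X]eq_fun do rewrite big_ord0; rewrite mean_on_cst// mul0r.
under [X in mean_on _ _ X]eq_fun do rewrite big_ord_recr/=.
rewrite mean_onD//; last 2 first.
- exact/summable2_summable1/noise_sum_summable2.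
- exact: summable2_summable1.
by rewrite IH add0r; exact: step_mean (@gB j).
Qed.

(* On integers this is min(x^+, K), see cappedE. *)
Definition capped (x : R) : R := \sum_(1 <= k < K.+1) level k x.

Lemma capped_bounds x : 0 <= capped x <= K%:R.
Proof.
rewrite /capped sumr_ge0/=; last by move=> k _; have /andP[] := level_bounds k x.
apply: (@le_trans _ _ (\sum_(1 <= k < K.+1) 1)).
  by apply: ler_sum => k _; have /andP[] := level_bounds k x.
by rewrite sumr_const_nat subn1.
Qed.

Lemma measurable_capped : measurable_fun setT capped.
Proof.
rewrite [X in measurable_fun _ X](_ : _ = fun x => \sum_(k < K) level k.+1 x).
  by apply: measurable_sum => k; exact: measurable_level.
by apply/funext => x; rewrite /capped big_add1 big_mkord.
Qed.

Lemma capped_queue_summable1 u : 0 <= u -> summable1 P (fun w => capped (Q u w)).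
Proof.
move=> u0; apply: (summable1_le _ _ (summable1_cst P K%:R)).
  apply: measurableT_comp; first exact: measurable_capped.
  apply: (adapted_at_measurable pA pS mQ0).
  exact: (adapted_at_queue pA pS cQ Qeq u0 (lexx u)).
by move=> w; have /andP[h1 h2] := capped_bounds (Q u w); rewrite ger0_norm.
Qed.

Lemma noise_sum_sqr_mean j : mean_on P B (fun w => noise_sum j w ^+ 2) =
  mu * mean_on P B (fun w => \sum_(i < j) capped (Q (g i) w) * mesh s t m).
Proof.
elim: j => [|j IH].
  under [X in mean_on _ _ X]eq_fun do rewrite /noise_sum big_ord0 expr0n.
  under [X in _ * mean_on _ _ X]eq_fun do rewrite big_ord0.
  by rewrite mean_on_cst// mul0r mulr0.
have -> : (fun w => noise_sum j.+1 w ^+ 2) = (fun w => noise_sum j w ^+ 2 +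
    (2 * (noise_sum j w * noise_step j w) + noise_step j w ^+ 2)).
  by apply/funext => w; rewrite noise_sumS; ring.
have i2 := noise_sum_summable2 j.
rewrite mean_onD//; last 2 first.
- exact: i2.2.
- by apply: summable1D; [apply: summable1Z; exact: summable2M|exact: (step2 j).2].
rewrite mean_onD//; last 2 first.
- by apply: summable1Z; exact: summable2M.
- exact: (step2 j).2.
rewrite mean_onZ//; last exact: summable2M.
(* The earlier sum is known at the left end of cell j, and the noise of that cell has mean 0 on
   every event known there. *)
have -> : mean_on P B (fun w => noise_sum j w * noise_step j w) = 0.
  rewrite mean_on_indic//; under [X in mean_on _ _ X]eq_fun do rewrite mulrA.
  apply: (mean_mul_eq0 (H := history_events P Q A S (g j))).
  - exact: F_measurable.
  - exact: summable2_summable1.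
  - exact: step_mean.
  - apply: measurable_funM; last exact: sum_adapted.
    by apply: (@measurable_indic _ (g_sigma_algebraType _)); exact: gB.
  - have i1 : summable2 P (fun w => \1_B w * noise_sum j w).
      apply: summable2_bounded_mul i2; first exact: measurable_indic.
      by move=> w; rewrite indicE; case: (_ \in _); rewrite /= ?normr1 ?normr0.
    exact: summable2M i1 (step2 j).
rewrite mulr0 add0r IH.
have -> : mean_on P B (fun w => noise_step j w ^+ 2) =
    mu * mesh s t m * mean_on P B (fun w => capped (Q (g j) w)).
  have al k : adapted_at P Q A S (g j) (level_at (g j) k) by exact: adapted_level_at.
  rewrite [LHS](thinned_noise_sqr_mean mu0 pA pS mQ0 iG K (g0 j) (gS j) al
    (level_at_sqr (g j)) (@gB j)).
  by rewrite gridS addrAC subrr add0r.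
under [in RHS]eq_fun do rewrite big_ord_recr/=.
have ic i : summable1 P (fun w => capped (Q (g i) w) * mesh s t m).
  under eq_fun do rewrite mulrC.
  exact/summable1Z/capped_queue_summable1.
rewrite mean_onD//; last first.
  under eq_fun do rewrite -(big_mkord xpredT (fun i => capped (Q (g i) _) * mesh s t m)).
  exact: summable1_sum.
rewrite mulrDr; congr (_ + _); rewrite -mulrA; congr (_ * _).
under [in RHS]eq_fun do rewrite mulrC.
by rewrite mean_onZ//; exact: capped_queue_summable1.
Qed.

End grid_sums.

End noise_sums.

(** * Moments of the compensated departures *)

Section departure_noise.
Context d (T : measurableType d) (R : realType) (P : probability T R).
Variables (mu lam : R) (Q A : R -> T -> R) (S : nat -> R -> T -> R).
Hypotheses (mu0 : 0 < mu) (lam0 : 0 < lam)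
  (pA : poisson_process P lam A)
  (pS : forall k, (1 <= k)%N -> poisson_process P mu (S k))
  (mQ0 : measurable_fun setT (Q 0))
  (Q0nat : forall w, Q 0 w \is a Num.nat)
  (iG : mutually_independent P (source Q A S))
  (cQ : forall w, cadlag (Q ^~ w))
  (Qeq : forall w t, 0 <= t ->
    ((Q t w)%:E = (Q 0 w + A t w)%:E - departures Q S t w)%E)
  (Q0mean : ('E_P[Q 0%R] < +oo)%E).

Local Notation F t := (<<s history_events P Q A S t >>).

Opaque departed potential server_departed.

Let arrival_counting w : counting_path (A ^~ w).
Proof. by have [_ + _ _] := pA; exact. Qed.

Let service_counting w k : (1 <= k)%N -> counting_path (S k ^~ w).
Proof. by move=> /pS[_ + _ _]; exact. Qed.

(** Agrees with [capped] on integers but is continuous, so that it maps the cadlag path of Q to a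
    cadlag path, whose Riemann sums converge. *)
Definition clamp (K : nat) (x : R) : R := Num.min (Num.max x 0) K%:R.

Lemma clamp_bounds K x : 0 <= clamp K x <= K%:R.
Proof. by rewrite /clamp le_min le_max lexx orbT ler0n ge_min lexx orbT. Qed.

Lemma clamp_le_max K x : clamp K x <= Num.max x 0.
Proof. by rewrite /clamp ge_min lexx. Qed.

Lemma continuous_clamp K : continuous (clamp K).
Proof.
move=> x; rewrite (_ : clamp K = (idfun \max (cst 0)) \min cst K%:R)//.
apply: continuous_min; last exact: cvg_cst.
by apply: continuous_max; [exact: cvg_id|exact: cvg_cst].
Qed.

Lemma cappedE K x : x \is a Num.int -> capped K x = clamp K x.
Proof.
move=> xint; have [x0|x0] := ltP x 0.
  rewrite /clamp (max_idPr (ltW x0)) min_l// /capped big_nat big1// => k /andP[k1 _].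
  by rewrite /level leNgt (lt_le_trans x0).
have /natrP[n ->] : x \is a Num.nat by rewrite natrEint xint.
rewrite /clamp (max_idPl (ler0n _ _)) -natr_min minEnat /capped.
elim: K => [|K IH]; first by rewrite big_geq// minn0.
rewrite big_nat_recr//= IH /level ler_nat.
have [Kn|nK] := leqP K.+1 n.
  by rewrite (minn_idPr (ltnW Kn)) natr1.
by rewrite /= addr0 (minn_idPl (nK : (n <= K)%N)).
Qed.

Lemma cvg_sum_nat (a : nat -> nat -> R) (l : nat -> R) K :
  (forall k, (1 <= k)%N -> a k m @[m --> \oo] --> l k) ->
  \sum_(1 <= k < K.+1) a k m @[m --> \oo] --> \sum_(1 <= k < K.+1) l k.
Proof.
move=> al; elim: K => [|K IH].
  by under eq_fun do rewrite big_geq//; rewrite big_geq//; exact: cvg_cst.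
under eq_fun do rewrite big_nat_recr//=.
by rewrite big_nat_recr//=; apply: cvgD => //; exact: al.
Qed.

Definition truncated_noise K s t w :=
  \sum_(1 <= k < K.+1) (server_departed Q S w k t - server_departed Q S w k s)
  - mu * \int[lebesgue_measure]_(r in `[s, t]) clamp K (Q r w).

(* Q is nonnegative only almost surely, hence the positive part. *)
Definition departure_noise s t w := departed Q S w t - departed Q S w s
  - mu * \int[lebesgue_measure]_(r in `[s, t]) Num.max (Q r w) 0.

(** The counting part of the sum equals its limit from some mesh on, by the exact cell formula; the
    drift converges as a Riemann sum. *)
Lemma noise_sum_cvg K s t w : 0 <= s -> s <= t ->
  noise_sum mu Q S K s t m m.+1 w @[m --> \oo] --> truncated_noise K s t w.
Proof.
move=> s0 st.
have -> : (fun m => noise_sum mu Q S K s t m m.+1 w) = (fun m =>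
    \sum_(1 <= k < K.+1) \sum_(i < m.+1) level k (Q (grid s t m i) w) *
      (S k (grid s t m i.+1) w - S k (grid s t m i) w)
    - mu * \sum_(i < m.+1) clamp K (Q (grid s t m i) w) * mesh s t m).
  apply/funext => m; rewrite exchange_big/= mulr_sumr -sumrB.
  apply: eq_bigr => i _; rewrite /noise_step /thinned_noise -cappedE; last first.
    apply: (queue_int (arrival_counting w) (@service_counting w) (cQ w) (Q0nat w) (Qeq w)).
    by rewrite (le_trans s0)// grid_ge.
  rewrite /capped mulr_suml mulr_sumr -sumrB; apply: eq_bigr => k _.
  have hm : grid s t m i.+1 - grid s t m i = mesh s t m.
    by rewrite gridS addrAC subrr add0r.
  by rewrite /service_noise /level_at hm; ring.
apply: cvgB.
  apply: cvg_sum_nat => k k1; apply: cvg_near_cst.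
  have := server_departed_riemann (arrival_counting w) (@service_counting w) (cQ w)
    (Qeq w) k1 s0 st.
  by apply: filterS => m <-.
apply: cvgMr.
exact: (riemann_sum_cvg (cadlag_comp (@continuous_clamp K) (cQ w)) s0 st).
Qed.

(** Replacing every indicator by 1 and each noise by count plus drift gives a bound free of m, as
    dominated convergence in the mesh requires. *)
Lemma noise_sum_bound K s t m w : 0 <= s -> s <= t ->
  `|noise_sum mu Q S K s t m m.+1 w| <=
    potential S w K t - potential S w K s + mu * K%:R * (t - s).
Proof.
move=> s0 st; rewrite (grid_telescope (potential S w K) s t m).
rewrite (grid_telescope id s t m) mulr_sumr -big_split/=.
apply: (le_trans (ler_norm_sum _ _ _)); apply: ler_sum => i _.
have g0 : 0 <= grid s t m i by rewrite (le_trans s0)// grid_ge.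
have gS : grid s t m i <= grid s t m i.+1 by exact: le_grid.
Transparent potential.
rewrite /potential -sumrB.
Opaque potential.
have -> : mu * K%:R * (grid s t m i.+1 - grid s t m i) =
    \sum_(1 <= k < K.+1) mu * (grid s t m i.+1 - grid s t m i).
  by rewrite sumr_const_nat subn1 mulrAC mulr_natr.
rewrite -big_split /noise_step /thinned_noise /=.
apply: (le_trans (ler_norm_sum _ _ _)); rewrite ler_sum_nat// => k /andP[k1 _].
rewrite normrM; have /andP[l0 l1] := level_bounds k (Q (grid s t m i) w).
rewrite /level_at (ger0_norm l0) /service_noise.
have S0 : 0 <= S k (grid s t m i.+1) w - S k (grid s t m i) w.
  by rewrite subr_ge0; have [_ _ + _] := service_counting w k1; apply.
have h0 : 0 <= mu * (grid s t m i.+1 - grid s t m i).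
  by rewrite mulr_ge0 ?subr_ge0// ltW.
apply: (@le_trans _ _ (1 * `|S k (grid s t m i.+1) w - S k (grid s t m i) w -
   mu * (grid s t m i.+1 - grid s t m i)|)); first by rewrite ler_wpM2r.
by rewrite mul1r (le_trans (ler_normB _ _))// !ger0_norm.
Qed.

Section truncated_moments.
Variables (K : nat) (s t : R) (B : set T).
Hypotheses (s0 : 0 <= s) (st : s <= t) (sB : F s B).

Let mB : measurable B.
Proof. exact: (history_measurable pA pS mQ0 sB). Qed.

Let bound w : R := potential S w K t - potential S w K s + mu * K%:R * (t - s).

Let bound2 : summable2 P bound.
Proof.
apply: summable2D (summable2_cst _ _).
Transparent potential.
rewrite /potential; under eq_fun do rewrite -sumrB.
Opaque potential.
apply: summable2_sum => k; rewrite mem_index_iota => /andP[k1 _].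
exact: (increment_summable2 mu0 (pS k1)).
Qed.

Let noise2 m := noise_sum_summable2 mu0 pA pS mQ0 cQ Qeq K m s0 st m.+1.

Lemma truncated_noise_mean :
  summable1 P (truncated_noise K s t) /\ mean_on P B (truncated_noise K s t) = 0.
Proof.
have [||||i1 cv] := @mean_on_dominated _ _ _ P B (fun m w => noise_sum mu Q S K s t m m.+1 w)
  (truncated_noise K s t) bound mB.
- by move=> m; exact: summable2_measurable (noise2 m).
- by move=> w; exact: noise_sum_cvg.
- exact: summable2_summable1.
- by apply: aeW => w m; exact: noise_sum_bound.
split => //; rewrite -(cvg_lim (@Rhausdorff R) cv).
under [X in lim (X @ _)]eq_fun do
  rewrite (noise_sum_mean mu0 pA pS mQ0 iG cQ Qeq K _ s0 st sB).
exact: lim_cst.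
Qed.

(** Both sides of the identity on the grid pass to the limit: the left under the square of [bound],
    the right under the constant [K%:R * (t - s)]. *)
Lemma truncated_noise_sqr_mean : summable2 P (truncated_noise K s t) /\
  mean_on P B (fun w => truncated_noise K s t w ^+ 2) =
  mu * mean_on P B (fun w => \int[lebesgue_measure]_(r in `[s, t]) clamp K (Q r w)).
Proof.
have [i1 _] := truncated_noise_mean.
have [||||i2 cv] := @mean_on_dominated _ _ _ P B (fun m w => noise_sum mu Q S K s t m m.+1 w ^+ 2)
  (fun w => truncated_noise K s t w ^+ 2) (fun w => bound w ^+ 2) mB.
- by move=> m; apply: measurable_funX; exact: summable2_measurable (noise2 m).
- by move=> w; apply: cvgM; exact: noise_sum_cvg.
- exact: bound2.2.
- apply: aeW => w m; rewrite ger0_norm ?sqr_ge0// -[leLHS]real_normK ?num_real//.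
  have b := noise_sum_bound K m w s0 st.
  by rewrite expr2 [leRHS]expr2; exact: (ler_pM (normr_ge0 _) (normr_ge0 _) b b).
split; first by split; [exact: summable1_measurable i1|exact: i2].
rewrite -(cvg_lim (@Rhausdorff R) cv); apply: (cvg_lim (@Rhausdorff R)).
under eq_fun do rewrite (noise_sum_sqr_mean mu0 pA pS mQ0 iG cQ Qeq K _ s0 st sB).
apply: cvgMr.
have int_Q m (i : 'I_m.+1) w : Q (grid s t m i) w \is a Num.int.
  apply: (queue_int (arrival_counting w) (@service_counting w) (cQ w) (Q0nat w) (Qeq w)).
  by rewrite (le_trans s0)// grid_ge.
have [||||_] := @mean_on_dominated _ _ _ P B
  (fun m w => \sum_(i < m.+1) capped K (Q (grid s t m i) w) * mesh s t m)
  (fun w => \int[lebesgue_measure]_(r in `[s, t]) clamp K (Q r w))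
  (fun=> K%:R * (t - s)) mB; last exact.
- move=> m; apply: measurable_sum => i; apply: measurable_funM => //.
  apply: measurableT_comp; first exact: measurable_capped.
  apply: (adapted_at_measurable pA pS mQ0 (t := grid s t m i)).
  by apply: (adapted_at_queue pA pS cQ Qeq) => //; rewrite (le_trans s0)// grid_ge.
- move=> w; under eq_fun do under eq_bigr do rewrite cappedE//.
  exact: (riemann_sum_cvg (cadlag_comp (@continuous_clamp K) (cQ w)) s0 st).
- exact: summable1_cst.
- apply: aeW => w m; rewrite ger0_norm; last first.
    apply: sumr_ge0 => i _; rewrite mulr_ge0 ?mesh_ge0//.
    by have /andP[] := capped_bounds K (Q (grid s t m i) w).
  rewrite (grid_telescope id s t m) mulr_sumr; apply: ler_sum => i _.
  rewrite gridS addrAC subrr add0r ler_wpM2r ?mesh_ge0//.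
  by have /andP[] := capped_bounds K (Q (grid s t m i) w).
Qed.

End truncated_moments.

Lemma initial_summable1 : summable1 P (Q 0).
Proof.
apply/integrableP; split; first exact/measurable_EFinP.
move: Q0mean; rewrite unlock; apply: le_lt_trans.
rewrite le_eqVlt; apply/orP; left; apply/eqP; apply: eq_integral => w _ /=.
by rewrite ger0_norm// natr_ge0.
Qed.

Lemma arrival_summable2 t : 0 <= t -> summable2 P (A t).
Proof.
move=> t0; have := increment_summable2 lam0 pA (lexx 0) t0.
rewrite (_ : (fun w => A t w - A 0 w) = A t)//; apply/funext => w.
by have [-> _ _ _] := arrival_counting w; rewrite subr0.
Qed.

(* Bounds the truncated noise uniformly in K, almost surely.  It is integrable,
   but square-integrable only where Q 0 is bounded. *)
Definition envelope (t : R) (w : T) : R := (1 + mu * t) * (Q 0 w + A t w).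

Lemma envelope_summable1 t : 0 <= t -> summable1 P (envelope t).
Proof.
move=> t0; apply: summable1Z; apply: summable1D; first exact: initial_summable1.
exact/summable2_summable1/arrival_summable2.
Qed.

Let queue_ub w s t : 0 <= s -> s <= t -> Q s w <= Q 0 w + A t w.
Proof. exact: (queue_le (arrival_counting w) (Qeq w)). Qed.

Let start_ge0 w t : 0 <= t -> 0 <= Q 0 w + A t w.
Proof.
move=> t0; apply: addr_ge0; first exact: (natr_ge0 (Q0nat w)).
exact: (counting_path_ge0 (arrival_counting w) t0).
Qed.

Let positive_cadlag w : cadlag (fun r => Num.max (Q r w) 0).
Proof.
apply: (@cadlag_comp _ (fun x => Num.max x 0)) => // x.
by apply: (@continuous_max _ _ idfun (cst 0)); [exact: cvg_id|exact: cvg_cst].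
Qed.

Lemma clamp_integral_cvg s t w : 0 <= s -> s <= t ->
  \int[lebesgue_measure]_(r in `[s, t]) clamp K (Q r w) @[K --> \oo] -->
  \int[lebesgue_measure]_(r in `[s, t]) Num.max (Q r w) 0.
Proof.
move=> s0 st; apply: cvg_near_cst.
have [K0 K0w] := nat_ub (Q 0 w + A t w).
near=> K.
have tK : Q 0 w + A t w <= K%:R.
  by rewrite (le_trans K0w)// ler_nat; near: K; exact: nbhs_infty_ge.
apply: eq_Rintegral => r /set_mem /=.
rewrite in_itv/= => /andP[sr rt]; rewrite /clamp min_l//.
rewrite ge_max ler0n andbT (le_trans _ tK)// queue_ub//.
exact: le_trans sr.
Unshelve. all: by end_near. Qed.

Lemma truncated_noise_cvg s t w : 0 <= s -> s <= t ->
  truncated_noise K s t w @[K --> \oo] --> departure_noise s t w.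
Proof.
move=> s0 st; have t0 := le_trans s0 st.
apply: cvgB; last by apply: cvgMr; exact: clamp_integral_cvg.
apply: cvg_near_cst; have [K0 K0w] := nat_ub (Q 0 w + A t w).
near=> K.
have tK : Q 0 w + A t w <= K%:R.
  by rewrite (le_trans K0w)// ler_nat; near: K; exact: nbhs_infty_ge.
have sK : Q 0 w + A s w <= K%:R.
  rewrite (le_trans _ tK)// lerD2l.
  by have [_ _ + _] := arrival_counting w; apply.
rewrite (departedE (arrival_counting w) (@service_counting w) (cQ w) (Qeq w) t0 tK).
rewrite (departedE (arrival_counting w) (@service_counting w) (cQ w) (Qeq w) s0 sK).
by rewrite -sumrB.
Unshelve. all: by end_near. Qed.

Let server_departed_ge0 w k t : (1 <= k)%N -> 0 <= t -> 0 <= server_departed Q S w k t.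
Proof.
move=> k1 t0.
have /andP[+ _] := server_departed_bounds (@service_counting w) (cQ w) k1 (lexx 0) t0.
by rewrite server_departed0 subr0.
Qed.

Let server_departed_homo w k s t : (1 <= k)%N -> 0 <= s -> s <= t ->
  server_departed Q S w k s <= server_departed Q S w k t.
Proof.
move=> k1 s0 st.
have /andP[+ _] := server_departed_bounds (@service_counting w) (cQ w) k1 s0 st.
by rewrite subr_ge0.
Qed.

(** With [M = Q 0 w + A t w], departures up to t are at most M because [Q t w] is nonnegative, and
    the drift is at most mu t M because Q stays below M; hence the factor [1 + mu * t] in
    [envelope]. *)
Lemma truncated_noise_bound K s t w : 0 <= s -> s <= t ->
  (forall u, 0 <= u -> 0 <= Q u w) -> `|truncated_noise K s t w| <= envelope t w.
Proof.
move=> s0 st Qw; have t0 := le_trans s0 st.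
pose M := Q 0 w + A t w; have M0 : 0 <= M := start_ge0 w t0.
rewrite /truncated_noise /envelope -/M.
set a := \sum_(_ <= _ < _) _; set c := \int[_]_(_ in _) _.
have a0 : 0 <= a.
  rewrite /a big_nat; apply: sumr_ge0 => k /andP[k1 _].
  by rewrite subr_ge0 server_departed_homo.
have aM : a <= M.
  (* K' is at least K, so that its sum extends the one in [a], and at least M, so that this sum
     counts all departures. *)
  have [K' K'w] := nat_ub (Num.max K%:R M).
  move: K'w; rewrite ge_max ler_nat => /andP[KK' MK'].
  apply: (@le_trans _ _ (departed Q S w t)).
    rewrite (departedE (arrival_counting w) (@service_counting w) (cQ w) (Qeq w) t0 MK').
    rewrite (big_cat_nat _ (n := K.+1))//= -[leLHS]addr0 lerD//.
      rewrite /a ler_sum_nat// => k /andP[k1 _].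
      by rewrite lerBlDr lerDl server_departed_ge0.
    rewrite big_nat; apply: sumr_ge0 => k /andP[k1 _]; apply: server_departed_ge0 => //.
    exact: leq_trans k1.
  have := queueE (Qeq w) t0; have := Qw t t0; rewrite /M.
  by move: (departed Q S w t) => x; lra.
have c0 : 0 <= c.
  by apply: Rintegral_ge0 => r _; have /andP[] := clamp_bounds K (Q r w).
have cM : c <= M * t.
  apply: (@le_trans _ _ (M * (t - s))); last by rewrite ler_wpM2l// gerBl.
  apply: cadlag_integral_le => //; first exact: (cadlag_comp (@continuous_clamp K)).
  move=> r sr rt; rewrite (le_trans (clamp_le_max _ _))// ge_max M0 andbT.
  by apply: queue_ub => //; exact: le_trans sr.
have m0 : 0 <= mu * c by rewrite mulr_ge0// ltW.
have mM : mu * c <= mu * (M * t) by rewrite ler_wpM2l// ltW.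
apply: (@le_trans _ _ (a + mu * c)); last by move: mM; nra.
by rewrite (le_trans (ler_normB _ _))// !ger0_norm.
Qed.

Section full_moments.
Variables (s t : R) (B : set T).
Hypotheses (s0 : 0 <= s) (st : s <= t) (sB : F s B).

Let t0 : 0 <= t. Proof. exact: le_trans st. Qed.

Let mB : measurable B.
Proof. exact: (history_measurable pA pS mQ0 sB). Qed.

Let ae_bound : {ae P, forall w, forall K, `|truncated_noise K s t w| <= envelope t w}.
Proof.
apply: filterS (ae_queue_ge0 mu0 pA pS mQ0 Q0nat iG cQ Qeq) => w Qw K.
exact: truncated_noise_bound.
Qed.

Let sT : F s setT.
Proof. exact: (@measurableT _ (g_sigma_algebraType (history_events P Q A S s))). Qed.

Let mtrunc K : measurable_fun setT (truncated_noise K s t).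
Proof. exact: summable1_measurable (truncated_noise_mean K s0 st sT).1. Qed.

Lemma departure_noise_mean :
  summable1 P (departure_noise s t) /\ mean_on P B (departure_noise s t) = 0.
Proof.
have [||||i1 cv] := @mean_on_dominated _ _ _ P B (fun K => truncated_noise K s t)
  (departure_noise s t) (envelope t) mB.
- exact: mtrunc.
- by move=> w; exact: truncated_noise_cvg.
- exact: envelope_summable1.
- exact: ae_bound.
split => //; rewrite -(cvg_lim (@Rhausdorff R) cv).
under [X in lim (X @ _)]eq_fun do rewrite (truncated_noise_mean _ s0 st sB).2.
exact: lim_cst.
Qed.

Definition positive_queue_integral u v w : R :=
  \int[lebesgue_measure]_(r in `[u, v]) Num.max (Q r w) 0.

Lemma positive_queue_integral_bounds w :
  0 <= positive_queue_integral s t w <= t * (Q 0 w + A t w).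
Proof.
rewrite Rintegral_ge0/=; last by move=> r _; rewrite le_max lexx orbT.
rewrite mulrC (@le_trans _ _ ((Q 0 w + A t w) * (t - s)))//; last first.
  by rewrite ler_wpM2l ?start_ge0// gerBl.
apply: cadlag_integral_le => // r sr rt; rewrite ge_max start_ge0// andbT.
by apply: queue_ub => //; exact: le_trans sr.
Qed.

Lemma positive_queue_integral_summable1 : summable1 P (positive_queue_integral s t).
Proof.
apply: (@summable1_le _ _ _ _ _ (fun w => t * (Q 0 w + A t w))).
- apply: (adapted_at_measurable pA pS mQ0 (t := t)).
  apply: (adapted_at_integral pA pS cQ Qeq (g := fun x => Num.max x 0)) => //.
  move=> x; apply: (@continuous_max _ _ idfun (cst 0)); [exact: cvg_id|exact: cvg_cst].
- by move=> w; have /andP[? ?] := positive_queue_integral_bounds w; rewrite ger0_norm.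
- apply: summable1Z; apply: summable1D; first exact: initial_summable1.
  exact/summable2_summable1/arrival_summable2.
Qed.

Let small (n : nat) : set T := [set w | Q 0 w <= n%:R].

(** The initial state belongs to every history, so restricting to [small n] keeps an event in
    [F s]. *)
Let small_history n : F s (small n).
Proof.
have aQ0 : adapted_at P Q A S s (Q 0) by exact: adapted_at_Q0.
rewrite (_ : small n = setT `&` Q 0 @^-1` `]-oo, n%:R]); first exact: aQ0.
by rewrite setTI; apply/seteqP; split => w /=; rewrite in_itv.
Qed.

(** On [small n] the envelope is at most [(1 + mu * t) * (n%:R + A t w)], whose square is integrable
    since A has second moments; so K can tend to infinity by domination. *)
Let mean_small n :
  summable1 P (fun w => \1_(small n) w * departure_noise s t w ^+ 2) /\
  mean_on P B (fun w => \1_(small n) w * departure_noise s t w ^+ 2) =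
  mu * mean_on P B (fun w => \1_(small n) w * positive_queue_integral s t w).
Proof.
have msm : measurable (small n) by exact: (history_measurable pA pS mQ0 (small_history n)).
have mind : measurable_fun setT (\1_(small n) : T -> R) by exact: measurable_indic.
have sBn : F s (B `&` small n).
  exact: (@measurableI _ (g_sigma_algebraType (history_events P Q A S s)) _ _ sB (small_history n)).
have inB (X : T -> R) :
    mean_on P B (fun w => \1_(small n) w * X w) = mean_on P (B `&` small n) X.
  rewrite mean_on_indic// [RHS]mean_on_indic; last exact: measurableI.
  by congr (mean_on _ _ _); apply/funext => w; rewrite mulrA indicI.
have env2 : summable2 P (fun w => (1 + mu * t) * (n%:R + A t w)).
  apply: summable2Z; apply: summable2D; first exact: summable2_cst.
  exact: arrival_summable2.
have [||||i1 cv] := @mean_on_dominated _ _ _ P B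
  (fun K w => \1_(small n) w * truncated_noise K s t w ^+ 2)
  (fun w => \1_(small n) w * departure_noise s t w ^+ 2)
  (fun w => ((1 + mu * t) * (n%:R + A t w)) ^+ 2) mB.
- by move=> K; apply: measurable_funM => //; apply: measurable_funX; exact: mtrunc.
- by move=> w; apply: cvgMr; apply: cvgM; exact: truncated_noise_cvg.
- exact: env2.2.
- apply: filterS ae_bound => w bw K; rewrite indicE.
  have [/set_mem /= Qn|_] := boolP (w \in small n); last first.
    by rewrite mul0r normr0 sqr_ge0.
  rewrite mul1r ger0_norm ?sqr_ge0// -[leLHS]real_normK ?num_real//.
  have {}bw : `|truncated_noise K s t w| <= (1 + mu * t) * (n%:R + A t w).
    apply: (le_trans (bw K)); rewrite /envelope ler_wpM2l ?lerD2r//.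
    by rewrite addr_ge0// mulr_ge0// ltW.
  by rewrite expr2 [leRHS]expr2; exact: (ler_pM (normr_ge0 _) (normr_ge0 _) bw bw).
split => //; rewrite -(cvg_lim (@Rhausdorff R) cv); apply: (cvg_lim (@Rhausdorff R)).
(* The indicator is moved into the event, as the moments with K servers are known over the
   intersection of B and [small n]. *)
under eq_fun do rewrite inB (truncated_noise_sqr_mean _ s0 st sBn).2.
rewrite inB; apply: cvgMr.
have [|||||_] := @mean_on_dominated _ _ _ P (B `&` small n)
  (fun K w => \int[lebesgue_measure]_(r in `[s, t]) clamp K (Q r w))
  (positive_queue_integral s t) (fun w => t * (Q 0 w + A t w)); last exact.
- exact: measurableI.
- move=> K; apply: (adapted_at_measurable pA pS mQ0 (t := t)).
  by apply: (adapted_at_integral pA pS cQ Qeq) => //; exact: continuous_clamp.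
- by move=> w; exact: clamp_integral_cvg.
- apply: summable1Z; apply: summable1D; first exact: initial_summable1.
  exact/summable2_summable1/arrival_summable2.
- apply: aeW => w K; rewrite ger0_norm; last first.
    by apply: Rintegral_ge0 => r _; have /andP[] := clamp_bounds K (Q r w).
  rewrite (@le_trans _ _ ((Q 0 w + A t w) * (t - s)))//; last first.
    by rewrite [leRHS]mulrC ler_wpM2l ?start_ge0// gerBl.
  apply: cadlag_integral_le => //; first exact: (cadlag_comp (@continuous_clamp K)).
  move=> r sr rt; rewrite (le_trans (clamp_le_max _ _))// ge_max start_ge0// andbT.
  by apply: queue_ub => //; exact: le_trans sr.
Qed.

Let indic_small_cvg w : \1_(small n) w @[n --> \oo] --> (1 : R).
Proof.
apply: cvg_near_cst; have [K Kw] := nat_ub (Q 0 w).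
near=> n; rewrite indicE mem_set// /small /= (le_trans Kw)// ler_nat.
by near: n; exact: nbhs_infty_ge.
Unshelve. all: by end_near. Qed.

(** Stated in the extended reals, since square-integrability of the noise is drawn from it: monotone
    convergence on the left, domination by the summable [positive_queue_integral] on the right. *)
Lemma integral_departure_noise_sqr :
  (\int[P]_(w in B) (departure_noise s t w ^+ 2)%:E =
   (mu * mean_on P B (positive_queue_integral s t))%:E)%E.
Proof.
have msm n : measurable (small n) by exact: (history_measurable pA pS mQ0 (small_history n)).
have mind n : measurable_fun setT (\1_(small n) : T -> R) by exact: measurable_indic.
have mnoise := summable1_measurable departure_noise_mean.1.
have iC := positive_queue_integral_summable1.
have C0 w : 0 <= positive_queue_integral s t w.
  by have /andP[] := positive_queue_integral_bounds w.
pose f (n : nat) (w : T) := (\1_(small n) w * departure_noise s t w ^+ 2)%:E.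
have fcv w : f n w @[n --> \oo] --> (departure_noise s t w ^+ 2)%:E.
  apply: cvg_EFin; first exact: nearW.
  by rewrite -[X in _ --> X]mul1r; apply: cvgMl; exact: indic_small_cvg.
have mf n : measurable_fun setT (f n).
  by apply/measurable_EFinP; apply: measurable_funM => //; exact: measurable_funX.
have f0 n w : (0 <= f n w)%E.
  by rewrite lee_fin mulr_ge0 ?sqr_ge0// indicE; case: (_ \in _).
have fnd w : nondecreasing_seq (f ^~ w).
  move=> m n mn; rewrite lee_fin ler_wpM2r ?sqr_ge0// !indicE.
  have [/set_mem Qm|_] := boolP (w \in small m); last first.
    by case: (_ \in _); rewrite /= ?lexx ?ler01.
  by rewrite mem_set//= /small /= (le_trans Qm)// ler_nat.
have mono := @cvg_monotone_convergence _ _ _ P B mB f (fun n => measurable_funTS (mf n))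
  (fun n w _ => f0 n w) (fun w _ => fnd w).
rewrite (_ : (\int[P]_(w in B) _ = \int[P]_(w in B) limn (f ^~ w))%E); last first.
  by apply: eq_integral => w _; apply/esym/cvg_lim => //; exact: fcv.
rewrite -(cvg_lim _ mono)//; apply: cvg_lim => //.
have -> : (fun n => \int[P]_(w in B) f n w)%E = (fun n =>
    (mu * mean_on P B (fun w => \1_(small n) w * positive_queue_integral s t w))%:E).
  by apply/funext => n; have [i1 <-] := mean_small n; rewrite -mean_on_fin.
apply: cvg_EFin; first exact: nearW.
apply: cvgMr.
have [||||_] := @mean_on_dominated _ _ _ P B
  (fun n w => \1_(small n) w * positive_queue_integral s t w)
  (positive_queue_integral s t) (positive_queue_integral s t) mB; last exact.
- by move=> n; apply: measurable_funM => //; exact: (summable1_measurable iC).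
- by move=> w; rewrite -[X in _ --> X]mul1r; apply: cvgMl; exact: indic_small_cvg.
- exact: iC.
- apply: aeW => w n; rewrite ger0_norm; last first.
    by rewrite mulr_ge0// indicE; case: (_ \in _).
  by rewrite ler_piMl// indicE; case: (_ \in _); rewrite /= ?ler01.
Qed.

End full_moments.

Lemma departure_noise_summable2 s t : 0 <= s -> s <= t -> summable2 P (departure_noise s t).
Proof.
move=> s0 st.
have sT : F s setT by exact: (@measurableT _ (g_sigma_algebraType (history_events P Q A S s))).
have mN := summable1_measurable (departure_noise_mean s0 st sT).1.
split => //; apply/integrableP; split.
  by apply/measurable_EFinP; exact: measurable_funX.
have := integral_departure_noise_sqr s0 st sT.
rewrite (_ : (\int[P]_x _ = \int[P]_x (departure_noise s t x ^+ 2)%:E)%E).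
  by move=> ->; exact: ltry.
by apply: eq_integral => w _; rewrite /= ger0_norm// sqr_ge0.
Qed.

Lemma departure_noise_sqr_mean s t B : 0 <= s -> s <= t -> F s B ->
  mean_on P B (fun w => departure_noise s t w ^+ 2) =
  mu * mean_on P B (positive_queue_integral s t).
Proof.
by move=> s0 st sB; rewrite {1}/mean_on /Rintegral integral_departure_noise_sqr.
Qed.

End departure_noise.

(** * Martingales *)

Section primitives.
Context {R : realType}.
Implicit Types f g : R -> R.

Lemma left_limit_cvg f t l : f x @[x --> t^'-] --> l -> left_limit f t = l.
Proof. by move=> h; apply/cvg_lim => //; exact: Rhausdorff. Qed.

Lemma continuous_cadlag f : continuous f -> cadlag f.
Proof.
move=> cf; split => t t0; first by apply: cvg_within_filter; exact: cf.
by apply/cvg_ex; exists (f t); apply: cvg_within_filter; exact: cf.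
Qed.

Lemma cadlagD f g : cadlag f -> cadlag g -> cadlag (fun t => f t + g t).
Proof.
move=> cf cg; split => t t0; first by apply: cvgD; [exact: cf.1|exact: cg.1].
by apply: is_cvgD; [exact: cf.2|exact: cg.2].
Qed.

Lemma cadlagZ c f : cadlag f -> cadlag (fun t => c * f t).
Proof.
move=> cf; apply: cadlag_comp cf => x.
by apply: cvgM; [exact: cvg_cst|exact: cvg_id].
Qed.

Lemma cadlagB f g : cadlag f -> cadlag g -> cadlag (fun t => f t - g t).
Proof.
move=> cf /(cadlagZ (-1)) cg; have := cadlagD cf cg.
by under eq_fun do rewrite mulN1r.
Qed.

Lemma cadlag_sqr f : cadlag f -> cadlag (fun t => f t ^+ 2).
Proof.
move=> cf; apply: (@cadlag_comp _ (fun x => x ^+ 2)) cf => x.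
exact: exprn_continuous.
Qed.

Variable f : R -> R.
Hypothesis cf : cadlag f.

Definition primitive (t : R) : R := \int[lebesgue_measure]_(r in `[0, t]) f r.

Lemma primitive0 : primitive 0 = 0.
Proof. by rewrite /primitive set_itv1 Rintegral_set1. Qed.

Lemma primitiveB s t : 0 <= s -> s <= t ->
  primitive t - primitive s = \int[lebesgue_measure]_(r in `[s, t]) f r.
Proof.
move=> s0 st; have t0 := le_trans s0 st.
have i0t := cadlag_integrable cf (lexx 0) t0.
rewrite Rintegral_itvB//.
rewrite Rintegral_itv_obnd_cbnd//.
apply: (integrableS _ _ _ i0t) => //.
by apply: subset_itv; rewrite bnd_simp.
Qed.

(** A cadlag path is bounded on [0, T], and the bound is a Lipschitz constant; continuity of the
    primitive from both sides follows even where [f] jumps. *)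
Lemma primitive_lipschitz T : exists2 C, 0 <= C & forall s t, 0 <= s -> s <= t -> t <= T ->
  `|primitive t - primitive s| <= C * (t - s).
Proof.
have [C hC] := cadlag_bounded T cf.
exists `|C| => // s t s0 st tT; rewrite primitiveB//.
have bnd r : s <= r -> r <= t -> `|f r| <= `|C|.
  move=> sr rt; rewrite (le_trans _ (ler_norm C))//; apply: hC.
    exact: le_trans sr.
  exact: le_trans tT.
rewrite ler_norml; apply/andP; split; last first.
  by apply: cadlag_integral_le => // r sr rt; rewrite (le_trans (ler_norm _))// bnd.
rewrite lerNl; have := @cadlag_integral_le _ (fun r => -1 * f r) `|C| s t (cadlagZ (-1) cf) s0 st.
rewrite RintegralZl//; last exact: cadlag_integrable.
rewrite mulN1r; apply => r sr rt; rewrite mulN1r (le_trans (ler_norm _))// normrN.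
exact: bnd.
Qed.

Lemma primitive_right t : 0 <= t -> primitive x @[x --> t^'+] --> primitive t.
Proof.
move=> t0; have [C C0 hC] := primitive_lipschitz (t + 1).
apply/cvgrPdist_lt => e e0; apply/near_rightP.
exists (Num.min 1 (e / (C + 1))); first by rewrite lt_min ltr01 divr_gt0// ltr_pwDr.
move=> y ty; rewrite -ltrBlDl lt_min => /andP[y1 ye].
rewrite distrC (le_lt_trans (hC t y t0 (ltW ty) _))//; first by lra.
have C1 : 0 < C + 1 by lra.
move: ye; rewrite ltr_pdivlMr//; nra.
Qed.

Lemma primitive_left t : 0 < t -> primitive x @[x --> t^'-] --> primitive t.
Proof.
move=> t0; have [C C0 hC] := primitive_lipschitz t.
apply/cvgrPdist_lt => e e0; apply/near_leftP.
exists (Num.min t (e / (C + 1))); first by rewrite lt_min t0 divr_gt0// ltr_pwDr.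
move=> y + yt; rewrite ltrBlDr -ltrBlDl lt_min => /andP[y1 ye].
rewrite (le_lt_trans (hC y t _ (ltW yt) _))//; first by lra.
have C1 : 0 < C + 1 by lra.
move: ye; rewrite ltr_pdivlMr//; nra.
Qed.

Lemma cadlag_primitive : cadlag primitive.
Proof.
split => t t0; first exact: primitive_right.
exact: cvgP (primitive_left t0).
Qed.

End primitives.

(** * Martingales from conditional moments of increments *)

Section martingales.
Context d (T : measurableType d) (R : realType) (P : probability T R).
Variable (H : R -> set (set T)).
Hypotheses (Hm : forall t, <<s H t >> `<=` measurable).

Local Notation F := (fun t => <<s H t >>).

Lemma expectation_lty (X : T -> R) : summable1 P X -> ('E_P[X] < +oo)%E.
Proof.
by move=> iX; rewrite unlock (mean_on_fin measurableT iX) ltry.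
Qed.

Lemma martingaleI (M : R -> T -> R) :
  (forall w, cadlag (M ^~ w)) ->
  (forall t, 0 <= t -> measurable_fun (setT : set (g_sigma_algebraType (H t))) (M t)) ->
  (forall t, 0 <= t -> summable1 P (M t)) ->
  (forall s t B, 0 <= s -> s <= t -> <<s H s >> B ->
    mean_on P B (M t) = mean_on P B (M s)) ->
  martingale P F M.
Proof.
move=> cM aM iM eM; split => //.
  by move=> t t0; apply/measurable_wrtP; exact: aM.
move=> s t s0 st; split; [by apply/measurable_wrtP; exact: aM|exact: iM|].
move=> B sB; have mB := Hm sB.
rewrite !mean_on_fin ?(eM s t)//; apply: iM => //.
exact: le_trans st.
Qed.

Lemma martingaleB c (M N : R -> T -> R) : martingale P F M -> martingale P F N ->
  martingale P F (fun t w => M t w - c * N t w).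
Proof.
move=> [cM aM iM eM] [cN aN iN eN]; apply: martingaleI => [w|t t0|t t0|s t B s0 st sB].
- exact: cadlagB (cM w) (cadlagZ c (cN w)).
- apply: measurable_funB; first by apply/measurable_wrtP; exact: aM.
  by apply: measurable_funM => //; apply/measurable_wrtP; exact: aN.
- exact: summable1B (iM _ t0) (summable1Z c (iN _ t0)).
have t0 := le_trans s0 st; have mB := Hm sB.
rewrite !mean_onB ?mean_onZ//; try exact: iM; try exact: iN;
  try (apply: summable1Z; exact: iN).
have [_ _ /(_ B sB) EM] := eM s t s0 st.
have [_ _ /(_ B sB) EN] := eN s t s0 st.
by rewrite /mean_on /Rintegral EM EN.
Qed.

(** The stopping times are constantly infinite, and stopping at infinity changes nothing. *)
Lemma martingale_local (M : R -> T -> R) : martingale P F M -> local_martingale P F M.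
Proof.
move=> mM; exists (fun _ _ => +oo%E); split.
- move=> m; split=> [w|t t0]; first exact: leey.
  rewrite (_ : [set _ | _] = set0).
    exact: (@measurable0 _ (g_sigma_algebraType (H t))).
  by apply/seteqP; split => w //=; rewrite leye_eq.
- by apply: aeW => w.
- by apply: aeW => w; exact: cvg_cst.
- move=> m; rewrite (_ : stopped _ M = M)//.
  apply/funext => t; apply/funext => w; rewrite /stopped; congr (M _ w).
  by rewrite min_l// leey.
Qed.

Lemma left_continuous_predictable (V : R -> T -> R) : adapted F V ->
  (forall w, left_continuous_path (V ^~ w)) -> predictable F V.
Proof.
move=> aV lV E hE; apply: sub_sigma_algebra; exists V => //.
Qed.

Variables M V : R -> T -> R.
Hypotheses (cM : forall w, cadlag (M ^~ w)) (cV : forall w, cadlag (V ^~ w))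
  (aM : forall t, 0 <= t -> measurable_fun (setT : set (g_sigma_algebraType (H t))) (M t))
  (aV : forall t, 0 <= t -> measurable_fun (setT : set (g_sigma_algebraType (H t))) (V t))
  (M2 : forall t, 0 <= t -> summable2 P (M t))
  (V1 : forall t, 0 <= t -> summable1 P (V t))
  (eM : forall s t B, 0 <= s -> s <= t -> <<s H s >> B ->
    mean_on P B (fun w => M t w - M s w) = 0)
  (eV : forall s t B, 0 <= s -> s <= t -> <<s H s >> B ->
    mean_on P B (fun w => (M t w - M s w) ^+ 2) = mean_on P B (fun w => V t w - V s w)).

Lemma increments_martingale : square_integrable_martingale P F M.
Proof.
split; last by move=> t t0; exact: expectation_lty (M2 t0).2.
apply: martingaleI => // [t t0|s t B s0 st sB].
  exact: summable2_summable1 (M2 t0).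
apply/eqP; rewrite -subr_eq0 -mean_onB ?eM//.
- exact: Hm sB.
- exact: summable2_summable1 (M2 (le_trans s0 st)).
- exact: summable2_summable1 (M2 s0).
Qed.

Lemma increments_compensated_martingale :
  martingale P F (fun t w => M t w ^+ 2 - V t w).
Proof.
apply: martingaleI => [w|t t0|t t0|s t B s0 st sB].
- exact: cadlagB (cadlag_sqr (cM w)) (cV w).
- apply: measurable_funB; last exact: aV.
  by apply: measurable_funX; exact: aM.
- exact: summable1B (M2 t0).2 (V1 t0).
have t0 := le_trans s0 st; have mB := Hm sB.
have Ms := M2 s0; have Mt := M2 t0; have MB := summable2B Mt Ms.
have iVB := summable1B (V1 t0) (V1 s0).
apply/eqP; rewrite -subr_eq0 -mean_onB//; last 2 first.
- exact: summable1B Mt.2 (V1 t0).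
- exact: summable1B Ms.2 (V1 s0).
(* M_t^2 - M_s^2 = (M_t - M_s)^2 + 2 M_s (M_t - M_s): [eV] cancels the first term against the
   increment of V, and orthogonality to the past kills the second. *)
rewrite [X in mean_on _ _ X](_ : _ = fun w => (M t w - M s w) ^+ 2 - (V t w - V s w) +
    2 * (M s w * (M t w - M s w))); last by apply/funext => w; ring.
have iMM := summable2M Ms MB.
rewrite mean_onD//; [|exact: summable1B MB.2 iVB|exact: summable1Z].
rewrite mean_onB//; [|exact: MB.2].
rewrite eV// subrr add0r mean_onZ//.
rewrite mean_on_indic//; under [X in mean_on _ _ X]eq_fun do rewrite mulrA.
rewrite (mean_mul_eq0 (H := H s)) ?mulr0//.
- exact: summable2_summable1.
- by move=> C sC; exact: eM.
- apply: measurable_funM; last exact: aM.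
  exact: (@measurable_indic _ (g_sigma_algebraType (H s))).
- have i1 : summable2 P (fun w => \1_B w * M s w).
    apply: summable2_bounded_mul Ms; first exact: measurable_indic.
    by move=> w; rewrite indicE; case: (_ \in _); rewrite /= ?normr1 ?normr0.
  exact: summable2M i1 MB.
Qed.

End martingales.

(** * The queue equation and the two martingales *)

Section many_server_queue.
Context d (T : measurableType d) (R : realType) (P : probability T R).
Variables (mu : R) (n : nat) (Q A : R -> T -> R) (S : nat -> R -> T -> R).
Local Notation lam := (arrival_rate mu n).
Hypotheses (mu0 : 0 < mu) (n1 : (1 <= n)%N)
  (pA : poisson_process P lam A)
  (pS : forall k, (1 <= k)%N -> poisson_process P mu (S k))
  (mQ0 : measurable_fun setT (Q 0))
  (Q0nat : forall w, Q 0 w \is a Num.nat)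
  (iG : mutually_independent P (source Q A S))
  (cQ : forall w, cadlag (Q ^~ w))
  (Qeq : forall w t, 0 <= t ->
    ((Q t w)%:E = (Q 0 w + A t w)%:E - departures Q S t w)%E)
  (Q0mean : ('E_P[Q 0%R] < +oo)%E).

Local Notation H := (history_events P Q A S).
Local Notation F := (history P Q A S).
Local Notation c := ((Num.sqrt n%:R : R)^-1).
Local Notation D t w := (departed Q S w t).

Let lam0 : 0 < lam. Proof. by rewrite /arrival_rate mulr_gt0 ?ltr0n. Qed.

Let Hm t : <<s H t >> `<=` measurable.
Proof. exact: (history_measurable pA pS mQ0). Qed.

Let arrival_counting w : counting_path (A ^~ w).
Proof. by have [_ + _ _] := pA; exact. Qed.

Let service_counting w k : (1 <= k)%N -> counting_path (S k ^~ w).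
Proof. by move=> /pS[_ + _ _]; exact. Qed.

Let departed_counting w : counting_path (departed Q S w).
Proof.
exact: (counting_departed (arrival_counting w) (@service_counting w) (cQ w) (Q0nat w) (Qeq w)).
Qed.

Let c2 : c ^+ 2 = n%:R^-1.
Proof. by rewrite exprVn sqr_sqrtr. Qed.

Definition departure_martingale t w := D t w - mu * primitive (Q ^~ w) t.

Lemma M1E : M1 mu n A = fun t w => c * (A t w - lam * t).
Proof. by apply/funext => t; apply/funext => w; rewrite /M1 mulrC. Qed.

Lemma primitive_left_limit w t :
  \int[lebesgue_measure]_(s in `[0, t]) left_limit (Q ^~ w) s = primitive (Q ^~ w) t.
Proof.
have [t0|t0] := leP 0 t; first exact: Rintegral_left_limit.
by rewrite /primitive set_itv_ge ?Rintegral_set0// bnd_simp -ltNge.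
Qed.

Lemma M2E : M2 mu n Q S = fun t w => c * departure_martingale t w.
Proof.
apply/funext => t; apply/funext => w; rewrite /M2 /departure_martingale.
by rewrite primitive_left_limit.
Qed.

Lemma scaled_queue_equation w t : 0 <= t ->
  scaled_queue n Q t w = scaled_queue n Q 0 w + M1 mu n A t w - M2 mu n Q S t w
    - mu * \int[lebesgue_measure]_(s in `[0, t]) scaled_queue n Q s w.
Proof.
move=> t0.
have iQ := cadlag_integrable (cQ w) (lexx 0) t0.
have cn : cadlag (fun _ : R => n%:R : R).
  by apply: continuous_cadlag => x; exact: cvg_cst.
have in1 := cadlag_integrable cn (lexx 0) t0.
have -> : \int[lebesgue_measure]_(s in `[0, t]) scaled_queue n Q s w =
    c * (primitive (Q ^~ w) t - n%:R * t).
  under eq_Rintegral do rewrite /scaled_queue mulrC.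
  rewrite RintegralZl//; last first.
    exact: (cadlag_integrable (cadlagB (cQ w) cn) (lexx 0) t0).
  rewrite RintegralB// Rintegral_cst//.
  have := @lebesgue_measure_itv R `[0, t]; rewrite /= lte_fin => ->.
  by move: t0; rewrite le_eqVlt => /predU1P[<-|->]; rewrite ?ltxx ?oppr0 ?adde0.
(* The drift [n%:R * mu * t] of the arrivals cancels the term that the centring of Q at n leaves in
   the integral. *)
rewrite M1E M2E /scaled_queue /departure_martingale (queueE (Qeq w) t0).
by rewrite /arrival_rate; move: (departed Q S w t) (primitive _ t) => x y; ring.
Qed.

Let departed_adapted t : 0 <= t ->
  measurable_fun (setT : set (g_sigma_algebraType (H t))) (departed Q S ^~ t).
Proof. by move=> t0; exact: (adapted_at_departed pA pS cQ Qeq t0 (lexx t)). Qed.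

Let primitive_adapted t : 0 <= t ->
  measurable_fun (setT : set (g_sigma_algebraType (H t))) (fun w => primitive (Q ^~ w) t).
Proof.
move=> t0; apply: (adapted_at_integral pA pS cQ Qeq (g := id)) => //.
by move=> x; exact: cvg_id.
Qed.

Let arrival_adapted t : 0 <= t ->
  measurable_fun (setT : set (g_sigma_algebraType (H t))) (A t).
Proof. by move=> t0; exact: adapted_at_arrival. Qed.

Let arrival2 t : 0 <= t -> summable2 P (A t).
Proof. exact: (arrival_summable2 lam0 pA). Qed.

(** * Quadratic variations of the arrival martingale *)

Section arrivals.

Let M := M1 mu n A.
Let V (t : R) (_ : T) : R := lam * t / n%:R.

Let cM w : cadlag (M ^~ w).
Proof.
rewrite /M M1E; apply: cadlagZ; apply: cadlagB; first exact: counting_path_cadlag.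
by apply: continuous_cadlag; exact: mulrl_continuous.
Qed.

Let continuous_V w : continuous (V ^~ w).
Proof.
rewrite (_ : V ^~ w = fun t => lam / n%:R * t); first exact: mulrl_continuous.
by apply/funext => t; rewrite /V mulrAC.
Qed.

Let cV w : cadlag (V ^~ w).
Proof. exact/continuous_cadlag/continuous_V. Qed.

Let aM t : 0 <= t -> measurable_fun (setT : set (g_sigma_algebraType (H t))) (M t).
Proof.
move=> t0; rewrite /M M1E; apply: measurable_funM => //.
by apply: measurable_funB => //; exact: arrival_adapted.
Qed.

Let aV t : 0 <= t -> measurable_fun (setT : set (g_sigma_algebraType (H t))) (V t).
Proof. by move=> _; exact: measurable_cst. Qed.

Let Msq t : 0 <= t -> summable2 P (M t).
Proof.
move=> t0; rewrite /M M1E; apply: summable2Z; apply: summable2B; first exact: arrival2.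
exact: summable2_cst.
Qed.

Let V1 t : 0 <= t -> summable1 P (V t).
Proof. by move=> _; exact: summable1_cst. Qed.

Let MB s t w : M t w - M s w = c * arrival_noise lam A s t w.
Proof. by rewrite /M M1E /arrival_noise; ring. Qed.

Let noise s t B : 0 <= s -> s <= t -> <<s H s >> B ->
  mean_on P B (arrival_noise lam A s t) = 0 /\
  mean_on P B (fun w => arrival_noise lam A s t w ^+ 2) = lam * (t - s) * fine (P B).
Proof.
move=> s0 st sB; apply: (arrival_noise_moments lam0 pA pS mQ0 iG s0 st).
by apply: (generated_mono (@history_sub_arrival _ _ _ P Q A S s)).
Qed.

Let eM s t B : 0 <= s -> s <= t -> <<s H s >> B ->
  mean_on P B (fun w => M t w - M s w) = 0.
Proof.
move=> s0 st sB; under [X in mean_on _ _ X]eq_fun do rewrite MB.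
rewrite mean_onZ; [|exact: Hm sB|].
  by have [-> _] := noise s0 st sB; rewrite mulr0.
exact: summable2_summable1 (arrival_noise_summable2 lam0 pA s0 st).
Qed.

Let eV s t B : 0 <= s -> s <= t -> <<s H s >> B ->
  mean_on P B (fun w => (M t w - M s w) ^+ 2) = mean_on P B (fun w => V t w - V s w).
Proof.
move=> s0 st sB; under [X in mean_on _ _ X]eq_fun do rewrite MB exprMn c2.
rewrite mean_onZ; [|exact: Hm sB|exact: (arrival_noise_summable2 lam0 pA s0 st).2].
have [_ ->] := noise s0 st sB; rewrite /V mean_on_cst; last exact: Hm sB.
by move: (fine (P B)) => p; ring.
Qed.

Lemma M1_square_integrable : square_integrable_martingale P F (M1 mu n A).
Proof. exact: (increments_martingale Hm cM aM Msq eM). Qed.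

Let M1_compensated : martingale P F (fun t w => M1 mu n A t w ^+ 2 - V t w).
Proof. exact: (increments_compensated_martingale Hm cM cV aM aV Msq V1 eM eV). Qed.

Lemma M1_predictable_variation :
  is_predictable_quadratic_variation P F (M1 mu n A) (fun t _ => lam * t / n%:R).
Proof.
split; first exact: M1_square_integrable.
split.
- apply: left_continuous_predictable => [t t0|w t t0].
    by apply/measurable_wrtP; exact: aV.
  by apply: cvg_within_filter; exact: continuous_V.
- apply: aeW => w s t s0 st; apply/andP; split.
    by rewrite !mulr_ge0 ?invr_ge0// ltW.
  by rewrite ler_wpM2r ?invr_ge0// ler_wpM2l// ltW.
- by apply: aeW => w _; rewrite mulr0 mul0r.
- by move=> t t0; exact: expectation_lty (V1 t0).
- exact: M1_compensated.
Qed.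

Lemma M1_optional_variation :
  is_optional_quadratic_variation P F (M1 mu n A) (fun t w => A t w / n%:R).
Proof.
have mM := M1_square_integrable.1.
split; split.
- exact: (martingale_local (H := H)).
- apply: aeW => w; rewrite M1E mulr0 subr0.
  by have [-> _ _ _] := arrival_counting w; rewrite mulr0.
- move=> t t0; apply/measurable_wrtP; apply: measurable_funM => //.
  exact: arrival_adapted.
- move=> w; under eq_fun do rewrite mulrC.
  by apply: cadlagZ; exact: counting_path_cadlag.
- by apply: aeW => w; have [-> _ _ _] := arrival_counting w; rewrite mul0r.
- apply: aeW => w t t0; apply: nondecreasing_bounded_variation => x y.
  rewrite !in_itv/= => /andP[x0 _] _ xy; rewrite ler_wpM2r//.
  by have [_ _ + _] := arrival_counting w; apply.
- apply: filterS (ae_arrival_unit_jumps lam0 pA) => w uj t t0.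
  have [u [u0 ut Au]] := uj t t0.
  have Aj := simple_jump (arrival_counting w) u0 ut Au.
  have All := left_limitP (counting_path_cadlag (arrival_counting w)) t0.
  have -> : jump (fun s => A s w / n%:R) t = jump (A ^~ w) t / n%:R.
    rewrite /jump (@left_limit_cvg _ _ t (left_limit (A ^~ w) t / n%:R)) ?mulrBl//.
    by apply: cvgMl.
  have -> : jump (M1 mu n A ^~ w) t = c * jump (A ^~ w) t.
    rewrite M1E /jump (@left_limit_cvg _ _ t (c * (left_limit (A ^~ w) t - lam * t))).
      by ring.
    apply: cvgMr; apply: cvgB => //; apply: cvg_within_filter.
    exact: mulrl_continuous.
  by rewrite exprMn c2 Aj mulrC.
(* Here [M] - <M> is the centred count over n, that is c M, since [c ^+ 2 = n%:R^-1]. *)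
- rewrite (_ : (fun t w => _) = fun t w => (M1 mu n A t w ^+ 2 - V t w) - c * M1 mu n A t w).
    apply: (martingale_local (H := H)).
    exact: (martingaleB Hm c M1_compensated mM).
  apply/funext => t; apply/funext => w; rewrite M1E /V mulrA -expr2 c2.
  by ring.
Qed.

End arrivals.

(** * Quadratic variations of the departure martingale *)

Section departures.

Let M := M2 mu n Q S.
Let V (t : R) (w : T) : R :=
  mu / n%:R * \int[lebesgue_measure]_(s in `[0, t]) Q s w.

Let N := departure_martingale.

Let VE t w : V t w = mu / n%:R * primitive (Q ^~ w) t. Proof. by []. Qed.

Let N0 w : N 0 w = 0.
Proof.
by rewrite /N /departure_martingale primitive0 mulr0 subr0;
  have [-> _ _ _] := departed_counting w.
Qed.

Let cN w : cadlag (N ^~ w).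
Proof.
apply: cadlagB; first exact: counting_path_cadlag.
by apply: cadlagZ; exact: cadlag_primitive.
Qed.

Let cM w : cadlag (M ^~ w).
Proof. by rewrite /M M2E; exact: cadlagZ. Qed.

Let cV w : cadlag (V ^~ w).
Proof. by apply: cadlagZ; exact: (cadlag_primitive (cQ w)). Qed.

Let aN t : 0 <= t -> measurable_fun (setT : set (g_sigma_algebraType (H t))) (N t).
Proof.
move=> t0; apply: measurable_funB; first exact: departed_adapted.
by apply: measurable_funM => //; exact: primitive_adapted.
Qed.

Let aM t : 0 <= t -> measurable_fun (setT : set (g_sigma_algebraType (H t))) (M t).
Proof. by move=> t0; rewrite /M M2E; apply: measurable_funM => //; exact: aN. Qed.

Let aV t : 0 <= t -> measurable_fun (setT : set (g_sigma_algebraType (H t))) (V t).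
Proof. by move=> t0; apply: measurable_funM => //; exact: primitive_adapted. Qed.

Let ae_Q_ge0 : {ae P, forall w t, 0 <= t -> 0 <= Q t w}.
Proof. exact: (ae_queue_ge0 mu0 pA pS mQ0 Q0nat iG cQ Qeq). Qed.

Let ae_integral s t : 0 <= s -> s <= t -> {ae P, forall w,
  primitive (Q ^~ w) t - primitive (Q ^~ w) s = positive_queue_integral Q s t w}.
Proof.
move=> s0 st; apply: filterS ae_Q_ge0 => w Qw; rewrite primitiveB//.
apply: eq_Rintegral => r /set_mem /=; rewrite in_itv/= => /andP[sr _].
by rewrite max_l// Qw// (le_trans s0).
Qed.

(** Almost surely Q is nonnegative and the positive part disappears, so the moments found for
    [departure_noise] transfer to the process itself, which is defined through Q. *)
Let ae_increment s t : 0 <= s -> s <= t -> {ae P, forall w,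
  N t w - N s w = departure_noise mu Q S s t w}.
Proof.
move=> s0 st; apply: filterS (ae_integral s0 st) => w E.
rewrite /N /departure_martingale /departure_noise.
have -> : \int[lebesgue_measure]_(r in `[s, t]) Num.max (Q r w) 0 =
    primitive (Q ^~ w) t - primitive (Q ^~ w) s by rewrite E.
by move: (departed Q S w t) (departed Q S w s) (primitive _ t) (primitive _ s) => *; ring.
Qed.

Let N_measurable t : 0 <= t -> measurable_fun setT (N t).
Proof. by move=> t0; exact: measurable_fun_wrt (Hm (t := t)) (aN t0). Qed.

Let noise2 s t : 0 <= s -> s <= t -> summable2 P (departure_noise mu Q S s t).
Proof.
exact: (departure_noise_summable2 mu0 lam0 pA pS mQ0 Q0nat iG cQ Qeq Q0mean).
Qed.

Let increment2 s t : 0 <= s -> s <= t -> summable2 P (fun w => N t w - N s w).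
Proof.
move=> s0 st; have t0 := le_trans s0 st.
have mNB : measurable_fun setT (fun w => N t w - N s w).
  by apply: measurable_funB; exact: N_measurable.
split => //; apply: (summable1_ae _ _ (noise2 s0 st).2); first exact: measurable_funX.
by apply: filterS (ae_increment s0 st) => w ->.
Qed.

Let N2 t : 0 <= t -> summable2 P (N t).
Proof.
move=> t0; have := increment2 (lexx 0) t0.
by rewrite (_ : (fun w => N t w - N 0 w) = N t)//; apply/funext => w; rewrite N0 subr0.
Qed.

Let Msq t : 0 <= t -> summable2 P (M t).
Proof. by move=> t0; rewrite /M M2E; apply: summable2Z; exact: N2. Qed.

Let V_measurable t : 0 <= t -> measurable_fun setT (V t).
Proof. by move=> t0; exact: measurable_fun_wrt (Hm (t := t)) (aV t0). Qed.

Let positive_integral1 s t : 0 <= s -> s <= t -> summable1 P (positive_queue_integral Q s t).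
Proof.
exact: (positive_queue_integral_summable1 lam0 pA pS mQ0 Q0nat cQ Qeq Q0mean).
Qed.

Let ae_V s t : 0 <= s -> s <= t -> {ae P, forall w,
  V t w - V s w = mu / n%:R * positive_queue_integral Q s t w}.
Proof.
by move=> s0 st; apply: filterS (ae_integral s0 st) => w <-; rewrite !VE mulrBr.
Qed.

Let V1 t : 0 <= t -> summable1 P (V t).
Proof.
move=> t0; apply: (summable1_ae (V_measurable t0) _
  (summable1Z (mu / n%:R) (positive_integral1 (lexx 0) t0))).
by apply: filterS (ae_V (lexx 0) t0) => w <-; rewrite [V 0 w]VE primitive0 mulr0 subr0.
Qed.

Let eM s t B : 0 <= s -> s <= t -> <<s H s >> B ->
  mean_on P B (fun w => M t w - M s w) = 0.
Proof.
move=> s0 st sB; have mB := Hm sB.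
rewrite [X in mean_on _ _ X](_ : _ = fun w => c * (N t w - N s w)); last first.
  by apply/funext => w; rewrite /M M2E -mulrBr.
have i2 := increment2 s0 st.
rewrite mean_onZ//; last exact: summable2_summable1.
rewrite (mean_on_ae mB i2.1 (noise2 s0 st).1 (ae_increment s0 st)).
rewrite (departure_noise_mean mu0 lam0 pA pS mQ0 Q0nat iG cQ Qeq Q0mean s0 st sB).2.
by rewrite mulr0.
Qed.

Let eV s t B : 0 <= s -> s <= t -> <<s H s >> B ->
  mean_on P B (fun w => (M t w - M s w) ^+ 2) = mean_on P B (fun w => V t w - V s w).
Proof.
move=> s0 st sB; have mB := Hm sB; have t0 := le_trans s0 st.
rewrite [X in mean_on _ _ X](_ : _ = fun w => n%:R^-1 * (N t w - N s w) ^+ 2); last first.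
  by apply/funext => w; rewrite /M M2E -mulrBr exprMn c2.
have i2 := increment2 s0 st; have p1 := positive_integral1 s0 st.
rewrite mean_onZ//; last exact: i2.2.
have -> : mean_on P B (fun w => (N t w - N s w) ^+ 2) =
    mean_on P B (fun w => departure_noise mu Q S s t w ^+ 2).
  apply: mean_on_ae => //.
  - exact: measurable_funX i2.1.
  - exact: measurable_funX (noise2 s0 st).1.
  - by apply: filterS (ae_increment s0 st) => w ->.
rewrite (departure_noise_sqr_mean mu0 lam0 pA pS mQ0 Q0nat iG cQ Qeq Q0mean s0 st sB).
rewrite (mean_on_ae mB _ _ (ae_V s0 st)).
- by rewrite mean_onZ// mulrA [_^-1 * _]mulrC.
- by apply: measurable_funB; exact: V_measurable.
- exact: summable1_measurable (summable1Z _ p1).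
Qed.

Lemma M2_square_integrable : square_integrable_martingale P F (M2 mu n Q S).
Proof. exact: (increments_martingale Hm cM aM Msq eM). Qed.

Let M2_compensated : martingale P F (fun t w => M2 mu n Q S t w ^+ 2 - V t w).
Proof. exact: (increments_compensated_martingale Hm cM cV aM aV Msq V1 eM eV). Qed.

Lemma M2_variation_mean t : 0 <= t -> ('E_P[V t] < +oo)%E.
Proof. by move=> t0; exact: expectation_lty (V1 t0). Qed.

Lemma M2_predictable_variation :
  is_predictable_quadratic_variation P F (M2 mu n Q S) V.
Proof.
split; first exact: M2_square_integrable.
have k0 : 0 <= mu / n%:R by rewrite mulr_ge0 ?invr_ge0// ltW.
split.
- apply: left_continuous_predictable => [t t0|w t t0].
    by apply/measurable_wrtP; exact: aV.
  by apply: cvgMr; exact: (primitive_left (cQ w)).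
- apply: filterS ae_Q_ge0 => w Qw s t s0 st.
  have pos x y : 0 <= x -> 0 <= \int[lebesgue_measure]_(r in `[x, y]) Q r w.
    move=> x0; apply: Rintegral_ge0 => r /=; rewrite in_itv/= => /andP[xr _].
    by rewrite Qw// (le_trans x0).
  apply/andP; split; first by rewrite mulr_ge0// pos.
  rewrite ler_wpM2l// -subr_ge0.
  by have := primitiveB (cQ w) s0 st; rewrite /primitive => ->; exact: pos.
- by apply: aeW => w _; rewrite VE primitive0 mulr0.
- exact: M2_variation_mean.
- exact: M2_compensated.
Qed.

Lemma M2_optional_variation : is_optional_quadratic_variation P F (M2 mu n Q S)
  (fun t w => n%:R^-1 * fine (departures Q S t w)).
Proof.
have mM := M2_square_integrable.1.
have cD w := departed_counting w.
rewrite [X in is_optional_quadratic_variation _ _ _ X](_ : _ =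
  fun t w => n%:R^-1 * D t w)//.
split; split.
- exact: (martingale_local (H := H)).
- by apply: aeW => w; rewrite M2E [departure_martingale _ _]N0 mulr0.
- move=> t t0; apply/measurable_wrtP; apply: measurable_funM => //.
  exact: departed_adapted.
- by move=> w; apply: cadlagZ; exact: counting_path_cadlag.
- by apply: aeW => w; have [-> _ _ _] := cD w; rewrite mulr0.
- apply: aeW => w t t0; apply: nondecreasing_bounded_variation => x y.
  rewrite !in_itv/= => /andP[x0 _] _ xy; rewrite ler_wpM2l ?invr_ge0//.
  by have [_ _ + _] := cD w; apply.
- apply: filterS (ae_service_unit_jumps mu0 pA pS mQ0 iG) => w uj t t0.
  have Dj := departed_jump (arrival_counting w) (@service_counting w) (cQ w)
    (Q0nat w) (Qeq w) uj t0.
  have Dll := left_limitP (counting_path_cadlag (cD w)) t0.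
  set l := left_limit (departed Q S w) t in Dll.
  have -> : jump (fun s => n%:R^-1 * D s w) t = n%:R^-1 * jump (departed Q S w) t.
    by rewrite /jump (@left_limit_cvg _ _ t (n%:R^-1 * l)) ?mulrBr//; apply: cvgMr.
  (* The compensator is continuous, so the jumps of the martingale are those of the departures,
     scaled by c. *)
  have -> : jump (M2 mu n Q S ^~ w) t = c * jump (departed Q S w) t.
    rewrite M2E /jump (@left_limit_cvg _ _ t (c * (l - mu * primitive (Q ^~ w) t))).
      rewrite /departure_martingale -/l; move: (departed Q S w t) (primitive _ t) => *.
      by ring.
    apply: cvgMr; apply: cvgB => //; apply: cvgMr; exact: (primitive_left (cQ w)).
  by rewrite exprMn c2 Dj.
- rewrite (_ : (fun t w => _) = fun t w =>
    (M2 mu n Q S t w ^+ 2 - V t w) - c * M2 mu n Q S t w).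
    apply: (martingale_local (H := H)).
    exact: (martingaleB Hm c M2_compensated mM).
  apply/funext => t; apply/funext => w; rewrite M2E VE mulrA -expr2 c2.
  rewrite /departure_martingale; move: (departed Q S w t) (primitive _ t) => *.
  by ring.
Qed.

End departures.

End many_server_queue.

Unset Implicit Arguments.

Theorem theorem3p5 (d : measure_display) (T : measurableType d) (R : realType)
  (P : probability T R) (mu : R)
  (A Q S : nat -> R -> T -> R)
  (mu_gt0 : 0 < mu)
  (A_poisson : forall n, (1 <= n)%N ->
    poisson_process P (arrival_rate mu n) (A n))
  (S_poisson : forall k, (1 <= k)%N -> poisson_process P mu (S k))
  (Q0_measurable : forall n, (1 <= n)%N -> measurable_fun setT (Q n 0))
  (Q0_nat : forall n w, (1 <= n)%N -> Q n 0 w \is a Num.nat)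
  (independence : forall n, (1 <= n)%N ->
    mutually_independent P (source (Q n) (A n) S))
  (Q_cadlag : forall n w, (1 <= n)%N -> cadlag (Q n ^~ w))
  (Q_equation : forall n w t, (1 <= n)%N -> 0 <= t ->
    ((Q n t w)%:E = (Q n 0 w + A n t w)%:E - departures (Q n) S t w)%E)
  (Q0_mean : forall n, (1 <= n)%N -> ('E_P[Q n 0%R] < +oo)%E) :
  forall n : nat, (1 <= n)%N ->
    let F := history P (Q n) (A n) S in
    let X := scaled_queue n (Q n) in
    let Mn1 := M1 mu n (A n) in
    let Mn2 := M2 mu n (Q n) S in
    let qv2 := fun (t : R) (w : T) =>
      mu / n%:R * \int[lebesgue_measure]_(s in `[0, t]) Q n s w in
    (forall w t, 0 <= t ->
       X t w = X 0 w + Mn1 t w - Mn2 t w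
               - mu * \int[lebesgue_measure]_(s in `[0, t]) X s w) /\
    (square_integrable_martingale P F Mn1 /\
     square_integrable_martingale P F Mn2) /\
    (is_predictable_quadratic_variation P F Mn1
       (fun t _ => arrival_rate mu n * t / n%:R) /\
     (forall t, 0 <= t -> arrival_rate mu n * t / n%:R = mu * t) /\
     is_predictable_quadratic_variation P F Mn2 qv2 /\
     (forall t, 0 <= t -> ('E_P[qv2 t] < +oo)%E)) /\
    (is_optional_quadratic_variation P F Mn1 (fun t w => A n t w / n%:R) /\
     is_optional_quadratic_variation P F Mn2
       (fun t w => n%:R^-1 * fine (departures (Q n) S t w))).
Proof.
move=> n n1 F X Mn1 Mn2 qv2.
have pA := A_poisson n n1; have mQ0 := Q0_measurable n n1.
have Qn := fun w => Q0_nat n w n1; have iG := independence n n1.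
have cQ := fun w => Q_cadlag n w n1.
have Qeq := fun w t => Q_equation n w t n1.
have EQ := Q0_mean n n1.
split; [|split; [|split]].
- by move=> w t; exact: (scaled_queue_equation mu n cQ Qeq).
- split; first exact: (M1_square_integrable mu_gt0 n1 pA S_poisson mQ0 iG).
  exact: (M2_square_integrable mu_gt0 n1 pA S_poisson mQ0 Qn iG cQ Qeq EQ).
- split; first exact: (M1_predictable_variation mu_gt0 n1 pA S_poisson mQ0 iG).
  split; first by move=> t _; rewrite /arrival_rate; field; rewrite pnatr_eq0 -lt0n.
  split; first exact: (M2_predictable_variation mu_gt0 n1 pA S_poisson mQ0 Qn iG cQ Qeq EQ).
  by move=> t; exact: (M2_variation_mean mu_gt0 n1 pA S_poisson mQ0 Qn iG cQ Qeq EQ).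
- split; first exact: (M1_optional_variation mu_gt0 n1 pA S_poisson mQ0 iG).
  exact: (M2_optional_variation mu_gt0 n1 pA S_poisson mQ0 Qn iG cQ Qeq EQ).
Qed.
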